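(* Let $(X_t)$ be of class $(\Sigma)$, $X_t=N_t+A_t=\dfrac{M_t}{I_t}-1$, where $M$ is the unique strictly positive continuous local martingale with $M_0=1$ giving this representation and $I_t=\inf_{s\le t}M_s$. Define $$U_t=\int_0^t\frac{dM_s}{M_s}=\int_0^t\frac{dN_s}{1+X_s}.$$ Then the following properties are equivalent: (1) $(X_t)$ is of class $(\Sigma D)$; (2) $(M_t)$ is a uniformly integrable martingale and $\mathbb{E}\left(\dfrac{M_\infty}{I_\infty}\right)<\infty$; (3) $(M_t)$ is a uniformly integrable martingale and $\mathbb{E}\left(\log\left(\dfrac{1}{I_\infty}\right)\right)<\infty$; (4) $(M_t)$ is a uniformly integrable martingale and $(U_t)$ is an $L^2$ bounded martingale.
   Context: All processes live on a filtered probability space $(\Omega,\mathcal{F},(\mathcal{F}_t)_{t\ge0},\mathbb{P})$ satisfying the usual assumptions. A nonnegative local submartingale $X$ with decomposition $X_t=N_t+A_t$ is of class $(\Sigma)$ if: (i) $(N_t)$ is a continuous local martingale with $N_0=0$; (ii) $(A_t)$ is a continuous (adapted) increasing process with $A_0=0$; (iii) the measure $(dA_t)$ is carried by $\{t: X_t=0\}$. It is of class $(\Sigma D)$ if it is moreover of class $(D)$, i.e. $\{X_T: T\text{ a finite stopping time}\}$ is uniformly integrable. For every $X$ of class $(\Sigma)$ there is a unique strictly positive continuous local martingale $M$ with $M_0=1$ such that $X_t=M_t/I_t-1$ with $I_t=\inf_{s\le t}M_s$; it is $M_t=(1+X_t)e^{-A_t}$. $M_\infty=\lim_{t\to\infty}M_t$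 (a.s.) and $I_\infty=\inf_{s\ge0}M_s$; $1/I_\infty=\log(1/I_\infty)=+\infty$ where $I_\infty=0$, and $M_\infty/I_\infty=M_\infty\cdot(1/I_\infty)$ is computed with the convention $0\cdot\infty=0$. *)

(* Defs.v *)
From HB Require Import structures.
From mathcomp Require Import all_boot all_order all_algebra.
From mathcomp Require Import all_classical all_reals all_analysis.

Set Implicit Arguments.
Unset Strict Implicit.
Unset Printing Implicit Defensive.
Import Order.TTheory GRing.Theory Num.Theory.
Import numFieldNormedType.Exports.

Local Open Scope classical_set_scope.
Local Open Scope ring_scope.

(* A real process is a map X : R -> Omega -> R, of which only the values at times
   t >= 0 are meaningful: every quantification over time is restricted to
   [0, +oo[.  Pathwise properties are required almost surely. *)

Section StochasticProcesses.
Context {R : realType} {d : measure_display} {Omega : measurableType d}.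
Implicit Types (P : probability Omega R) (F : R -> set (set Omega)).
Implicit Types (X Y Z U H N A M : R -> Omega -> R).

Definition usual_filtration P F :=
  [/\ forall t, 0 <= t ->
        sigma_algebra [set: Omega] (F t) /\ F t `<=` measurable,
      forall s t, 0 <= s -> s <= t -> F s `<=` F t,
      forall t, 0 <= t -> F t = \bigcap_(s in [set s | t < s]) F s
    & forall E : set Omega, P.-negligible E -> F 0 E].

Definition rv_measurable (G : set (set Omega)) (f : Omega -> R) :=
  forall B : set R, measurable B -> G (f @^-1` B).

Definition adapted F X := forall t, 0 <= t -> rv_measurable (F t) (X t).

Definition continuous_paths P X :=
  {ae P, forall w, {within `[0, +oo[, continuous (fun t => X t w)}}.

Definition stopping_time F (tau : Omega -> \bar R) :=
  (forall w, (0 <= tau w)%E) /\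
  (forall t, 0 <= t -> F t [set w | (tau w <= t%:E)%E]).

Definition stopped X (tau : Omega -> \bar R) : R -> Omega -> R :=
  fun t w => X (fine (Order.min t%:E (tau w))) w.

(* The last clause says that X s is (a version of) E[X t | F s]. *)
Definition martingale P F X :=
  [/\ adapted F X,
      forall t, 0 <= t -> P.-integrable [set: Omega] (EFin \o X t)
    & forall s t E, 0 <= s -> s <= t -> F s E ->
        (\int[P]_(w in E) (X s w)%:E = \int[P]_(w in E) (X t w)%:E)%E].

Definition submartingale P F X :=
  [/\ adapted F X,
      forall t, 0 <= t -> P.-integrable [set: Omega] (EFin \o X t)
    & forall s t E, 0 <= s -> s <= t -> F s E ->
        (\int[P]_(w in E) (X s w)%:E <= \int[P]_(w in E) (X t w)%:E)%E].

Definition localized P F (C : set (R -> Omega -> R)) X :=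
  adapted F X /\
  exists tau : nat -> Omega -> \bar R,
    [/\ forall n, stopping_time F (tau n),
        {ae P, forall w, forall n, (tau n w <= tau n.+1 w)%E},
        {ae P, forall w, tau n w @[n --> \oo] --> +oo%E}
      & forall n, C (fun t w => stopped X (tau n) t w - X 0 w)].

Definition local_submartingale P F := localized P F (submartingale P F).

Definition continuous_local_martingale P F X :=
  localized P F (martingale P F) X /\ continuous_paths P X.

Definition unif_integrable P (C : set (Omega -> R)) :=
  forall e : R, 0 < e -> exists c : R, forall f, C f ->
    (\int[P]_(w in [set w | (c < `|f w|)%R]) `|f w|%:E <= e%:E)%E.

Definition ui_martingale P F X :=
  martingale P F X /\ unif_integrable P [set X t | t in `[0, +oo[].

Definition L2_bounded_martingale P F X :=
  martingale P F X /\
  exists K : R, forall t, 0 <= t -> (\int[P]_w ((X t w) ^+ 2)%:E <= K%:E)%E.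

Definition class_D P F X :=
  unif_integrable P [set (fun w => X (T w) w) |
                     T in [set T : Omega -> R | stopping_time F (EFin \o T)]].

Definition continuous_increasing P F A :=
  [/\ adapted F A, continuous_paths P A
    & {ae P, forall w, forall s t, 0 <= s -> s <= t -> A s w <= A t w}].

(* The path of A is extended to negative times by its value at 0, so that its
   Lebesgue-Stieltjes measure is the measure dA on [0, +oo[ without an atom
   at 0. *)
Definition carried_by_zeros P A X :=
  {ae P, forall w, exists f : cumulative R R,
     (forall t, f t = A (Num.max 0 t) w) /\
     lebesgue_stieltjes_measure f [set t | 0 <= t /\ X t w != 0] = 0%E}.

Record Sigma_decomposition P F X N A : Prop := {
  Sigma_ge0 : {ae P, forall w, forall t, 0 <= t -> 0 <= X t w};
  Sigma_local_submartingale : local_submartingale P F X;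
  Sigma_eq : {ae P, forall w, forall t, 0 <= t -> X t w = N t w + A t w};
  Sigma_N : continuous_local_martingale P F N;
  Sigma_N0 : {ae P, forall w, N 0 w = 0};
  Sigma_A : continuous_increasing P F A;
  Sigma_A0 : {ae P, forall w, A 0 w = 0};
  Sigma_carried : carried_by_zeros P A X }.

Definition class_Sigma P F X := exists N A, Sigma_decomposition P F X N A.

Definition class_SigmaD P F X := class_Sigma P F X /\ class_D P F X.

Definition running_inf M : R -> Omega -> R :=
  fun t w => inf [set M s w | s in `[0, t]].

Definition inf_infty M : Omega -> R :=
  fun w => inf [set M s w | s in `[0, +oo[].

Definition lim_infty M : Omega -> R := fun w => lim (M t w @[t --> +oo]).

(* The integrand \sum_k h_k \1_(t_k, t_(k+1)] with deterministic times t_k and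
   F_(t_k)-measurable coefficients h_k. *)
Record simple_integrand F := SimpleIntegrand {
  si_size : nat;
  si_time : nat -> R;
  si_coef : nat -> Omega -> R;
  si_time_ge0 : 0 <= si_time 0%N;
  si_time_nd : forall k, si_time k <= si_time k.+1;
  si_coef_meas : forall k, rv_measurable (F (si_time k)) (si_coef k) }.

Definition si_process F (J : simple_integrand F) : R -> Omega -> R :=
  fun t w => \sum_(k < si_size J)
    si_coef J k w * (si_time J k < t <= si_time J k.+1)%R%:R.

Definition si_integral F (J : simple_integrand F) Z : R -> Omega -> R :=
  fun t w => \sum_(k < si_size J)
    si_coef J k w *
      (Z (Num.min (si_time J k.+1) t) w - Z (Num.min (si_time J k) t) w).

(* Convergence in probability, uniformly on each ]0, t].
   Time 0 is left out because simple integrands vanish there. *)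
Definition ucp_cvg P (Y : nat -> R -> Omega -> R) Z :=
  forall t e : R, 0 <= t -> 0 < e ->
    P [set w | exists2 s, 0 < s <= t & e < `|Y n s w - Z s w|]
      @[n --> \oo] --> 0%E.

(* U is the Ito integral \int_0^. H dZ of the continuous adapted H against the
   continuous semimartingale Z: the ucp-continuous extension to H of the
   elementary integral of simple integrands.  A continuous adapted H is a
   ucp limit of simple integrands, so this determines U up to
   indistinguishability. *)
Definition is_stochastic_integral P F H Z U :=
  [/\ adapted F H /\ continuous_paths P H,
      adapted F U /\ continuous_paths P U,
      {ae P, forall w, U 0 w = 0}
    & forall J : nat -> simple_integrand F,
        ucp_cvg P (fun n => si_process (J n)) H ->
        ucp_cvg P (fun n => si_integral (J n) Z) U].

End StochasticProcesses.

(* Main.v *)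
(* On a path of M, d(M/I) + d(log I) = dM/I because I decreases only where
   M = I; hence N = M/I + log I - 1, A = log (1/I), and dN/(1+X) = dM/M.
   Let T be a stopping time at which all the processes stay bounded.  Taking
   expectations in X = N + A gives E X_T = E log (1/I_T), and expanding log M
   along a fine grid shows that E U_T^2 is comparable with -E log M_T, where
   log M = log (1+X) - log (1/I).  So all four properties amount to a bound on
   E X_T uniform in T:
   - uniform integrability of X gives it, and passes to M <= 1 + X;
   - by Fatou it is equivalent to E log (1/I_oo) < oo, and it implies
     E (M_oo/I_oo) < oo;
   - if M is uniformly integrable, 1 + X_s = M_s/I_s is dominated by M_oo/I_oo
     on the events of F_s, so that X is of class (D);
   - -log M <= log (1/I) bounds E U_T^2, and conversely
     log (1+X) <= (1+X)/2 turns E X_T = E log (1+X_T) - E log M_T into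
     E X_T <= 1 - 2 E log M_T. *)
Require Import Defs.
From HB Require Import structures.
From mathcomp Require Import all_boot all_order all_algebra.
From mathcomp Require Import all_classical all_reals all_analysis.
From mathcomp Require Import ring lra zify.

Set Implicit Arguments.
Unset Strict Implicit.
Unset Printing Implicit Defensive.
Import Order.TTheory GRing.Theory Num.Theory.
Import numFieldNormedType.Exports.
Import measurable_realfun.

Local Open Scope classical_set_scope.
Local Open Scope ring_scope.

(** * Random variables measurable for a sub-sigma-algebra *)

(** The integral U is known only through ucp limits of simple integrals, so there is no Ito formula
    to start from. Every identity between continuous processes is proved for finite sums along a
    grid and carried to the limit by bounded convergence in probability; hence everything is stopped
    at bounded levels, and the grid sums are killed once they leave their bounds. For the same
    reason E U_T^2 = -2 E log M_T is replaced by two inequalities with constants 8 and 2, which come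
    from comparing x - log(1+x) with x^2 for |x| at most 1/2. The equality N = M/I + log I - 1 is a
    uniqueness statement: the difference A + log I is at once a local martingale and of bounded
    variation, hence zero. That dN/(1+X) integrates to the same U is obtained by subdividing an
    arbitrary sequence of simple integrands. Almost sure hypotheses become sure ones by overwriting
    all processes on a single negligible set, which leaves them adapted because [F 0] contains the
    negligible sets. *)

Section SigmaAlgebraMeasurability.
Context {R : realType} {d} {T : measurableType d} (G : set (set T)).
Hypothesis sG : sigma_algebra [set: T] G.
Implicit Types f g : T -> R.

Lemma measurable_sigmaE : @measurable _ (g_sigma_algebraType G) = G.
Proof. exact: measurable_g_measurableTypeE. Qed.

(** [g_sigma_algebraType] turns [G] into a measurable type, through which the closure properties of
    measurable functions are inherited by [rv_measurable]. *)
Lemma rvP f : rv_measurable G f <->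
  measurable_fun [set: g_sigma_algebraType G] (f : g_sigma_algebraType G -> R).
Proof.
split=> [h _ B mB|h B mB].
  by rewrite setTI measurable_sigmaE; exact: h.
by rewrite -measurable_sigmaE -[X in measurable X]setTI; exact: h.
Qed.

Lemma rv_cst c : rv_measurable G (fun=> c : R).
Proof. by apply/rvP; exact: measurable_cst. Qed.

Lemma rvD f g : rv_measurable G f -> rv_measurable G g ->
  rv_measurable G (fun w => f w + g w).
Proof. by move=> /rvP mf /rvP mg; apply/rvP/measurable_funD. Qed.

Lemma rvB f g : rv_measurable G f -> rv_measurable G g ->
  rv_measurable G (fun w => f w - g w).
Proof. by move=> /rvP mf /rvP mg; apply/rvP/measurable_funB. Qed.

Lemma rvM f g : rv_measurable G f -> rv_measurable G g ->
  rv_measurable G (fun w => f w * g w).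
Proof. by move=> /rvP mf /rvP mg; apply/rvP/measurable_funM. Qed.

Lemma rvX f n : rv_measurable G f -> rv_measurable G (fun w => f w ^+ n).
Proof. by move=> /rvP mf; apply/rvP/measurable_funX. Qed.

Lemma rv_comp (h : R -> R) f : measurable_fun setT h -> rv_measurable G f ->
  rv_measurable G (fun w => h (f w)).
Proof. by move=> mh /rvP mf; apply/rvP/(measurableT_comp mh). Qed.

Lemma rv_sum (I : Type) (s : seq I) (h : I -> T -> R) :
  (forall i, rv_measurable G (h i)) ->
  rv_measurable G (fun w => \sum_(i <- s) h i w).
Proof. by move=> mh; apply/rvP/measurable_sum => i; exact/rvP. Qed.

Lemma rv_min f g : rv_measurable G f -> rv_measurable G g ->
  rv_measurable G (fun w => Num.min (f w) (g w)).
Proof. by move=> /rvP mf /rvP mg; apply/rvP/measurable_minr. Qed.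

Lemma rv_norm f : rv_measurable G f -> rv_measurable G (fun w => `|f w|).
Proof. by apply: rv_comp; exact: normr_measurable. Qed.

(** Continuity gives measurability off 0 only; the point 0, where the inverse takes its default
    value, is added as a measurable singleton. *)
Lemma measurable_funV : measurable_fun setT (@GRing.inv R).
Proof.
have mU : measurable ([set~ 0] : set R) by exact: measurableC.
have m1 : measurable_fun ([set~ 0] : set R) (@GRing.inv R); last first.
  have := (measurable_funU (@GRing.inv R) mU (measurable_set1 0)).2.
  by rewrite setUC setUv; apply; split=> //; exact: measurable_fun_set1.
apply: open_continuous_measurable_fun.
  by rewrite openC; exact: closed_eq.
by move=> x; rewrite inE => /eqP x0; exact: inv_continuous.
Qed.

Lemma rvV f : rv_measurable G f -> rv_measurable G (fun w => (f w)^-1).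
Proof. by apply: rv_comp; exact: measurable_funV. Qed.

Lemma rv_ln f : rv_measurable G f -> rv_measurable G (fun w => ln (f w)).
Proof. by apply: rv_comp; exact: measurable_ln. Qed.

Lemma rv_indic E : G E -> rv_measurable G (\1_E : T -> R).
Proof. by move=> GE; apply/rvP/measurable_indic; rewrite measurable_sigmaE. Qed.

Lemma rv_cvg (h : nat -> T -> R) f : (forall n, rv_measurable G (h n)) ->
  (forall w, h n w @[n --> \oo] --> f w) -> rv_measurable G f.
Proof.
move=> mh hf; apply/rvP; apply: (@measurable_fun_cvg _ (g_sigma_algebraType G) R setT h).
  by move=> n; exact/rvP.
by move=> w _; exact: hf.
Qed.

Lemma sigma_le f g : rv_measurable G f -> rv_measurable G g ->
  G [set w | f w <= g w].
Proof.
move=> /rvP mf /rvP mg; rewrite -measurable_sigmaE.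
by rewrite -[X in measurable X]setTI; exact: measurable_fun_le.
Qed.

Lemma sigmaC E : G E -> G (~` E).
Proof. by rewrite -measurable_sigmaE; exact: measurableC. Qed.

Lemma sigmaI E E' : G E -> G E' -> G (E `&` E').
Proof. by rewrite -measurable_sigmaE; exact: measurableI. Qed.

Lemma sigmaU E E' : G E -> G E' -> G (E `|` E').
Proof. by rewrite -measurable_sigmaE; exact: measurableU. Qed.

Lemma sigmaD E E' : G E -> G E' -> G (E `\` E').
Proof. by rewrite -measurable_sigmaE; exact: measurableD. Qed.

Lemma sigmaT : G setT.
Proof. by rewrite -measurable_sigmaE. Qed.

Lemma sigma0 : G set0.
Proof. by rewrite -measurable_sigmaE. Qed.

Lemma sigma_lt f g : rv_measurable G f -> rv_measurable G g ->
  G [set w | f w < g w].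
Proof.
move=> mf mg; rewrite (_ : [set w | _] = ~` [set w | g w <= f w]).
  exact/sigmaC/sigma_le.
by apply/seteqP; split=> w /=; [rewrite ltNge => /negP|move/negP; rewrite -ltNge].
Qed.

Lemma sigma_bigcap (E : nat -> set T) : (forall n, G (E n)) -> G (\bigcap_n E n).
Proof. by rewrite -measurable_sigmaE => h; exact: bigcapT_measurable. Qed.

Lemma sigma_bigcup_rat (E : rat -> set T) :
  (forall n, G (E n)) -> G (\bigcup_n E n).
Proof. by rewrite -measurable_sigmaE => h; exact: bigcupT_measurable_rat. Qed.

Lemma sigma_forall (k : nat) (E : nat -> set T) : (forall n, (n < k)%N -> G (E n)) ->
  G [set w | forall n, (n < k)%N -> E n w].
Proof.
elim: k => [_|k ih hE]; first by rewrite (_ : [set w | _] = setT);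
    [exact: sigmaT|apply/seteqP; split].
rewrite (_ : [set w | _] = [set w | forall n, (n < k)%N -> E n w] `&` E k).
  by apply: sigmaI; [apply: ih => n nk; apply: hE; exact: ltnW|exact: hE].
apply/seteqP; split=> w /=.
  by move=> h; split; [move=> n nk; apply: h; exact: ltnW|exact: h].
by move=> [h Ek] n; rewrite ltnS leq_eqVlt => /predU1P[->//|]; exact: h.
Qed.

End SigmaAlgebraMeasurability.

Section MeasurableSets.
Context {R : realType} {d} {T : measurableType d}.
Implicit Types f g : T -> R.

Lemma mfun_rv f : measurable_fun setT f <-> rv_measurable measurable f.
Proof.
split=> [h B mB|h _ B mB]; first by rewrite -[X in measurable X]setTI; exact: h.
by rewrite setTI; exact: h.
Qed.

Lemma measurable_lt f g : measurable_fun setT f -> measurable_fun setT g ->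
  measurable [set w | f w < g w].
Proof.
by move=> /mfun_rv mf /mfun_rv mg; apply: sigma_lt => //; exact: sigma_algebra_measurable.
Qed.

Lemma measurable_norm f : measurable_fun setT f -> measurable_fun setT (fun w => `|f w|).
Proof. by move=> mf; apply: measurableT_comp mf; exact: normr_measurable. Qed.

End MeasurableSets.

(** * Expectations and convergence in probability *)

(** [Lone P f] reads: f is in L^1(P). [Ex P f] is the expectation as a real number; [ExE] ties it to
    the extended integral for integrable f. *)
Notation Lone P f := (P.-integrable setT (EFin \o f)).
Notation Ex P f := (Rintegral P setT f).

Section Expectation.
Context {R : realType} {d} {Omega : measurableType d} (P : probability Omega R).
Implicit Types f g : Omega -> R.

Lemma Lone_bdd c f : measurable_fun setT f -> (forall w, `|f w| <= c) ->
  Lone P f.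
Proof.
move=> mf fc; have Ic := finite_measure_integrable_cst P c.
apply: (@le_integrable _ _ _ P setT measurableT _ (cst c%:E)).
- exact/measurable_EFinP.
- by move=> w _ /=; rewrite lee_fin (le_trans (fc w)) ?ler_norm.
- exact: Ic.
Qed.

Lemma Lone_meas f : Lone P f -> measurable_fun setT f.
Proof. by move=> /integrableP[/measurable_EFinP]. Qed.

Lemma LoneD f g : Lone P f -> Lone P g -> Lone P (fun w => f w + g w).
Proof. by move=> If Ig; exact: (integrableD measurableT If Ig). Qed.

Lemma LoneB f g : Lone P f -> Lone P g -> Lone P (fun w => f w - g w).
Proof. by move=> If Ig; exact: (integrableB measurableT If Ig). Qed.

Lemma LoneZ k f : Lone P f -> Lone P (fun w => k * f w).
Proof. by move=> If; exact: (integrableZl measurableT k If). Qed.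

Lemma Lone_cst c : Lone P (fun=> c).
Proof. by apply: (@Lone_bdd `|c|). Qed.

Lemma Lone_le f g : measurable_fun setT f -> (forall w, `|f w| <= g w) ->
  Lone P g -> Lone P f.
Proof.
move=> mf fg; apply: le_integrable => //; first exact/measurable_EFinP.
by move=> w _ /=; rewrite lee_fin (le_trans (fg w)) ?ler_norm.
Qed.

Lemma Lone_abs f : Lone P f -> Lone P (fun w => `|f w|).
Proof. exact: integrable_norm. Qed.

Lemma LoneM_bdd c f g : Lone P f -> measurable_fun setT g ->
  (forall w, `|g w| <= c) -> Lone P (fun w => g w * f w).
Proof.
move=> If mg gc; apply: (@Lone_le _ (fun w => c * `|f w|)).
- exact: measurable_funM mg (Lone_meas If).
- by move=> w; rewrite normrM ler_wpM2r.
- exact/LoneZ/Lone_abs.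
Qed.

Lemma Lone_sum (I : Type) (s : seq I) (h : I -> Omega -> R) :
  (forall i, Lone P (h i)) -> Lone P (fun w => \sum_(i <- s) h i w).
Proof.
move=> Ih; have := @integrable_sum _ _ _ P setT measurableT I s xpredT
  (fun i => EFin \o h i) (fun i _ => Ih i).
by apply: eq_integrable => // w _; rewrite /= sumEFin.
Qed.

Lemma ExE f : Lone P f -> (\int[P]_w (f w)%:E)%E = (Ex P f)%:E.
Proof. by move=> If; rewrite /Rintegral fineK//; exact: integrable_fin_num. Qed.

Lemma ExD f g : Lone P f -> Lone P g ->
  Ex P (fun w => f w + g w) = Ex P f + Ex P g.
Proof. by move=> If Ig; rewrite RintegralD. Qed.

Lemma ExB f g : Lone P f -> Lone P g ->
  Ex P (fun w => f w - g w) = Ex P f - Ex P g.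
Proof. by move=> If Ig; rewrite RintegralB. Qed.

Lemma ExZ k f : Lone P f -> Ex P (fun w => k * f w) = k * Ex P f.
Proof. by move=> If; rewrite RintegralZl. Qed.

Lemma Ex_cst c : Ex P (fun=> c) = c.
Proof.
transitivity (c * fine (P setT)); first exact: Rintegral_cst.
by rewrite probability_setT mulr1.
Qed.

Lemma eq_Ex f g : f =1 g -> Ex P f = Ex P g.
Proof. by move=> /funext ->. Qed.

Lemma Ex_sum (I : Type) (s : seq I) (h : I -> Omega -> R) :
  (forall i, Lone P (h i)) ->
  Ex P (fun w => \sum_(i <- s) h i w) = \sum_(i <- s) Ex P (h i).
Proof.
move=> Ih; elim: s => [|a s ih].
  by rewrite big_nil -[RHS](Ex_cst 0); apply: eq_Ex => w; rewrite big_nil.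
rewrite big_cons -ih -ExD; [|exact: Ih|exact: Lone_sum].
by apply: eq_Ex => w; rewrite big_cons.
Qed.

Lemma Ex_le f g : Lone P f -> Lone P g -> (forall w, f w <= g w) ->
  Ex P f <= Ex P g.
Proof. by move=> If Ig fg; apply: le_Rintegral. Qed.

Lemma Ex_ge0 f : (forall w, 0 <= f w) -> 0 <= Ex P f.
Proof. by move=> f0; apply: Rintegral_ge0. Qed.

Lemma Ex_abs f : Lone P f -> `|Ex P f| <= Ex P (fun w => `|f w|).
Proof. by move=> If; apply: le_normr_Rintegral. Qed.

Lemma Ex_indic E : measurable E -> (Ex P (\1_E : Omega -> R))%:E = P E.
Proof.
move=> mE; rewrite -ExE; last first.
  by apply: (@Lone_bdd 1) => // w; rewrite ger0_norm ?ler0n// lern1 leq_b1.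
by rewrite integral_indic// setIT.
Qed.

Lemma int_indic E f : measurable E -> Lone P f ->
  (\int[P]_(w in E) (f w)%:E)%E = (Ex P (fun w => \1_E w * f w))%:E.
Proof.
move=> mE If; rewrite -ExE; last first.
  by apply: (@LoneM_bdd 1) => // w; rewrite ger0_norm ?ler0n// lern1 leq_b1.
rewrite integral_mkcond; apply: eq_integral => w _.
rewrite /patch indicE; case: ifPn => wE; first by rewrite mul1r.
by rewrite mul0r.
Qed.

Lemma Ex_cvg_bdd c (f_ : nat -> Omega -> R) f :
  (forall n, measurable_fun setT (f_ n)) ->
  (forall n w, `|f_ n w| <= c) ->
  (forall w, f_ n w @[n --> \oo] --> f w) ->
  Ex P (f_ n) @[n --> \oo] --> Ex P f.
Proof.
move=> mf fc cf.
have mf0 : measurable_fun setT f by apply: measurable_fun_cvg mf _ => w _; exact: cf.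
have [] := @dominated_convergence _ _ _ P setT measurableT (fun n => EFin \o f_ n)
  (EFin \o f) (cst c%:E).
- by move=> n; apply/measurable_EFinP; exact: mf.
- exact/measurable_EFinP.
- by apply: nearW => w _; apply: cvg_EFin; [exact: nearW|exact: cf].
- exact: Lone_cst.
- by apply: nearW => w n _ /=; rewrite lee_fin; exact: fc.
move=> If _ cv.
have -> : (fun n => Ex P (f_ n)) = fine \o (fun n => \int[P]_x (f_ n x)%:E)%E by [].
apply: fine_cvg; rewrite -ExE//; exact: cv.
Qed.

(** The limit g takes extended values because the lemma has to serve log(1/I_oo), which may be
    infinite. *)
Lemma fatou_le K (f_ : nat -> Omega -> R) (g : Omega -> \bar R) :
  (forall n, measurable_fun setT (f_ n)) -> (forall n w, 0 <= f_ n w) ->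
  measurable_fun setT g -> (forall w, 0 <= g w)%E ->
  (forall w, (g w <= limn_einf (fun n => (f_ n w)%:E))%E) ->
  (forall n, (\int[P]_w (f_ n w)%:E <= K%:E)%E) ->
  (\int[P]_w g w <= K%:E)%E.
Proof.
move=> mf f0 mg g0 gl fK.
have mef n : measurable_fun setT (EFin \o f_ n) by exact/measurable_EFinP.
apply: (@le_trans _ _ (\int[P]_w limn_einf (fun n => (f_ n w)%:E))%E).
  apply: ge0_le_integral => //.
  apply: measurableT_comp => //; apply: measurable_fun_limn_esup => n.
  by apply: measurableT_comp => //; exact: mef.
apply: le_trans.
  by apply: fatou => // n w _ /=; rewrite lee_fin.
rewrite limn_einf_lim; apply: lime_le; first exact: is_cvg_einfs.
apply: nearW => n; apply: le_trans (fK n).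
by apply: ereal_inf_lbound; exists n => /=.
Qed.

Lemma fatou_cvg K (f_ : nat -> Omega -> R) f :
  (forall n, measurable_fun setT (f_ n)) -> (forall n w, 0 <= f_ n w) ->
  (forall w, f_ n w @[n --> \oo] --> f w) ->
  (forall n, (\int[P]_w (f_ n w)%:E <= K%:E)%E) ->
  (\int[P]_w (f w)%:E <= K%:E)%E.
Proof.
move=> mf f0 cf; apply: (@fatou_le _ f_ (fun w => (f w)%:E)) => //.
- by apply/measurable_EFinP; apply: measurable_fun_cvg mf _ => w _; exact: cf.
- move=> w; rewrite lee_fin -(cvg_lim (@Rhausdorff R) (cf w)).
  by apply: limr_ge; [apply/cvg_ex; exists (f w); exact: cf|exact: nearW].
- move=> w; have cfE : (f_ n w)%:E @[n --> \oo] --> (f w)%:E.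
    by apply: cvg_EFin; [exact: nearW|exact: cf].
  by have [->] := cvg_limn_einf_sup cfE.
Qed.

(** Outer-measure form of P(S n) --> 0. It requires no measurability of S n and therefore passes to
    arbitrary subsets. *)
Definition small (S : nat -> set Omega) := forall e, 0 < e ->
  exists n0, forall n, (n0 <= n)%N ->
    exists B, [/\ measurable B, S n `<=` B & (P B <= e%:E)%E].

Lemma small_sub S S' : (forall n, S n `<=` S' n) -> small S' -> small S.
Proof.
move=> SS' + e e0 => /(_ e e0)[n0 h]; exists n0 => n /h[B [mB SB PB]].
by exists B; split=> //; exact: subset_trans SB.
Qed.

Lemma smallU S S' : small S -> small S' -> small (fun n => S n `|` S' n).
Proof.
move=> h h' e e0.
have [n0 {}h] := h _ (divr_gt0 e0 (ltr0n _ 2)).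
have [n1 {}h'] := h' _ (divr_gt0 e0 (ltr0n _ 2)).
exists (maxn n0 n1) => n; rewrite geq_max => /andP[/h[B [mB SB PB]] /h'[B' [mB' SB' PB']]].
exists (B `|` B'); split; [exact: measurableU|exact: setUSS|].
apply: le_trans (measureU2 _ mB mB') _.
by rewrite [e]splitr EFinD leeD.
Qed.

Lemma small_cvg S : (forall n, measurable (S n)) -> small S <-> P (S n) @[n --> \oo] --> 0%E.
Proof.
move=> mS; split=> [h|h e e0].
  apply/fine_cvgP; split.
    by apply: nearW => n; exact: fin_num_measure.
  apply/cvgrPdist_le => e e0; have [n0 {}h] := h _ e0.
  exists n0 => // n /h[B [mB SB PB]] /=.
  rewrite sub0r normrN ger0_norm ?fine_ge0//.
  rewrite -lee_fin fineK ?fin_num_measure//.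
  by apply: le_trans PB; apply: le_measure; rewrite ?inE.
have /fine_cvgP[_ /cvgrPdist_le/(_ _ e0)[n0 _ {}h]] := h.
exists n0 => n /h /=; rewrite sub0r normrN ger0_norm ?fine_ge0// => hn.
by exists (S n); split=> //; rewrite -[leLHS]fineK ?fin_num_measure// lee_fin.
Qed.

Lemma small_pointwise S : (forall n, measurable (S n)) ->
  (forall w, \forall n \near \oo, ~ S n w) -> small S.
Proof.
move=> mS h; apply/small_cvg => //.
have hc : Ex P (\1_(S n) : Omega -> R) @[n --> \oo] --> Ex P (fun=> 0 : R).
  apply: (@Ex_cvg_bdd 1) => //.
  - by move=> n w; rewrite ger0_norm ?ler0n// lern1 leq_b1.
  - move=> w; apply: cvg_near_cst.
    near=> n; rewrite indicE memNset//; near: n; exact: h.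
have -> : (fun n => P (S n)) = (fun n => (Ex P (\1_(S n) : Omega -> R))%:E).
  by apply/funext => n; rewrite Ex_indic.
by apply: cvg_EFin; [exact: nearW|move: hc; rewrite Ex_cst].
Unshelve. all: by end_near. Qed.

(** Bounded convergence under convergence in probability: the difference is at most e/2 off the
    exceptional set and at most 2c on it. *)
Lemma Ex_cvg_small c (f_ : nat -> Omega -> R) f :
  (forall n, measurable_fun setT (f_ n)) -> measurable_fun setT f ->
  (forall n w, `|f_ n w| <= c) -> (forall w, `|f w| <= c) ->
  (forall e, 0 < e -> small (fun n => [set w | e < `|f_ n w - f w|])) ->
  Ex P (f_ n) @[n --> \oo] --> Ex P f.
Proof.
move=> mf_ mf fc_ fc hs.
have c0 : 0 <= c by rewrite (le_trans _ (fc point)).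
have If_ n : Lone P (f_ n) by exact: Lone_bdd (mf_ n) (fc_ n).
have If : Lone P f by exact: Lone_bdd fc.
apply/cvgrPdist_le => e e0.
have e2 : 0 < e / 2 by rewrite divr_gt0.
(* The summand 1 keeps the divisor positive when c = 0. *)
have c2 : 0 < 2 * c + 1 by rewrite ltr_wpDl ?mulr_ge0.
have [n0 h] := hs _ e2 _ (divr_gt0 e2 c2).
exists n0 => // n /h[B [mB SB PB]] /=.
have IB : Lone P (\1_B : Omega -> R).
  by apply: (@Lone_bdd 1) => // w; rewrite ger0_norm ?ler0n// lern1 leq_b1.
rewrite -ExB//; apply: le_trans (Ex_abs _) _; first exact: LoneB.
apply: (@le_trans _ _ (Ex P (fun w => e / 2 + (2 * c + 1) * \1_B w))).
  apply: Ex_le; [exact/Lone_abs/LoneB|by apply: LoneD; [exact: Lone_cst|exact: LoneZ]|].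
  move=> w; rewrite indicE; have [wB|wB] := boolP (w \in B).
    rewrite mulr1 (le_trans (ler_normB _ _))// (le_trans (lerD (fc w) (fc_ n w)))//.
    by lra.
  rewrite mulr0 addr0 leNgt; apply/negP => hw; move/negP: wB; apply.
  by rewrite inE; apply: SB => /=; rewrite distrC.
rewrite ExD; [|exact: Lone_cst|exact: LoneZ].
rewrite Ex_cst ExZ// [leRHS]splitr lerD2l mulrC -ler_pdivlMr//.
by rewrite -lee_fin Ex_indic.
Qed.

Lemma Lone_indic E : measurable E -> Lone P (\1_E : Omega -> R).
Proof. by move=> mE; apply: (@Lone_bdd 1) => // w; rewrite ger0_norm ?ler0n// lern1 leq_b1. Qed.

End Expectation.

(** * Uniform integrability *)

Section Tails.
Context {R : realType}.
Implicit Types x c : R.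

(** [tail c x] is (|x| - c)^+, a continuous substitute for |x| restricted to |x| > c: being
    Lipschitz it respects pointwise limits, so bounds on its expectation pass to the limit by Fatou.
    [clip] is the complementary truncation, at distance [tail c x] from x. *)
Definition tail c x : R := Num.max 0 (`|x| - c).
Definition clip c x : R := Num.max (- c) (Num.min c x).

Lemma tail_ge0 c x : 0 <= tail c x.
Proof. by rewrite /tail le_max lexx. Qed.

Lemma tail_le_norm c x : 0 <= c -> tail c x <= `|x|.
Proof. by move=> c0; rewrite /tail ge_max normr_ge0/= gerBl. Qed.

Lemma norm_le_tail c x : `|x| <= c + tail c x.
Proof. by rewrite -lerBlDl /tail le_max lexx orbT. Qed.

Lemma tail0 x : tail 0 x = `|x|.
Proof. by rewrite /tail subr0; apply/max_idPr. Qed.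

Lemma norm_clip_le c x : 0 <= c -> `|clip c x| <= c.
Proof.
move=> c0; rewrite /clip /Num.max /Num.min ler_norml.
by case: (ltP c x) => ?; case: ltP => ?; apply/andP; split; lra.
Qed.

Lemma norm_sub_clip c x : 0 <= c -> `|x - clip c x| = tail c x.
Proof.
move=> c0; rewrite /clip /tail /Num.max /Num.min.
have [x0|x0] := leP 0 x; [rewrite (ger0_norm x0)|rewrite (ltr0_norm x0)];
  case: (ltP c x) => ?; case: ltP => ?; case: ltP => ?; first [by rewrite ger0_norm; lra|by rewrite ler0_norm; lra].
Qed.

Lemma clip_lip c x y : `|clip c x - clip c y| <= `|x - y|.
Proof.
wlog h : x y / y <= x => [hw|].
  by have [/hw//|/ltW/hw] := leP y x; rewrite distrC [`|y - x|]distrC.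
rewrite /clip /Num.max /Num.min [leRHS]ger0_norm ?subr_ge0// ler_norml.
by case: (ltP c x) => ?; case: (ltP c y) => ?; case: ltP => ?; case: ltP => ?; apply/andP; split; lra.
Qed.

Lemma tail_lip c x y : `|tail c x - tail c y| <= `|x - y|.
Proof.
apply: le_trans (ler_dist_dist x y); rewrite /tail; move: `|x| `|y| => {}x {}y.
wlog h : x y / y <= x => [hw|].
  by have [/hw//|/ltW/hw] := leP y x; rewrite distrC [`|y - x|]distrC.
rewrite /Num.max [leRHS]ger0_norm ?subr_ge0// ler_norml.
by case: ltP => ?; case: ltP => ?; apply/andP; split; lra.
Qed.

Lemma lip_continuous (f : R -> R) : (forall x y, `|f x - f y| <= `|x - y|) ->
  continuous f.
Proof.
move=> h x; apply/cvgrPdist_le => e e0; near=> y.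
apply: le_trans (h _ _) _; near: y.
exact: cvgr_dist_le.
Unshelve. all: by end_near. Qed.

Lemma tail_continuous c : continuous (tail c).
Proof. by apply: lip_continuous => x y; exact: tail_lip. Qed.

Lemma clip_continuous c : continuous (clip c).
Proof. by apply: lip_continuous => x y; exact: clip_lip. Qed.

End Tails.

Section UniformIntegrability.
Context {R : realType} {d} {Omega : measurableType d} (P : probability Omega R).
Implicit Types f g : Omega -> R.

Lemma measurable_tail c f : measurable_fun setT f ->
  measurable_fun setT (fun w => tail c (f w)).
Proof.
move=> mf; apply: measurableT_comp mf.
by apply: continuous_measurable_fun; exact: tail_continuous.
Qed.

Lemma measurable_clip c f : measurable_fun setT f ->
  measurable_fun setT (fun w => clip c (f w)).
Proof.
move=> mf; apply: measurableT_comp mf.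
by apply: continuous_measurable_fun; exact: clip_continuous.
Qed.

Lemma Lone_tail c f : 0 <= c -> Lone P f -> Lone P (fun w => tail c (f w)).
Proof.
move=> c0 If; apply: (@Lone_le _ _ _ _ _ (fun w => `|f w|)).
- exact/measurable_tail/Lone_meas/If.
- by move=> w; rewrite ger0_norm ?tail_ge0// tail_le_norm.
- exact: Lone_abs.
Qed.

Lemma Lone_of_tail c e f : measurable_fun setT f ->
  (\int[P]_w (tail c (f w))%:E <= e%:E)%E -> Lone P f.
Proof.
move=> mf h; apply: (@Lone_le _ _ _ _ _ (fun w => c + tail c (f w))) => //.
  by move=> w; exact: norm_le_tail.
apply: LoneD; first exact: Lone_cst.
apply/integrableP; split; first exact/measurable_EFinP/measurable_tail.
rewrite (eq_integral (fun w => (tail c (f w))%:E)); last first.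
  by move=> w _ /=; rewrite ger0_norm ?tail_ge0.
by rewrite (le_lt_trans h)// ltry.
Qed.

Definition ui_tail (C : set (Omega -> R)) := forall e : R, 0 < e ->
  exists2 c : R, 0 <= c &
    forall f, C f -> (\int[P]_w (tail c (f w))%:E <= e%:E)%E.

Lemma unif_integrable_tail C : (forall f, C f -> measurable_fun setT f) ->
  unif_integrable P C -> ui_tail C.
Proof.
move=> mC h e e0; have [c {}h] := h e e0.
(* The level given by uniform integrability may be negative, whereas [ui_tail] asks for c >= 0. *)
exists (Num.max c 0); first by rewrite le_max lexx orbT.
move=> f Cf; apply: le_trans (h f Cf); have mf := mC f Cf.
rewrite [leRHS]integral_mkcond; apply: ge0_le_integral => //.
- by move=> w _; rewrite lee_fin tail_ge0.
- exact/measurable_EFinP/measurable_tail.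
- apply/(measurable_restrictT _ _).1.
    by apply: measurable_lt => //; exact: measurable_norm.
  by apply/measurable_EFinP/measurable_funTS/measurable_norm.
- move=> w _; rewrite /patch; case: ifPn => wc; rewrite lee_fin.
    by rewrite tail_le_norm// le_max lexx orbT.
  rewrite /tail ge_max lexx subr_le0 le_max leNgt; apply/orP; left; apply/negP => cw.
  by move/negP: wc; apply; rewrite inE.
Qed.

Lemma tail_unif_integrable C : (forall f, C f -> measurable_fun setT f) ->
  ui_tail C -> unif_integrable P C.
Proof.
move=> mC h e e0; have [c c0 {}h] := h _ (divr_gt0 e0 (ltr0n _ 2)).
(* Where |x| > 2c, the value |x| is at most twice (|x| - c). *)
exists (2 * c) => f Cf; have mf := mC f Cf.
apply: (@le_trans _ _ (\int[P]_w (2%:E * (tail c (f w))%:E))%E).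
  rewrite integral_mkcond; apply: ge0_le_integral => //.
  - by move=> w _; rewrite /patch; case: ifP => //; rewrite lee_fin.
  - apply/(measurable_restrictT _ _).1.
      by apply: measurable_lt => //; exact: measurable_norm.
    by apply/measurable_EFinP/measurable_funTS/measurable_norm.
  - by apply/measurable_EFinP/measurable_funM => //; exact: measurable_tail.
  - move=> w _; rewrite /patch; case: ifPn => wc; rewrite -EFinM lee_fin.
      move: wc; rewrite inE/= => wc.
      by have := norm_le_tail c (f w); lra.
    by rewrite mulr_ge0// tail_ge0.
rewrite ge0_integralZl_EFin//; last 2 first.
- by move=> w _; rewrite lee_fin tail_ge0.
- exact/measurable_EFinP/measurable_tail.
rewrite -(@fineK _ (\int[P]_w _)%E); last first.
  rewrite ge0_fin_numE ?(le_lt_trans (h f Cf)) ?ltry//.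
  by apply: integral_ge0 => w _; rewrite lee_fin tail_ge0.
rewrite -EFinM lee_fin; have := h f Cf; rewrite -lee_fin.
rewrite -[in X in X -> _](@fineK _ (\int[P]_w _)%E); last first.
  rewrite ge0_fin_numE ?(le_lt_trans (h f Cf)) ?ltry//.
  by apply: integral_ge0 => w _; rewrite lee_fin tail_ge0.
by rewrite !lee_fin; lra.
Qed.

(** The clipped parts converge by bounded convergence, and what clipping removes is uniformly small.
    The weight g is there for indicators of events and other bounded test functions. *)
Lemma vitali (f_ : nat -> Omega -> R) f :
  (forall n, measurable_fun setT (f_ n)) ->
  (forall w, f_ n w @[n --> \oo] --> f w) ->
  ui_tail (range f_) ->
  [/\ forall n, Lone P (f_ n), Lone P f &
    forall b g, measurable_fun setT g -> (forall w, `|g w| <= b) ->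
      Ex P (fun w => g w * f_ n w) @[n --> \oo] --> Ex P (fun w => g w * f w)].
Proof.
move=> mf_ cf ui.
have mf : measurable_fun setT f by apply: measurable_fun_cvg mf_ _ => w _; exact: cf.
(* By Fatou the limit obeys every tail bound common to the sequence. *)
have tf c e : (forall n, (\int[P]_w (tail c (f_ n w))%:E <= e%:E)%E) ->
    (\int[P]_w (tail c (f w))%:E <= e%:E)%E.
  move=> h; apply: (@fatou_cvg _ _ _ P e (fun n w => tail c (f_ n w))) => //.
  - by move=> n; exact: measurable_tail.
  - by move=> n w; exact: tail_ge0.
  - move=> w; apply: (@cvg_comp _ _ _ (fun n => f_ n w) (tail c)); first exact: cf.
    exact: tail_continuous.
have If_ n : Lone P (f_ n).
  have [c c0 h] := ui 1 ltr01; apply: (Lone_of_tail (mf_ n) (h _ _)).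
  by exists n.
have If : Lone P f.
  have [c c0 h] := ui 1 ltr01; apply: (@Lone_of_tail c 1 f mf).
  by apply: tf => n; apply: h; exists n.
split=> // b g mg gb; apply/cvgrPdist_le => e e0.
have b0 : 0 <= b by rewrite (le_trans _ (gb point)).
have b1 : 0 < b + 1 by rewrite ltr_wpDl.
(* Three errors of at most e/3 will be added, two of them being tails weighted by |g| <= b; b + 1 is
   positive even if b = 0. *)
have e3 : 0 < e / (3 * (b + 1)) by rewrite divr_gt0// mulr_gt0.
have [c c0 h] := ui _ e3.
have cg : Ex P (fun w => g w * clip c (f_ n w)) @[n --> \oo] -->
          Ex P (fun w => g w * clip c (f w)).
  apply: (@Ex_cvg_bdd _ _ _ _ (b * c)).
  - by move=> n; apply: measurable_funM => //; exact: measurable_clip.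
  - by move=> n w; rewrite normrM ler_pM// norm_clip_le.
  - move=> w; apply: cvgMr; apply: (@cvg_comp _ _ _ (fun n => f_ n w) (clip c)).
      exact: cf.
    exact: clip_continuous.
have key h0 : Lone P h0 -> (\int[P]_w (tail c (h0 w))%:E <= (e / (3 * (b + 1)))%:E)%E ->
    `|Ex P (fun w => g w * h0 w) - Ex P (fun w => g w * clip c (h0 w))| <= e / 3.
  move=> Ih ht.
  have Igh : Lone P (fun w => g w * h0 w) by apply: LoneM_bdd Ih mg gb.
  have Igc : Lone P (fun w => g w * clip c (h0 w)).
    apply: (@Lone_bdd _ _ _ _ (b * c)).
      by apply: measurable_funM => //; apply: measurable_clip; exact: Lone_meas Ih.
    by move=> w; rewrite normrM ler_pM// norm_clip_le.
  rewrite -ExB//; apply: le_trans (Ex_abs _) _; first exact: LoneB.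
  apply: (@le_trans _ _ (Ex P (fun w => b * tail c (h0 w)))).
    apply: Ex_le; [exact/Lone_abs/LoneB|exact/LoneZ/Lone_tail|].
    by move=> w; rewrite -mulrBr normrM norm_sub_clip// ler_wpM2r ?tail_ge0.
  rewrite ExZ; last exact: Lone_tail.
  move: ht; rewrite ExE ?lee_fin; last exact: Lone_tail.
  move=> ht; have := ler_wpM2l b0 ht; move=> /le_trans; apply.
  rewrite (_ : b * (e / (3 * (b + 1))) = (e / 3) * (b / (b + 1))); last by field; rewrite gt_eqF.
  rewrite ler_piMr//; first by rewrite divr_ge0// ltW.
  by rewrite ler_pdivrMr// mul1r lerDl.
have e30 : 0 < e / 3 by rewrite divr_gt0.
move/cvgrPdist_le : cg => /(_ _ e30)[n0 _ hn]; exists n0 => // n /hn /= hc.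
have k1 := key f If (tf _ _ (fun n => h _ (imageP _ I))).
have k2 := key (f_ n) (If_ n) (h _ (imageP _ I)).
rewrite (_ : _ - _ = (Ex P (fun w => g w * f w) - Ex P (fun w => g w * clip c (f w)))
   + (Ex P (fun w => g w * clip c (f w)) - Ex P (fun w => g w * clip c (f_ n w)))
   - (Ex P (fun w => g w * f_ n w) - Ex P (fun w => g w * clip c (f_ n w)))); last by lra.
apply: le_trans (ler_normB _ _) _; apply: le_trans (lerD (ler_normD _ _) k2) _.
by move: k1 hc; lra.
Qed.

Lemma Ex_cvg_dom (f_ : nat -> Omega -> R) f g :
  (forall n, measurable_fun setT (f_ n)) ->
  (forall n w, `|f_ n w| <= g w) -> Lone P g ->
  (forall w, f_ n w @[n --> \oo] --> f w) ->
  Ex P (f_ n) @[n --> \oo] --> Ex P f.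
Proof.
move=> mf fc Ig cf.
have mf0 : measurable_fun setT f by apply: measurable_fun_cvg mf _ => w _; exact: cf.
have [] := @dominated_convergence _ _ _ P setT measurableT (fun n => EFin \o f_ n)
  (EFin \o f) (EFin \o g).
- by move=> n; apply/measurable_EFinP; exact: mf.
- exact/measurable_EFinP.
- by apply: nearW => w _; apply: cvg_EFin; [exact: nearW|exact: cf].
- exact: Ig.
- by apply: nearW => w n _ /=; rewrite lee_fin; exact: fc.
move=> If _ cv.
have -> : (fun n => Ex P (f_ n)) = fine \o (fun n => \int[P]_x (f_ n x)%:E)%E by [].
apply: fine_cvg; rewrite -ExE//; exact: cv.
Qed.

Lemma Ex_tail_cvg0 z e : Lone P z -> 0 < e ->
  exists2 b, 0 <= b & Ex P (fun w => tail b (z w)) <= e.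
Proof.
move=> Iz e0.
have : Ex P (fun w => tail n%:R (z w)) @[n --> \oo] --> Ex P (fun=> 0 : R).
  apply: (@Ex_cvg_dom _ _ (fun w => `|z w|)).
  - by move=> n; exact/measurable_tail/Lone_meas/Iz.
  - by move=> n w; rewrite ger0_norm ?tail_ge0// tail_le_norm.
  - exact: Lone_abs.
  - move=> w; apply: cvg_near_cst; near=> n.
    rewrite /tail; apply/max_idPl; rewrite subr_le0.
    near: n; exact: nbhs_infty_ger.
rewrite Ex_cst => /cvgrPdist_le/(_ _ e0)[n _ /(_ n (leqnn n))] /=.
rewrite sub0r normrN => h; exists n%:R => //.
by rewrite (le_trans _ h)// ler_norm.
Unshelve. all: by end_near. Qed.

End UniformIntegrability.

(** * Stopping along a grid *)

Section Orthogonality.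
Context {R : realType}.

Lemma sum_indicator_full (k : nat) (x : R) : k%:R <= x ->
  \sum_(i < k) ((i.+1%:R <= x)%R%:R : R) = k%:R.
Proof.
move=> kx; rewrite (eq_bigr (fun=> 1)); first by rewrite sumr_const card_ord.
by move=> i _; rewrite (le_trans _ kx)// ler_nat.
Qed.

(** In this range the sum is the integer part of x. *)
Lemma sum_indicator_floor (k : nat) (x : R) : 0 <= x <= k%:R ->
  `|x - \sum_(i < k) ((i.+1%:R <= x)%R%:R : R)| <= 1.
Proof.
elim: k => [/andP[x0 x1]|k ih /andP[x0 x1]].
  by rewrite big_ord0 subr0 ger0_norm// (le_trans x1).
rewrite big_ord_recr/=; have [xk|kx] := leP x k%:R.
  rewrite (_ : (k.+1%:R <= x) = false) ?addr0; last first.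
    by apply/negbTE; rewrite -ltNge (le_lt_trans xk) ?ltr_nat.
  by apply: ih; rewrite x0.
rewrite sum_indicator_full; last exact: ltW.
move: x1; rewrite -natr1; have [h h'|h h'] := leP (k%:R + 1) x.
  by rewrite /= mulr1n ler_norml; apply/andP; split; lra.
by rewrite /= mulr0n ler_norml; apply/andP; split; lra.
Qed.

Context {d} {Omega : measurableType d} (P : probability Omega R).
Variable G : set (set Omega).
Hypothesis sG : sigma_algebra [set: Omega] G.
Hypothesis Gm : G `<=` measurable.
Implicit Types f g Z : Omega -> R.

Lemma rv_mfun f : rv_measurable G f -> measurable_fun setT f.
Proof. by move=> mf; apply/mfun_rv => B mB; exact/Gm/mf. Qed.

(** Orthogonality to indicators extends to step functions by linearity and to g by dominated
    convergence, g being uniformly approximated by step functions. *)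
Lemma Ex_orth_ge0 c Z g : Lone P Z ->
  (forall E, G E -> Ex P (fun w => \1_E w * Z w) = 0) ->
  rv_measurable G g -> (forall w, 0 <= g w <= c) ->
  Ex P (fun w => g w * Z w) = 0.
Proof.
move=> IZ Z0 mg gc.
have [N cN] : exists N : nat, c <= N%:R.
  by exists (Num.truncn c).+1; apply/ltW/truncnS_gt.
(* The integer part of (n+1) g divided by n+1, written as a combination of indicators of events of
   [G]; it is within 1/(n+1) of g. *)
pose gn n w : R := n.+1%:R^-1 *
  \sum_(i < (N * n.+1)%N) ((i.+1%:R <= n.+1%:R * g w)%R%:R : R).
have n0 n : 0 < n.+1%:R :> R by rewrite ltr0n.
have gnE n w : gn n w = \sum_(i < (N * n.+1)%N)
    n.+1%:R^-1 * \1_[set w | i.+1%:R <= n.+1%:R * g w] w.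
  by rewrite /gn mulr_sumr; apply: eq_bigr => i _; rewrite indicE mem_setE.
have mE n (i : nat) : G [set w | i.+1%:R <= n.+1%:R * g w].
  by apply: sigma_le => //; [exact: rv_cst|apply: rvM => //; exact: rv_cst].
have dist n w : `|g w - gn n w| <= n.+1%:R^-1.
  rewrite -(ler_pM2l (n0 n)) mulfV ?gt_eqF// -[X in X * _](@ger0_norm _ n.+1%:R)//.
  rewrite -normrM mulrBr /gn mulrA mulfV ?gt_eqF// mul1r.
  apply: sum_indicator_floor; have /andP[g0 g1] := gc w.
  rewrite mulr_ge0//= natrM mulrC ler_wpM2r// (le_trans g1)//.
have mgn n : rv_measurable G (gn n).
  rewrite (_ : gn n = fun w => \sum_(i < (N * n.+1)%N)
    n.+1%:R^-1 * \1_[set w | i.+1%:R <= n.+1%:R * g w] w); last by apply/funext => w; exact: gnE.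
  by apply: rv_sum => // i; apply: rvM => //; [exact: rv_cst|exact: rv_indic].
have Egn n : Ex P (fun w => gn n w * Z w) = 0.
  rewrite (_ : (fun w => _) = fun w => \sum_(i < (N * n.+1)%N)
    n.+1%:R^-1 * (\1_[set w | i.+1%:R <= n.+1%:R * g w] w * Z w)); last first.
    by apply/funext => w; rewrite gnE mulr_suml; apply: eq_bigr => i _; rewrite mulrA.
  have Ii (i : 'I_(N * n.+1)) : Lone P (fun w => \1_[set w | i.+1%:R <= n.+1%:R * g w] w * Z w).
    apply: (@LoneM_bdd _ _ _ _ 1) => //; first exact/measurable_indic/Gm.
    by move=> w; rewrite ger0_norm ?ler0n// lern1 leq_b1.
  rewrite Ex_sum => [|i]; last exact: LoneZ.
  by apply: big1 => i _; rewrite ExZ// Z0 ?mulr0.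
have IgZ : Lone P (fun w => g w * Z w).
  apply: (@LoneM_bdd _ _ _ _ c) => //; first exact: rv_mfun.
  by move=> w; have /andP[g0 g1] := gc w; rewrite ger0_norm.
have cv : Ex P (fun w => gn n w * Z w) @[n --> \oo] --> Ex P (fun w => g w * Z w).
  apply: (@Ex_cvg_dom _ _ _ _ _ _ (fun w => (c + 1) * `|Z w|)).
  - by move=> n; apply: measurable_funM; [exact: rv_mfun|exact: Lone_meas IZ].
  - move=> n w; rewrite normrM ler_wpM2r//.
    rewrite (_ : gn n w = g w - (g w - gn n w)); last by lra.
    have /andP[g0 g1] := gc w.
    rewrite (le_trans (ler_normB _ _))// lerD//; first by rewrite ger0_norm.
    by rewrite (le_trans (dist n w))// invf_le1// ler1n.
  - exact/LoneZ/Lone_abs.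
  - move=> w; apply: cvgMl; apply/cvgrPdist_le => e e0.
    near=> n; rewrite (le_trans (dist n w))//.
    near: n; have /cvgrPdist_le/(_ _ e0) := @cvg_harmonic R.
    by apply: filterS => n /=; rewrite sub0r normrN ger0_norm// invr_ge0.
have e : (fun n => Ex P (fun w => gn n w * Z w)) = fun=> 0 by apply/funext.
by move: cv; rewrite e => cv; exact: (cvg_unique (@Rhausdorff R) cv (cvg_cst _)).
Unshelve. all: by end_near. Qed.

Lemma Ex_orth c Z g : Lone P Z ->
  (forall E, G E -> Ex P (fun w => \1_E w * Z w) = 0) ->
  rv_measurable G g -> (forall w, `|g w| <= c) ->
  Ex P (fun w => g w * Z w) = 0.
Proof.
move=> IZ Z0 mg gc.
(* Adding c makes the test function nonnegative; the constant is itself orthogonal to Z. *)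
have -> : (fun w => g w * Z w) = (fun w => (g w + c) * Z w - c * Z w).
  by apply/funext => w; ring.
have h1 : Ex P (fun w => (g w + c) * Z w) = 0.
  apply: (@Ex_orth_ge0 (c + c)) => //.
    by apply: rvD => //; exact: rv_cst.
  by move=> w; have := gc w; rewrite ler_norml => /andP[? ?]; apply/andP; split; lra.
have h2 : Ex P Z = 0.
  rewrite -[RHS](Z0 setT); last exact: sigmaT.
  by apply: eq_Ex => w; rewrite indicT mul1r.
rewrite ExB ?h1 ?ExZ ?h2 ?mulr0 ?subr0//; last exact: LoneZ.
apply: (@LoneM_bdd _ _ _ _ (c + c)) => //.
  by apply: measurable_funD => //; exact: rv_mfun.
by move=> w; have := gc w; rewrite !ler_norml => /andP[? ?]; apply/andP; split; lra.
Qed.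

End Orthogonality.

(** * Discrete optional stopping *)

Section GridStopping.
Context {R : realType} {d} {Omega : measurableType d} (P : probability Omega R).
Variable F : R -> set (set Omega).
Hypothesis sF : forall t, 0 <= t -> sigma_algebra [set: Omega] (F t).
Hypothesis Fm : forall t, 0 <= t -> F t `<=` measurable.
Hypothesis Fmono : forall s t, 0 <= s -> s <= t -> F s `<=` F t.
Variables (m : nat) (u : nat -> R) (p : nat -> Omega -> bool).
Hypothesis u0 : forall k, 0 <= u k.
Hypothesis und : forall i j, (i <= j)%N -> u i <= u j.
Hypothesis Fp : forall k, F (u k) [set w | p k w].
Implicit Types Z : R -> Omega -> R.

(* The first index k < m at which p k holds, and m if there is none. *)
Definition first_index w := find (fun k => p k w) (iota 0 m).

Lemma first_index_le w : (first_index w <= m)%N.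
Proof. by rewrite /first_index -{2}(size_iota 0 m) find_size. Qed.

Lemma first_index_lt k w : (k < first_index w)%N -> ~~ p k w.
Proof.
move=> km; have := before_find 0%N km; rewrite nth_iota ?add0n => [->//|].
exact: leq_trans km (first_index_le w).
Qed.

Lemma first_index_p w : (first_index w < m)%N -> p (first_index w) w.
Proof.
move=> h; have := @nth_find _ 0%N (fun k => p k w) (iota 0 m).
rewrite has_find size_iota => /(_ h).
by rewrite nth_iota ?add0n.
Qed.

Lemma first_indexP k w : (k <= m)%N ->
  (first_index w = k) <->
  (forall j, (j < k)%N -> ~~ p j w) /\ ((k < m)%N -> p k w).
Proof.
move=> km; split=> [<-|[h1 h2]].
  by split; [move=> j; exact: first_index_lt|exact: first_index_p].
apply/eqP; rewrite eqn_leq; apply/andP; split; rewrite leqNgt; apply/negP => h.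
  by have := h2 (leq_trans h (first_index_le w)); apply/negP/first_index_lt.
by have /negP := h1 _ h; apply; apply: first_index_p; exact: leq_trans h km.
Qed.

Lemma first_index_meas k : (k <= m)%N -> F (u k) [set w | first_index w = k].
Proof.
move=> km; have suk := sF (u0 k).
rewrite (_ : [set w | _] = [set w | forall j, (j < k)%N -> (~` [set w | p j w]) w] `&`
    [set w | (k < m)%N -> p k w]); last first.
  apply/seteqP; split=> w /=; rewrite first_indexP//.
    by move=> [h1 h2]; split=> // j /h1/negP.
  by move=> [h1 h2]; split=> // j /h1/negP.
apply: sigmaI => //.
  apply: sigma_forall => // j jk; apply: sigmaC => //.
  by apply: (Fmono (u0 j) (und (ltnW jk))); exact: Fp.
case: (ltnP k m) => h.
  rewrite (_ : [set w | _] = [set w | p k w]); first exact: Fp.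
  by apply/seteqP; split=> w /=; [exact|].
rewrite (_ : [set w | _] = setT); first exact: sigmaT.
by apply/seteqP; split.
Qed.

Definition grid_stop Z w := Z (u (first_index w)) w.

Lemma first_index_sum (a : nat -> R) w : a (first_index w) =
  \sum_(k < m.+1) \1_[set w | first_index w = k] w * a k.
Proof.
have lt : (first_index w < m.+1)%N by rewrite ltnS first_index_le.
rewrite (bigD1 (Ordinal lt))//= indicE mem_set// mul1r big1 ?addr0// => i ik.
rewrite indicE memNset ?mul0r//= => h1; move/negP: ik; apply.
by apply/eqP/val_inj => /=.
Qed.

Lemma measurable_grid_stop Z :
  (forall k, measurable_fun setT (Z (u k))) -> measurable_fun setT (grid_stop Z).
Proof.
move=> mZ; rewrite (_ : grid_stop Z = fun w =>
  \sum_(k < m.+1) \1_[set w | first_index w = k] w * Z (u k) w); last first.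
  by apply/funext => w; rewrite -(first_index_sum (fun k => Z (u k) w)).
apply: measurable_sum => k; apply: measurable_funM => //.
by apply: measurable_indic; apply: (Fm (u0 k)); apply: first_index_meas; rewrite -ltnS.
Qed.

Lemma indicM (A B : set Omega) w : \1_A w * \1_B w = \1_(A `&` B) w :> R.
Proof. by rewrite -[RHS]/((\1_(A `&` B) : Omega -> R) w) indicI. Qed.

(** The event that the index equals k belongs to [F (u k)], so that Z (u k) may be exchanged for Y
    on it; the pieces are then summed. *)
Lemma Ex_grid_stop Z Y E : (forall k, Lone P (Z (u k))) -> Lone P Y ->
  (forall k A, (k <= m)%N -> F (u k) A ->
    Ex P (fun w => \1_A w * Z (u k) w) = Ex P (fun w => \1_A w * Y w)) ->
  F (u 0) E ->
  Ex P (fun w => \1_E w * grid_stop Z w) = Ex P (fun w => \1_E w * Y w).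
Proof.
move=> IZ IY ZY FE; pose K k := [set w | first_index w = k].
have FEK k : (k <= m)%N -> F (u k) (E `&` K k).
  move=> km; apply: sigmaI; first exact: sF.
    exact: (Fmono (u0 0) (und (leq0n k))).
  exact: first_index_meas.
have b1 A w : `|(\1_A : Omega -> R) w| <= 1 :> R.
  by rewrite ger0_norm ?ler0n// lern1 leq_b1.
have mEK k : (k <= m)%N -> measurable (E `&` K k) by move=> /FEK/(Fm (u0 k)).
transitivity (\sum_(k < m.+1) Ex P (fun w => \1_(E `&` K k) w * Z (u k) w)).
  rewrite -Ex_sum.
    apply: eq_Ex => w; rewrite /grid_stop (first_index_sum (fun k => Z (u k) w)) mulr_sumr.
    by apply: eq_bigr => k _; rewrite mulrA indicM.
  move=> k; apply: (LoneM_bdd (IZ k) _ (b1 _)); apply: measurable_indic.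
  by apply: mEK; rewrite -ltnS.
transitivity (\sum_(k < m.+1) Ex P (fun w => \1_(E `&` K k) w * Y w)).
  by apply: eq_bigr => k _; apply: ZY; [rewrite -ltnS|apply: FEK; rewrite -ltnS].
rewrite -Ex_sum.
  apply: eq_Ex => w; rewrite [in RHS](first_index_sum (fun=> Y w) w) mulr_sumr.
  by apply: eq_bigr => k _; rewrite mulrA indicM.
move=> k; apply: (LoneM_bdd IY _ (b1 _)); apply: measurable_indic.
by apply: mEK; rewrite -ltnS.
Qed.

(** On the event that the index is k and |Z (u k)| > c, which belongs to [F (u k)], the tail is at
    most |Z (u k)| and the domination by z applies. Keeping the indicator on the right is what later
    yields uniform integrability and not just boundedness. *)
Lemma Ex_tail_grid_stop c Z z : 0 <= c -> (forall k, Lone P (Z (u k))) -> Lone P z ->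
  (forall k A, (k <= m)%N -> F (u k) A ->
    Ex P (fun w => \1_A w * `|Z (u k) w|) <= Ex P (fun w => \1_A w * z w)) ->
  (forall k, rv_measurable (F (u k)) (Z (u k))) ->
  Ex P (fun w => tail c (grid_stop Z w)) <=
  Ex P (fun w => \1_[set w | c < `|grid_stop Z w|] w * z w).
Proof.
move=> c0 IZ Iz Zz mZ; pose K k := [set w | first_index w = k].
pose C k := [set w | c < `|Z (u k) w|].
have b1 A w : `|(\1_A : Omega -> R) w| <= 1 :> R.
  by rewrite ger0_norm ?ler0n// lern1 leq_b1.
have FKC k : (k <= m)%N -> F (u k) (K k `&` C k).
  move=> km; apply: sigmaI; first exact: sF.
    exact: first_index_meas.
  by apply: sigma_lt; [exact: sF|apply: rv_cst; exact: sF|apply: rv_norm; [exact: sF|exact: mZ]].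
have mKC k : (k <= m)%N -> measurable (K k `&` C k) by move=> /FKC/(Fm (u0 k)).
have mgs : measurable_fun setT (grid_stop Z).
  by apply: measurable_grid_stop => k; exact: Lone_meas (IZ k).
have Ige (k : 'I_m.+1) Y : Lone P Y -> Lone P (fun w => \1_(K k `&` C k) w * Y w).
  move=> IY; apply: (LoneM_bdd IY _ (b1 _)); apply: measurable_indic.
  by apply: mKC; rewrite -ltnS.
have Itail k : Lone P (fun w => \1_(K k) w * tail c (Z (u k) w)).
  case: (leqP k m) => km.
    apply: (LoneM_bdd (Lone_tail c0 (IZ k)) _ (b1 _)); apply: measurable_indic.
    by apply: (Fm (u0 k)); exact: first_index_meas.
  rewrite (_ : (fun w => _) = fun=> 0); first exact: Lone_cst.
  apply/funext => w; rewrite indicE memNset ?mul0r//= => h.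
  by have := first_index_le w; rewrite h leqNgt km.
apply: (@le_trans _ _ (\sum_(k < m.+1) Ex P (fun w => \1_(K k `&` C k) w * `|Z (u k) w|))).
  rewrite -Ex_sum => [|k]; last exact/Ige/Lone_abs.
  rewrite (_ : (fun w => tail c _) = fun w => \sum_(k < m.+1) \1_(K k) w * tail c (Z (u k) w)); last first.
    by apply/funext => w; rewrite -(first_index_sum (fun k => tail c (Z (u k) w))).
  apply: Ex_le; [exact: Lone_sum|by apply: Lone_sum => k; exact/Ige/Lone_abs|].
  move=> w; apply: ler_sum => k _; rewrite -indicM -mulrA ler_wpM2l ?ler0n//.
  rewrite indicE; have [wC|wC] := boolP (w \in C k).
    by rewrite mul1r tail_le_norm.
  rewrite mul0r /tail ge_max lexx subr_le0 leNgt.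
  by apply/negP => h; move/negP: wC; apply; rewrite inE.
apply: (@le_trans _ _ (\sum_(k < m.+1) Ex P (fun w => \1_(K k `&` C k) w * z w))).
  apply: ler_sum => k _; have km : (k <= m)%N by rewrite -ltnS.
  exact: Zz km (FKC k km).
rewrite -Ex_sum => [|k]; last exact: Ige.
apply: Ex_le; first by apply: Lone_sum => k; exact: Ige.
  apply: (LoneM_bdd Iz _ (b1 _)); apply: measurable_indic.
  by apply: measurable_lt => //; exact: measurable_norm.
move=> w; rewrite (_ : \1_[set w | c < `|grid_stop Z w|] w =
   \1_[set k | c < `|Z (u k) w|] (first_index w)).
  rewrite [in leRHS](first_index_sum (fun k => \1_[set k | c < `|Z (u k) w|] k)) mulr_suml.
  apply: ler_sum => k _; rewrite -indicM.
  by rewrite (_ : \1_(C k) w = \1_[set k | c < `|Z (u k) w|] (k : nat))// !indicE !mem_setE.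
by rewrite !indicE !mem_setE.
Qed.

End GridStopping.

(** * Continuous paths and their running infimum *)

Section Paths.
Context {R : realType}.
Implicit Types (z : R -> R) (s t e : R).

(* Continuity on [0, +oo[, expressed by freezing the path at negative times. *)
Definition cpath z := continuous (fun t => z (Num.max 0 t)).

Lemma within_cpath z : {within `[0, +oo[, continuous z} -> cpath z.
Proof.
move=> /subspace_continuousP h t.
have m0 : `[0, +oo[%classic (Num.max 0 t) by rewrite /= in_itv/= andbT le_max lexx.
have := h _ m0; move=> ht; apply: (@cvg_comp _ _ _ (fun t => Num.max 0 t) z _ _ _ _ ht).
move=> A /= [e /= e0 hA]; near=> s.
apply: hA => /=; last by rewrite in_itv/= andbT le_max lexx.
change (`|Num.max 0 t - Num.max 0 s| < e).
apply: (@le_lt_trans _ _ `|t - s|).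
  have h1 := ler_norm (t - s); have h2 := ler_norm (s - t); rewrite distrC in h2.
  rewrite /Num.max ler_norml.
  by case: (ltP 0 t) => ?; case: (ltP 0 s) => ?; apply/andP; split; lra.
by near: s; apply: cvgr_dist_lt.
Unshelve. all: by end_near. Qed.

Lemma cpath_within z : cpath z -> {within `[0, +oo[, continuous z}.
Proof.
move=> cz; apply/subspace_continuousP => x; rewrite /= in_itv/= andbT => x0.
have := cz x; rewrite /continuous_at (max_idPr x0) => h.
apply: (@cvg_trans _ ((fun t => z (Num.max 0 t)) @ within `[0, +oo[%classic (nbhs x))); last first.
  by apply: cvg_trans h; apply: cvg_app; apply: cvg_within.
apply: near_eq_cvg; rewrite near_withinE; apply: nearW => y.
by rewrite /= in_itv/= andbT => y0; rewrite (max_idPr y0).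
Qed.

Lemma eq_cpath z z' : (forall t, 0 <= t -> z t = z' t) -> cpath z -> cpath z'.
Proof.
move=> zz' cz; rewrite /cpath (_ : (fun t => _) = fun t => z (Num.max 0 t))//.
by apply/funext => t; rewrite zz'// le_max lexx.
Qed.

Lemma cpath_cst c : cpath (fun=> c).
Proof. by move=> t; exact: cvg_cst. Qed.

Lemma cpathD z z' : cpath z -> cpath z' -> cpath (fun t => z t + z' t).
Proof. by move=> h h' t; apply: cvgD; [exact: h|exact: h']. Qed.

Lemma cpathB z z' : cpath z -> cpath z' -> cpath (fun t => z t - z' t).
Proof. by move=> h h' t; apply: cvgB; [exact: h|exact: h']. Qed.

Lemma cpathM z z' : cpath z -> cpath z' -> cpath (fun t => z t * z' t).
Proof. by move=> h h' t; apply: cvgM; [exact: h|exact: h']. Qed.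

Lemma cpath_norm z : cpath z -> cpath (fun t => `|z t|).
Proof. by move=> h t; apply: cvg_norm; exact: h. Qed.

Lemma cpathV z : (forall t, 0 <= t -> z t != 0) -> cpath z -> cpath (fun t => (z t)^-1).
Proof. by move=> z0 h t; apply: cvgV; [apply: z0; rewrite le_max lexx|exact: h]. Qed.

Lemma cpath_ln z : (forall t, 0 <= t -> 0 < z t) -> cpath z -> cpath (fun t => ln (z t)).
Proof.
move=> z0 h t; apply: (@cvg_comp _ _ _ (fun t => z (Num.max 0 t)) (@ln R)); first exact: h.
by apply: continuous_ln; apply: z0; rewrite le_max lexx.
Qed.

Lemma cpath_cvg z (u : nat -> R) t : cpath z -> 0 <= t -> (forall n, 0 <= u n) ->
  u n @[n --> \oo] --> t -> z (u n) @[n --> \oo] --> z t.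
Proof.
move=> cz t0 u0 ut.
have := cz t; rewrite /continuous_at (max_idPr t0) => h.
have : (fun t => z (Num.max 0 t)) (u n) @[n --> \oo] --> z t.
  by apply: (@cvg_comp _ _ _ u (fun t => z (Num.max 0 t)) _ _ _ ut h).
by apply: cvg_trans; apply: near_eq_cvg; apply: nearW => n; rewrite (max_idPr (u0 n)).
Qed.

Lemma cpath_delta z t e : cpath z -> 0 <= t -> 0 < e ->
  exists2 dl : R, 0 < dl & forall s, 0 <= s -> `|t - s| < dl -> `|z t - z s| < e.
Proof.
move=> cz t0 e0; have := cz t; rewrite /continuous_at (max_idPr t0) => /cvgrPdist_lt/(_ _ e0)[dl /= d0 h].
by exists dl => // s s0 ts; have := h s ts; rewrite /= (max_idPr s0).
Qed.

(** Heine-Cantor: the near-covering form of compactness of [0, t] is applied with the modulus dl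
    running through the right neighbourhoods of 0. *)
Lemma cpath_unif z t e : cpath z -> 0 < e ->
  exists2 dl : R, 0 < dl &
    forall a b, 0 <= a <= t -> 0 <= b <= t -> `|a - b| <= dl -> `|z a - z b| <= e.
Proof.
move=> cz e0; have := @segment_compact R 0 t; rewrite compact_near_coveringP.
move=> /(_ R (0:R)^'+ (fun dl a => 0 <= a ->
  forall b, 0 <= b -> `|a - b| <= dl -> `|z a - z b| <= e)).
have fr : Filter ((0:R)^'+) by apply: at_right_proper_filter.
move=> /(_ fr) h.
have : \forall dl \near 0^'+, forall a, `[0, t]%classic a -> 0 <= a ->
    forall b, 0 <= b -> `|a - b| <= dl -> `|z a - z b| <= e.
  apply: h => x; rewrite /= in_itv/= => /andP[x0 xt].
  have e2 : 0 < e / 2 by rewrite divr_gt0.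
  have [dl d0 hd] := cpath_delta cz x0 e2.
  have dl2 : 0 < dl / 2 by rewrite divr_gt0.
  exists (ball x (dl / 2), [set y | y < dl / 2]); first split.
  - exact: nbhsx_ballx.
  - exact: nbhs_right_lt.
  move=> [a y] /= [xa yd] a0 b b0 ab.
  have xa' : `|x - a| < dl / 2 by [].
  have za : `|z x - z a| < e / 2 by apply: hd => //; rewrite (lt_trans xa')//; lra.
  have zb : `|z x - z b| < e / 2.
    apply: hd => //; rewrite (_ : x - b = (x - a) + (a - b)); last by lra.
    by rewrite (le_lt_trans (ler_normD _ _))//; lra.
  rewrite (_ : z a - z b = (z x - z b) - (z x - z a)); last by lra.
  by rewrite (le_trans (ler_normB _ _))//; lra.
move=> hh; near (0:R)^'+ => dl; exists dl => // a b /andP[a0 aT] /andP[b0 bt] ab.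
have hdl : forall a, `[0, t]%classic a -> 0 <= a ->
    forall b, 0 <= b -> `|a - b| <= dl -> `|z a - z b| <= e by near: dl.
by apply: hdl => //; rewrite /= in_itv/= a0.
Unshelve. all: by end_near. Qed.

Lemma cpath_within_itv z t : cpath z -> {within `[0, t], continuous (fun s => z (Num.max 0 s))}.
Proof. by move=> cz; apply: continuous_subspaceT. Qed.

Lemma cpath_max z t : cpath z -> 0 <= t ->
  exists2 s, 0 <= s <= t & forall r, 0 <= r <= t -> z r <= z s.
Proof.
move=> cz t0; have [s] := EVT_max t0 (cpath_within_itv (t := t) cz).
rewrite in_itv/= => /andP[s0 st] h; exists s; first by rewrite s0.
move=> r /andP[r0 rt]; have := h r; rewrite in_itv/= r0 rt => /(_ isT).
by rewrite (max_idPr r0) (max_idPr s0).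
Qed.

Lemma cpath_min z t : cpath z -> 0 <= t ->
  exists2 s, 0 <= s <= t & forall r, 0 <= r <= t -> z s <= z r.
Proof.
move=> cz t0; have [s] := EVT_min t0 (cpath_within_itv (t := t) cz).
rewrite in_itv/= => /andP[s0 st] h; exists s; first by rewrite s0.
move=> r /andP[r0 rt]; have := h r; rewrite in_itv/= r0 rt => /(_ isT).
by rewrite (max_idPr r0) (max_idPr s0).
Qed.

(** A countable dense family of times of [0, t], through which events about whole paths on [0, t]
    become countable unions and intersections. *)
Definition clip_rat t (q : rat) : R := Num.min t (Num.max 0 (ratr q)).

Lemma clip_rat_itv t q : 0 <= t -> 0 <= clip_rat t q <= t.
Proof. by move=> t0; rewrite /clip_rat ge_min lexx/= le_min t0 le_max lexx. Qed.

Lemma clip_rat_dense t s dl : 0 <= s <= t -> 0 < dl ->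
  exists q, `|s - clip_rat t q| < dl.
Proof.
move=> /andP[s0 st] d0; have sd : s - dl < s + dl by lra.
have [q] := rat_in_itvoo sd; rewrite in_itv/= => /andP[h1 h2]; exists q.
rewrite /clip_rat /Num.min /Num.max ltr_norml.
by case: (ltP 0 (ratr q)) => ?; [case: (ltP t (ratr q)) => ?|case: (ltP t 0) => ?];
  apply/andP; split; lra.
Qed.

Lemma cpath_rat z t s e : cpath z -> 0 <= s <= t -> 0 < e ->
  exists q, `|z s - z (clip_rat t q)| < e.
Proof.
move=> cz st e0; have /andP[s0 s1] := st.
have [dl d0 h] := cpath_delta cz s0 e0.
have [q sq] := clip_rat_dense st d0; exists q; apply: h => //.
by have /andP[] := clip_rat_itv q (le_trans s0 s1).
Qed.

(** [running_inf M t w] is [path_inf (M ^~ w) t] by conversion; the pathwise form allows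
    deterministic arguments. *)
Definition path_inf z t := inf [set z s | s in `[0, t]].

Section PathInf.
Variable z : R -> R.
Hypothesis cz : cpath z.
Hypothesis z_gt0 : forall t, 0 <= t -> 0 < z t.

Lemma path_inf_attained t : 0 <= t -> exists2 s, 0 <= s <= t & path_inf z t = z s.
Proof.
move=> t0; have [s st h] := cpath_min cz t0; exists s => //.
apply/le_anti/andP; split.
  apply: ge_inf; last by exists s => //; rewrite /= in_itv.
  by exists (z s) => _ [r /= + <-]; rewrite in_itv/=; exact: h.
apply: lb_le_inf; first by exists (z s), s => //; rewrite /= in_itv.
by move=> _ [r /= + <-]; rewrite in_itv/=; exact: h.
Qed.

Lemma path_inf_le t s : 0 <= s <= t -> path_inf z t <= z s.
Proof.
move=> /andP[s0 st]; apply: ge_inf; last by exists s => //; rewrite /= in_itv/= s0.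
by exists 0 => _ [r /= + <-]; rewrite in_itv/= => /andP[r0 _]; exact/ltW/z_gt0.
Qed.

Lemma path_inf_gt0 t : 0 <= t -> 0 < path_inf z t.
Proof. by move=> t0; have [s /andP[s0 _] ->] := path_inf_attained t0; exact: z_gt0. Qed.

Lemma path_inf_anti s t : 0 <= s -> s <= t -> path_inf z t <= path_inf z s.
Proof.
move=> s0 st; have [r /andP[r0 rs] ->] := path_inf_attained s0.
by apply: path_inf_le; rewrite r0 (le_trans rs).
Qed.

Lemma path_inf0 : path_inf z 0 = z 0.
Proof.
have [s /andP[s0 s1] ->] := path_inf_attained (lexx 0).
by have -> : s = 0 by apply/le_anti/andP.
Qed.

Lemma ln_le_sub1 (x : R) : 0 < x -> ln x <= x - 1.
Proof.
move=> x0; have := @le_ln1Dx R (x - 1).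
by rewrite (_ : 1 + (x - 1) = x); [apply; lra|ring].
Qed.

(* The infimum only decreases at times where the path attains it, so that
   z d(1/I) and d(log(1/I)) differ by at most the oscillation of z. *)
Lemma path_inf_step s t om : 0 <= s -> s <= t ->
  (forall a b, s <= a <= t -> s <= b <= t -> `|z a - z b| <= om) ->
  `|(z t - z s) / path_inf z s -
    ((z t / path_inf z t + ln (path_inf z t)) -
     (z s / path_inf z s + ln (path_inf z s)))|
    <= om * ((path_inf z t)^-1 - (path_inf z s)^-1).
Proof.
move=> s0 st hom; have t0 := le_trans s0 st.
have it0 := path_inf_gt0 t0; have is0 := path_inf_gt0 s0.
have [r /andP[r0 rt] ir] := path_inf_attained t0.
(* If the infimum over [0, t] is already attained before s, then I does not move on [s, t] and both
   increments agree exactly. *)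
have [rs|rs] := leP r s.
  have e : path_inf z t = path_inf z s.
    by apply/le_anti; rewrite path_inf_anti//= ir path_inf_le// r0.
  by rewrite e subrr mulr0 mulrBl (_ : _ - _ = 0) ?normr0//; ring.
set i := path_inf z s in is0 *; set j := path_inf z t in it0 ir *.
have ji : j <= i by exact: path_inf_anti.
have zt : j <= z t by apply: path_inf_le; rewrite t0 lexx.
have izs : i <= z s by apply: path_inf_le; rewrite s0 lexx.
(* Otherwise the new infimum j is a value of z inside [s, t], so z t and i <= z s exceed it by at
   most om. *)
have h1 : z t <= j + om.
  have := hom t r; rewrite lexx st rt (ltW rs) => /(_ isT isT).
  by rewrite -ir => /(le_trans (ler_norm _)); lra.
have h2 : i <= j + om.
  have := hom s r; rewrite lexx st rt (ltW rs) => /(_ isT isT).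
  by rewrite -ir => /(le_trans (ler_norm _)); lra.
have D0 : 0 <= j^-1 - i^-1 by rewrite subr_ge0 lef_pV2.
(* The inequality ln x <= x - 1 at i/j and at j/i encloses ln i - ln j between j D and i D, where D
   = 1/j - 1/i. *)
have l1 : ln i - ln j <= i * (j^-1 - i^-1).
  rewrite -ln_div// mulrBr mulfV ?gt_eqF//; apply: ln_le_sub1; exact: divr_gt0.
have l2 : j * (j^-1 - i^-1) <= ln i - ln j.
  rewrite mulrBr mulfV ?gt_eqF//; have := ln_le_sub1 (divr_gt0 it0 is0).
  by rewrite ln_div//; lra.
(* What remains is a difference of two quantities lying between j D and (j + om) D. *)
rewrite (_ : _ - _ = (ln i - ln j) - z t * (j^-1 - i^-1)); last by ring.
move: D0 l1 l2; set D := j^-1 - i^-1 => D0 l1 l2.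
rewrite ler_norml; apply/andP; split; nra.
Qed.

(** The bound of a single step is an increment of 1/I, so the errors telescope: the total is small
    with om, however many steps there are. *)
Lemma path_inf_sum (u : nat -> R) n om : 0 <= u 0 -> (forall k, u k <= u k.+1) ->
  (forall k, (k < n)%N -> forall a b, u k <= a <= u k.+1 -> u k <= b <= u k.+1 -> `|z a - z b| <= om) ->
  `|\sum_(k < n) (z (u k.+1) - z (u k)) / path_inf z (u k) -
    ((z (u n) / path_inf z (u n) + ln (path_inf z (u n))) -
     (z (u 0) / path_inf z (u 0) + ln (path_inf z (u 0))))|
    <= om * ((path_inf z (u n))^-1 - (path_inf z (u 0))^-1).
Proof.
move=> u0 uS; have un k : 0 <= u k by elim: k => // k ih; exact: le_trans ih (uS k).
elim: n => [_|n ih hom]; first by rewrite big_ord0 !subrr normr0 mulr0.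
have {}ih := ih (fun k kn => hom k (ltnW kn)).
have hn := path_inf_step (un n) (uS n) (hom n (ltnSn n)).
rewrite big_ord_recr/=; move: ih hn.
set a := \sum_(_ < _) _; set b := _ / _ - _.
set A := z (u n) / _ + _; set B := z (u n.+1) / _ + _; set C := z (u 0) / _ + _.
move=> ih hn.
set b' := _ / _ in hn *.
rewrite (_ : a + b' - (B - C) = (a - (A - C)) + (b' - (B - A))); last by ring.
apply: le_trans (ler_normD _ _) _; apply: le_trans (lerD ih hn) _.
by rewrite -mulrDr le_eqVlt; apply/orP; left; apply/eqP; ring.
Qed.

End PathInf.
End Paths.

(** * Optional stopping *)

Section Stopping.
Context {R : realType} {d} {Omega : measurableType d} (P : probability Omega R).
Variable F : R -> set (set Omega).
Hypothesis usualF : usual_filtration P F.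
Implicit Types (Z : R -> Omega -> R) (T : Omega -> \bar R).

Lemma filt_sigma t : 0 <= t -> sigma_algebra [set: Omega] (F t).
Proof. by case: usualF => h _ _ _ /h[]. Qed.

Lemma filt_meas t : 0 <= t -> F t `<=` measurable.
Proof. by case: usualF => h _ _ _ /h[]. Qed.

Lemma filt_mono s t : 0 <= s -> s <= t -> F s `<=` F t.
Proof. by case: usualF => _ h _ _; exact: h. Qed.

Lemma filt_null t E : 0 <= t -> P.-negligible E -> F t E.
Proof. by case: usualF => _ _ _ h t0 /h; exact: filt_mono. Qed.

Lemma filt_rv s t (f : Omega -> R) : 0 <= s -> s <= t ->
  rv_measurable (F s) f -> rv_measurable (F t) f.
Proof. by move=> s0 st h B mB; apply: (filt_mono s0 st); exact: h. Qed.

Lemma adapted_mfun Z t : adapted F Z -> 0 <= t -> measurable_fun setT (Z t).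
Proof. by move=> aZ t0; apply: (rv_mfun (filt_meas t0)); exact: aZ. Qed.

Lemma martingaleP Z : martingale P F Z <->
  [/\ adapted F Z, forall t, 0 <= t -> Lone P (Z t)
    & forall s t E, 0 <= s -> s <= t -> F s E ->
      Ex P (fun w => \1_E w * Z s w) = Ex P (fun w => \1_E w * Z t w)].
Proof.
split=> [[aZ IZ h]|[aZ IZ h]]; split=> // s t E s0 st FE.
  have mE := filt_meas s0 FE; have t0 := le_trans s0 st.
  by apply: EFin_inj; rewrite -!int_indic//; [exact: h|exact: IZ|exact: IZ].
have mE := filt_meas s0 FE; have t0 := le_trans s0 st.
by rewrite !int_indic//; [rewrite (h s t)|exact: IZ|exact: IZ].
Qed.

Definition sure_continuous Z := forall w, cpath (Z ^~ w).

(** The time min(t, T) as a real number; [stopped Z T t w] unfolds to [Z (capped T t w) w]. *)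
Definition capped T t w : R := fine (Order.min t%:E (T w)).

Lemma capped_itv T t w : 0 <= t -> (0 <= T w)%E -> 0 <= capped T t w <= t.
Proof.
rewrite /capped => t0; case: (T w) => [r|_|//].
  by rewrite lee_fin -EFin_min /= => r0; rewrite le_min t0 r0/= ge_min lexx.
by rewrite min_l ?leey//= t0 lexx.
Qed.

Lemma capped_le T t w : (0 <= T w)%E -> (T w <= t%:E)%E -> (capped T t w)%:E = T w.
Proof.
rewrite /capped; case: (T w) => [r|//|//]; rewrite !lee_fin => r0 rt.
by rewrite -EFin_min /= min_r.
Qed.

Lemma capped_ge T t w : (t%:E <= T w)%E -> capped T t w = t.
Proof. by move=> h; rewrite /capped min_l. Qed.

Lemma capped_leT T t w : 0 <= t -> (0 <= T w)%E -> ((capped T t w)%:E <= T w)%E.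
Proof.
move=> t0 T0; have [h|h] := leP (T w) t%:E; first by rewrite capped_le.
by rewrite capped_ge ltW.
Qed.

Lemma le_capped T t w r : (r%:E <= T w)%E -> r <= t -> r <= capped T t w.
Proof.
move=> rT rt; rewrite /capped; case: (T w) rT => [x|_|//].
  by rewrite lee_fin -EFin_min/= le_min rt.
by rewrite min_l ?leey.
Qed.

Definition grid s t m (k : nat) : R := s + (t - s) * (k%:R / m.+1%:R).

Lemma grid0 s t m : grid s t m 0 = s.
Proof. by rewrite /grid mul0r mulr0 addr0. Qed.

Lemma grid_last s t m : grid s t m m.+1 = t.
Proof. by rewrite /grid divff ?pnatr_eq0// mulr1 addrC subrK. Qed.

Lemma gridS s t m k : grid s t m k.+1 = grid s t m k + (t - s) / m.+1%:R.
Proof. by rewrite /grid -(natr1 k); ring. Qed.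

Lemma grid_nd s t m i j : s <= t -> (i <= j)%N -> grid s t m i <= grid s t m j.
Proof.
move=> st ij; rewrite /grid lerD2l ler_wpM2l ?subr_ge0// ler_wpM2r ?invr_ge0//.
by rewrite ler_nat.
Qed.

Lemma grid_ge s t m k : s <= t -> s <= grid s t m k.
Proof. by move=> st; rewrite -[leLHS](grid0 s t m) grid_nd. Qed.

Lemma mesh_cvg (s t : R) : (t - s) / m.+1%:R @[m --> \oo] --> (0 : R).
Proof. by rewrite -[X in _ --> X](mulr0 (t - s)); apply: cvgMr; exact: cvg_harmonic. Qed.

(** Approximation from above of max(s, min(t, T)): the first grid point not before T, and t if there
    is none. The decision to stop at a grid point is known at that point, so discrete optional
    stopping applies. *)
Definition grid_time s t m T w :=
  grid s t m (first_index m.+1 (fun k w => (T w <= (grid s t m k)%:E)%E) w).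

Lemma grid_time_bounds s t m T w : 0 <= s -> s <= t -> (0 <= T w)%E ->
  Num.max s (capped T t w) <= grid_time s t m T w <=
  Num.max s (capped T t w) + (t - s) / m.+1%:R.
Proof.
move=> s0 st T0; have t0 := le_trans s0 st.
have m0 : 0 <= (t - s) / m.+1%:R by rewrite divr_ge0 ?subr_ge0.
rewrite /grid_time; set p := fun k w => _; set fi := first_index _ _ _.
have fim : (fi <= m.+1)%N by exact: first_index_le.
apply/andP; split.
  rewrite ge_max grid_ge//=.
  move: fim; rewrite leq_eqVlt => /predU1P[->|fim].
    by rewrite grid_last; have /andP[] := capped_itv t0 T0.
  have := @first_index_p _ _ m.+1 p w fim; rewrite /p -/fi => h.
  by rewrite -lee_fin (le_trans (capped_leT t0 T0)).
case E : fi => [|k]; first by rewrite grid0 ler_wpDr// le_max lexx.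
rewrite gridS lerD2r le_max; apply/orP; right.
have kfi : (k < fi)%N by rewrite E.
have := @first_index_lt _ _ m.+1 p k w kfi; rewrite /p -ltNge => /ltW h.
by apply: le_capped => //; rewrite -[leRHS](grid_last s t m) grid_nd// -ltnS -E ltnW.
Qed.

Lemma grid_time_cvg s t T w Z : 0 <= s -> s <= t -> (0 <= T w)%E ->
  cpath (Z ^~ w) ->
  Z (grid_time s t m T w) w @[m --> \oo] --> Z (Num.max s (capped T t w)) w.
Proof.
move=> s0 st T0 cZ; apply: (@cpath_cvg _ (Z ^~ w) (fun m => grid_time s t m T w)) => //.
- by rewrite le_max s0.
- by move=> m; have /andP[+ _] := grid_time_bounds m s0 st T0; apply: le_trans; rewrite le_max s0.
- apply: (@squeeze_cvgr _ _ _ _ (fun=> Num.max s (capped T t w))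
      (fun m => Num.max s (capped T t w) + (t - s) / m.+1%:R)).
  + by apply: nearW => m; exact: grid_time_bounds.
  + exact: cvg_cst.
  + rewrite -[X in _ --> X](addr0 (Num.max s (capped T t w))).
    by apply: cvgD; [exact: cvg_cst|exact: mesh_cvg].
Qed.

Lemma stopping_grid T s t m k : 0 <= s -> s <= t -> stopping_time F T ->
  F (grid s t m k) [set w | (T w <= (grid s t m k)%:E)%E].
Proof. by move=> s0 st [_ h]; apply: h; rewrite (le_trans s0)// grid_ge. Qed.

(** The stopped value is a limit of grid stoppings, each of them a finite sum over grid points not
    later than t. *)
Lemma adapted_stopped Z T : adapted F Z -> sure_continuous Z ->
  stopping_time F T -> adapted F (stopped Z T).
Proof.
move=> aZ cZ sT t t0; have T0 := sT.1.
apply: (rv_cvg (filt_sigma t0) (h := fun m w => Z (grid_time 0 t m T w) w)); last first.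
  move=> w; have := grid_time_cvg (lexx 0) t0 (T0 w) (cZ w).
  by have /andP[c0 _] := capped_itv t0 (T0 w); rewrite (max_idPr c0).
move=> m; pose p k w := (T w <= (grid 0 t m k)%:E)%E.
rewrite (_ : (fun w => _) = fun w => \sum_(k < m.+2)
    \1_[set w | first_index m.+1 p w = k] w * Z (grid 0 t m k) w); last first.
  by apply/funext => w; rewrite -(first_index_sum m.+1 p (fun k => Z (grid 0 t m k) w)).
apply: rv_sum => [|k]; first exact: filt_sigma.
have km : (k <= m.+1)%N by rewrite -ltnS.
have gk0 : 0 <= grid 0 t m k by exact: grid_ge.
have gkt : grid 0 t m k <= t by rewrite -[leRHS](grid_last 0 t m) grid_nd.
apply: rvM; first exact: filt_sigma.
  apply: rv_indic; first exact: filt_sigma.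
  apply: (filt_mono gk0 gkt).
  apply: first_index_meas => //.
  - by move=> r; exact: filt_sigma.
  - by move=> r r'; exact: filt_mono.
  - by move=> j; exact: grid_ge.
  - by move=> i j; exact: grid_nd.
  - by move=> j; exact: stopping_grid.
by apply: (filt_rv gk0 gkt); exact: aZ.
Qed.

Lemma measurable_grid_time Z T s t m : adapted F Z -> stopping_time F T ->
  0 <= s -> s <= t -> measurable_fun setT (fun w => Z (grid_time s t m T w) w).
Proof.
move=> aZ sT s0 st.
have g0 k : 0 <= grid s t m k by rewrite (le_trans s0)// grid_ge.
apply: (@measurable_grid_stop _ _ _ F filt_sigma filt_meas filt_mono m.+1 (grid s t m)
   (fun k w => (T w <= (grid s t m k)%:E)%E)) => //.
- by move=> i j; exact: grid_nd.
- by move=> k; exact: stopping_grid.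
- by move=> k; exact: adapted_mfun.
Qed.

(** The level c must depend on z and e alone. The hypothesis at level 0 gives E|f| <= E z, hence
    P(|f| > c) <= E z / c by Markov; on that event z is split at height b into a small tail and at
    most b. *)
Lemma ui_dominated (z : Omega -> R) e : Lone P z -> (forall w, 0 <= z w) -> 0 < e ->
  exists2 c, 0 <= c & forall f, measurable_fun setT f ->
    (forall c', 0 <= c' -> (\int[P]_w (tail c' (f w))%:E <=
       (Ex P (fun w => \1_[set w | c' < `|f w|] w * z w))%:E)%E) ->
    (\int[P]_w (tail c (f w))%:E <= e%:E)%E.
Proof.
move=> Iz z0 e0; have e2 : 0 < e / 2 by rewrite divr_gt0.
have [b b0 hb] := Ex_tail_cvg0 Iz e2.
have Ez0 : 0 <= Ex P z by exact: Ex_ge0.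
(* Chosen so that b times the Markov bound E z / c is at most e/2; the two summands 1 keep
   everything positive. *)
pose c := (b + 1) * (Ex P z + 1) / (e / 2).
have c0 : 0 < c by rewrite divr_gt0// mulr_gt0// ltr_wpDl.
exists c; first exact: ltW.
move=> f mf h; apply: le_trans (h c (ltW c0)) _; rewrite lee_fin.
have I1 c' : Lone P (fun w => \1_[set w | c' < `|f w|] w * z w).
  apply: (@LoneM_bdd _ _ _ _ 1) => //.
    by apply: measurable_indic; apply: measurable_lt => //; exact: measurable_norm.
  by move=> w; rewrite ger0_norm ?ler0n// lern1 leq_b1.
have mA : measurable [set w | c < `|f w|].
  by apply: measurable_lt => //; exact: measurable_norm.
set A := [set w | c < `|f w|] in mA *.
have IA := Lone_indic P mA.
have If : Lone P f.
  by apply: (Lone_of_tail mf (h 0 (lexx 0))).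
have PA : c * Ex P (\1_A : Omega -> R) <= Ex P z.
  rewrite -ExZ//; apply: (@le_trans _ _ (Ex P (fun w => `|f w|))).
    apply: Ex_le; [exact: LoneZ|exact: Lone_abs|].
    move=> w; rewrite indicE; have [wA|wA] := boolP (w \in A); last by rewrite mulr0.
    by rewrite mulr1; move: wA; rewrite inE => /ltW.
  have := h 0 (lexx 0); rewrite (eq_integral (fun w => (`|f w|)%:E)); last first.
    by move=> w _; rewrite tail0.
  rewrite ExE ?lee_fin; last exact: Lone_abs.
  move=> /le_trans; apply; apply: Ex_le => // w.
  by rewrite ler_piMl// ?lern1 ?leq_b1.
apply: (@le_trans _ _ (Ex P (fun w => tail b (z w) + b * \1_A w))).
  apply: Ex_le; [exact: I1|by apply: LoneD; [exact: Lone_tail|exact: LoneZ]|].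
  move=> w; rewrite indicE; have [wA|wA] := boolP (w \in A); last first.
    by rewrite mul0r mulr0 addr0 tail_ge0.
  by rewrite mul1r mulr1 addrC; have := norm_le_tail b (z w); rewrite ger0_norm.
rewrite ExD; [|exact: Lone_tail|exact: LoneZ].
rewrite ExZ// [leRHS]splitr lerD//.
have p0 : 0 <= Ex P (\1_A : Omega -> R) by apply: Ex_ge0 => w; rewrite ler0n.
apply: (@le_trans _ _ ((b + 1) * Ex P (\1_A : Omega -> R))).
  by rewrite ler_wpM2r// lerDl.
move: PA; rewrite /c -ler_pdivlMl//.
move=> /(ler_wpM2l (_ : 0 <= b + 1)) => /(_ _)/le_trans; apply; first by rewrite addr_ge0.
rewrite invf_div mulrA mulrA.
rewrite (_ : (b + 1) * (e / 2) / ((b + 1) * (Ex P z + 1)) * Ex P z =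
             (e / 2) * (Ex P z / (Ex P z + 1))); last first.
  by field; rewrite !gt_eqF// ltr_wpDl.
apply: ler_piMr; first exact: ltW.
by rewrite ler_pdivrMr ?ltr_wpDl// mul1r lerDl.
Qed.

Lemma abs_indic_le1 (A : set Omega) w : `|(\1_A : Omega -> R) w| <= 1.
Proof. by rewrite ger0_norm ?ler0n// lern1 leq_b1. Qed.

Lemma martingale_Lone Z t : martingale P F Z -> 0 <= t -> Lone P (Z t).
Proof. by move=> /martingaleP[_ IZ _]; exact: IZ. Qed.

Lemma martingale_orth Z s t g c : martingale P F Z -> 0 <= s -> s <= t ->
  rv_measurable (F s) g -> (forall w, `|g w| <= c) ->
  Ex P (fun w => g w * Z t w) = Ex P (fun w => g w * Z s w).
Proof.
move=> /martingaleP[aZ IZ h] s0 st mg gc; have t0 := le_trans s0 st.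
have mg' := rv_mfun (filt_meas s0) mg.
apply/eqP; rewrite -subr_eq0 -ExB; last 2 first.
- exact: LoneM_bdd (IZ _ t0) mg' gc.
- exact: LoneM_bdd (IZ _ s0) mg' gc.
apply/eqP; rewrite -[RHS](@Ex_orth _ _ _ P (F s) (filt_sigma s0) (filt_meas s0)
   c (fun w => Z t w - Z s w) g)//.
- by apply: eq_Ex => w; ring.
- by apply: LoneB; exact: IZ.
- move=> E FE; have mE := filt_meas s0 FE.
  rewrite (_ : (fun w => _) = (fun w => \1_E w * Z t w - \1_E w * Z s w)); last first.
    by apply/funext => w; ring.
  by rewrite ExB ?(h s t E)// ?subrr//;
    apply: (LoneM_bdd (IZ _ _) (measurable_indic mE) (abs_indic_le1 E)).
Qed.

(** The absolute value at time s is Z s times a sign known at time s. Orthogonality exchanges Z s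
    for Z t under this sign, and a signed Z t is at most |Z t|. *)
Lemma martingale_abs_le Z s t E : martingale P F Z -> 0 <= s -> s <= t -> F s E ->
  Ex P (fun w => \1_E w * `|Z s w|) <= Ex P (fun w => \1_E w * `|Z t w|).
Proof.
move=> mZ s0 st FE; have [aZ IZ h] := (martingaleP Z).1 mZ.
have t0 := le_trans s0 st; have mE := filt_meas s0 FE.
have sF := filt_sigma s0.
pose A := [set w | 0 <= Z s w].
have FA : F s A by apply: sigma_le => //; [exact: rv_cst|exact: aZ].
pose g w : R := \1_E w * (2 * \1_A w - 1).
have mg : rv_measurable (F s) g.
  by repeat first [apply: rvM => //|apply: rvB => //|exact: rv_indic|exact: rv_cst].
have g1 w : `|g w| <= 1.
  rewrite /g !indicE; case: (w \in E); case: (w \in A);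
  by rewrite /= ?mulr1n ?mulr0n ler_norml; apply/andP; split; lra.
rewrite (_ : (fun w => _) = (fun w => g w * Z s w)); last first.
  apply/funext => w; rewrite /g -mulrA !indicE; congr (_ * _).
  have [wA|wA] := boolP (w \in A).
    by move: wA; rewrite inE /A/= => wA; rewrite ger0_norm//= mulr1n; ring.
  have wA' : Z s w < 0.
    by rewrite ltNge; apply: contra wA => wA; rewrite inE.
  by rewrite ltr0_norm//= mulr0n; ring.
rewrite -(martingale_orth mZ s0 st mg g1).
have mg' := rv_mfun (filt_meas s0) mg.
apply: Ex_le; first exact: LoneM_bdd (IZ _ t0) mg' g1.
  exact: LoneM_bdd (Lone_abs (IZ _ t0)) (measurable_indic mE) (abs_indic_le1 E).
move=> w; rewrite /g -mulrA ler_wpM2l//.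
apply: le_trans (ler_norm _) _; rewrite normrM ler_piMl//.
by rewrite indicE; case: (w \in A); rewrite /= ?mulr1n ?mulr0n ler_norml; apply/andP; split; lra.
Qed.

Section GridTime.
Variables (Z : R -> Omega -> R) (T : Omega -> \bar R).
Hypothesis aZ : adapted F Z.
Hypothesis sT : stopping_time F T.
Hypothesis IZ : forall t, 0 <= t -> Lone P (Z t).
Variables (s t : R).
Hypothesis s0 : 0 <= s.
Hypothesis st : s <= t.

Let t0 : 0 <= t. Proof. exact: le_trans st. Qed.
Let g0 m k : 0 <= grid s t m k. Proof. by rewrite (le_trans s0)// grid_ge. Qed.

Lemma Lone_grid_time m : Lone P (fun w => Z (grid_time s t m T w) w).
Proof.
pose p k w := (T w <= (grid s t m k)%:E)%E.
apply: (@Lone_le _ _ _ _ _ (fun w => \sum_(k < m.+2) `|Z (grid s t m k) w|)).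
- exact: measurable_grid_time.
- move=> w; have fim := first_index_le m.+1 p w.
  by rewrite (bigD1 (Ordinal (fim : (_ < m.+2)%N)))//= lerDl sumr_ge0.
- by apply: Lone_sum => k; exact/Lone_abs/IZ.
Qed.

Lemma grid_time_mart m E : martingale P F Z -> F s E ->
  Ex P (fun w => \1_E w * Z (grid_time s t m T w) w) = Ex P (fun w => \1_E w * Z t w).
Proof.
move=> mZ FE.
apply: (@Ex_grid_stop _ _ _ P F filt_sigma filt_meas filt_mono m.+1 (grid s t m)
   (fun k w => (T w <= (grid s t m k)%:E)%E) _ _ _ Z (Z t)) => //.
- by move=> i j; exact: grid_nd.
- by move=> k; exact: stopping_grid.
- by move=> k; exact: IZ.
- exact: IZ.
- move=> k A km FA; have [_ _ h] := (martingaleP Z).1 mZ.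
  by apply: (h _ t) => //; rewrite -[leRHS](grid_last s t m) grid_nd.
- by rewrite grid0.
Qed.

Lemma grid_time_tail m z c : Lone P z ->
  (forall r E, s <= r <= t -> F r E ->
    Ex P (fun w => \1_E w * `|Z r w|) <= Ex P (fun w => \1_E w * z w)) -> 0 <= c ->
  (\int[P]_w (tail c (Z (grid_time s t m T w) w))%:E <=
   (Ex P (fun w => \1_[set w | (c < `|Z (grid_time s t m T w) w|)%R] w * z w))%:E)%E.
Proof.
move=> Iz Zz c0; rewrite ExE ?lee_fin; last by apply: Lone_tail => //; exact: Lone_grid_time.
apply: (@Ex_tail_grid_stop _ _ _ P F filt_sigma filt_meas filt_mono m.+1 (grid s t m)
   (fun k w => (T w <= (grid s t m k)%:E)%E) _ _ _ c Z z) => //.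
- by move=> i j; exact: grid_nd.
- by move=> k; exact: stopping_grid.
- by move=> k; exact: IZ.
- move=> k A km FA; apply: Zz => //.
  by rewrite grid_ge//= -[leRHS](grid_last s t m) grid_nd.
- by move=> k; exact: aZ.
Qed.

End GridTime.

(** Grid times decrease to max(s, min(t, T)), and the grid values are uniformly integrable because
    |Z t| dominates them, so Vitali gives optional stopping in the limit. The maximum with s appears
    since only times after s may be compared on an event of [F s]. *)
Lemma martingale_stopped Z T : martingale P F Z -> sure_continuous Z ->
  stopping_time F T -> martingale P F (stopped Z T).
Proof.
move=> mZ cZ sT; have [aZ IZ h] := (martingaleP Z).1 mZ.
have key s t : 0 <= s -> s <= t -> Lone P (fun w => Z (Num.max s (capped T t w)) w) /\
    forall E, F s E -> Ex P (fun w => \1_E w * Z (Num.max s (capped T t w)) w) =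
      Ex P (fun w => \1_E w * Z t w).
  move=> s0 st; have t0 := le_trans s0 st.
  have := @vitali _ _ _ P (fun m w => Z (grid_time s t m T w) w)
    (fun w => Z (Num.max s (capped T t w)) w).
  case.
  - by move=> m; exact: measurable_grid_time.
  - by move=> w; apply: grid_time_cvg => //; exact: sT.1.
  - move=> e e0; have [c c0 hc] := ui_dominated (Lone_abs (IZ t t0)) (fun w => normr_ge0 _) e0.
    exists c => // _ [m _ <-]; apply: hc; first exact: measurable_grid_time.
    move=> c' c'0; apply: grid_time_tail => //; first exact/Lone_abs/IZ.
    move=> r E /andP[sr rt]; apply: martingale_abs_le => //; exact: le_trans sr.
  move=> _ IY cv; split=> // E FE.
  have mE := filt_meas s0 FE.
  have := cv 1 _ (measurable_indic mE) (abs_indic_le1 E).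
  rewrite (_ : (fun m => _) = fun=> Ex P (fun w => \1_E w * Z t w)); last first.
    by apply/funext => m; exact: grid_time_mart.
  by move=> cv'; exact: (cvg_unique (@Rhausdorff R) cv' (cvg_cst _)).
have max0 t : 0 <= t -> stopped Z T t = fun w => Z (Num.max 0 (capped T t w)) w.
  move=> t0; apply/funext => w; have /andP[c0 _] := capped_itv t0 (sT.1 w).
  by rewrite (max_idPr c0).
apply/martingaleP; split; first exact: adapted_stopped.
  by move=> t t0; rewrite max0//; have [] := key 0 t (lexx 0) t0.
move=> s t E s0 st FE; have t0 := le_trans s0 st; have mE := filt_meas s0 FE.
have [IY hY] := key s t s0 st.
have It : Lone P (stopped Z T t) by rewrite max0//; have [] := key 0 t (lexx 0) t0.
have Is : Lone P (stopped Z T s) by rewrite max0//; have [] := key 0 s (lexx 0) s0.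
have I1 f : Lone P f -> Lone P (fun w => \1_E w * f w).
  by move=> If; apply: LoneM_bdd If (measurable_indic mE) (abs_indic_le1 E).
apply/esym/eqP; rewrite -subr_eq0 -ExB; [|exact: I1|exact: I1].
(* The increment of the stopped process over [s, t] is the increment of Z from s to max(s, min(t,
   T)): both vanish if T <= s, and otherwise min(s, T) = s. *)
rewrite (_ : (fun w => _) = fun w => \1_E w * Z (Num.max s (capped T t w)) w -
   \1_E w * Z s w); last first.
  apply/funext => w; rewrite -!mulrBr; congr (_ * _); rewrite /stopped -/(capped T t w) -/(capped T s w).
  have [h1|h1] := leP (T w) s%:E.
    have h2 := capped_le (sT.1 w) h1.
    have h3 := capped_le (sT.1 w) (le_trans h1 (_ : s%:E <= t%:E)%E).
    rewrite (_ : capped T t w = capped T s w); last first.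
      by apply: EFin_inj; rewrite h2 h3// lee_fin.
    rewrite subrr max_l ?subrr//.
    by rewrite -lee_fin h2.
  by rewrite (capped_ge (ltW h1)) max_r// le_capped// ltW.
rewrite ExB; [|exact: I1|exact/I1/IZ].
by rewrite hY// -(h s t E)// subrr.
Qed.

Lemma stopped_fatou Z T t K (psi : R -> R) : adapted F Z -> sure_continuous Z ->
  stopping_time F T -> 0 <= t -> continuous psi -> (forall x, 0 <= psi x) ->
  (forall m, (\int[P]_w (psi (Z (grid_time 0 t m T w) w))%:E <= K%:E)%E) ->
  (\int[P]_w (psi (stopped Z T t w))%:E <= K%:E)%E.
Proof.
move=> aZ cZ sT t0 cpsi psi0 h.
apply: (@fatou_cvg _ _ _ P K (fun m w => psi (Z (grid_time 0 t m T w) w))) => //.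
- move=> m; apply: measurableT_comp; first exact: continuous_measurable_fun.
  exact: measurable_grid_time.
- move=> w; apply: (@cvg_comp _ _ _ (fun m => Z (grid_time 0 t m T w) w) psi); last exact: cpsi.
  have := grid_time_cvg (lexx 0) t0 (sT.1 w) (cZ w).
  by have /andP[c0 _] := capped_itv t0 (sT.1 w); rewrite (max_idPr c0).
Qed.

(** The level c is chosen before Z, T and t, so the estimate is uniform over stopping times. *)
Lemma stopped_dominated_ui z e : Lone P z -> (forall w, 0 <= z w) -> 0 < e ->
  exists2 c, 0 <= c & forall Z T t, adapted F Z -> sure_continuous Z ->
    stopping_time F T -> 0 <= t -> (forall r, 0 <= r -> Lone P (Z r)) ->
    (forall r E, 0 <= r <= t -> F r E ->
      Ex P (fun w => \1_E w * `|Z r w|) <= Ex P (fun w => \1_E w * z w)) ->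
    (\int[P]_w (tail c (stopped Z T t w))%:E <= e%:E)%E.
Proof.
move=> Iz z0 e0; have [c c0 hc] := ui_dominated Iz z0 e0.
exists c => // Z T t aZ cZ sT t0 IZ Zz.
apply: (stopped_fatou aZ cZ sT t0 (@tail_continuous _ c) (tail_ge0 c)) => m.
apply: hc; first exact: measurable_grid_time.
by move=> c' c'0; exact: grid_time_tail.
Qed.

(** The level 0 of the same tail estimate: for a nonnegative submartingale, with z its value at t,
    this is optional sampling. *)
Lemma stopped_dominated_le z Z T t : Lone P z -> (forall w, 0 <= z w) ->
    adapted F Z -> sure_continuous Z ->
    stopping_time F T -> 0 <= t -> (forall r, 0 <= r -> Lone P (Z r)) ->
    (forall r E, 0 <= r <= t -> F r E ->
      Ex P (fun w => \1_E w * `|Z r w|) <= Ex P (fun w => \1_E w * z w)) ->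
  (\int[P]_w (`|stopped Z T t w|)%:E <= (Ex P z)%:E)%E.
Proof.
move=> Iz z0 aZ cZ sT t0 IZ Zz.
apply: (stopped_fatou aZ cZ sT t0 (@norm_continuous _ _) (@normr_ge0 _ _)) => m.
rewrite (eq_integral (fun w => (tail 0 (Z (grid_time 0 t m T w) w))%:E)); last first.
  by move=> w _; rewrite tail0.
apply: le_trans (grid_time_tail aZ sT IZ (lexx 0) t0 m Iz Zz (lexx 0)) _.
rewrite lee_fin; apply: Ex_le => //.
  apply: LoneM_bdd Iz _ (abs_indic_le1 _); apply: measurable_indic.
  by apply: measurable_lt => //; apply: measurable_norm; exact: measurable_grid_time.
by move=> w; rewrite ler_piMl// lern1 leq_b1.
Qed.

End Stopping.

(** * Hitting times and localization *)

Section Hitting.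
Context {R : realType} {d} {Omega : measurableType d} (P : probability Omega R).
Variable F : R -> set (set Omega).
Hypothesis usualF : usual_filtration P F.
Implicit Types (Z G : R -> Omega -> R) (T : Omega -> \bar R).

(** The infimum of the empty set makes this +oo on paths that never reach the level. *)
Definition hitting G (k : R) w : \bar R :=
  ereal_inf [set t%:E | t in [set t | 0 <= t /\ k <= G t w]].

Section HittingOf.
Variables (G : R -> Omega -> R).
Hypothesis aG : adapted F G.
Hypothesis cG : sure_continuous G.

Lemma hitting_ge0 k w : (0 <= hitting G k w)%E.
Proof. by apply: le_ereal_inf_tmp => _ [t [t0 _] <-]; rewrite lee_fin. Qed.

Lemma hitting_leP k t w : 0 <= t ->
  (hitting G k w <= t%:E)%E <-> exists2 s, 0 <= s <= t & k <= G s w.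
Proof.
move=> t0; split=> [h|[s /andP[s0 st] kG]]; last first.
  apply: (@le_trans _ _ s%:E); last by rewrite lee_fin.
  by apply: ereal_inf_lbound; exists s.
apply: contrapT => hn.
have lt s : 0 <= s <= t -> G s w < k.
  by move=> st; rewrite ltNge; apply/negP => kG; apply: hn; exists s.
have e0 : 0 < k - G t w by rewrite subr_gt0 lt// t0 lexx.
have [dl d0 hd] := cpath_delta (@cG w) t0 e0.
have : ((t + dl)%:E <= hitting G k w)%E.
  apply: le_ereal_inf_tmp => _ [s [s0 kG] <-]; rewrite lee_fin leNgt; apply/negP => sd.
  have [st|ts] := leP s t; first by have := lt s; rewrite s0 st ltNge kG => /(_ isT).
  have : `|G t w - G s w| < k - G t w.
    by apply: hd => //; rewrite ltr0_norm ?subr_lt0//; lra.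
  by rewrite ltr_norml => /andP[]; lra.
move=> /le_trans/(_ h); rewrite lee_fin; lra.
Qed.

(** By continuity the maximum of the path on [0, t] is attained, so the level is reached exactly
    when rational times come within every 1/(m+1) of it. *)
Lemma hitting_stopping k : stopping_time F (hitting G k).
Proof.
split=> [w|t t0]; first exact: hitting_ge0.
have sF := filt_sigma usualF t0.
rewrite (_ : [set w | _] = \bigcap_m \bigcup_q
    [set w | k - m.+1%:R^-1 < G (clip_rat t q) w]); last first.
  apply/seteqP; split=> w /=.
    move=> /(hitting_leP _ _ t0)[s st kG] m _.
    have m0 : 0 < m.+1%:R^-1 :> R by rewrite invr_gt0.
    have [q hq] := cpath_rat (@cG w) st m0; exists q => //=.
    move: hq => /=; set e := _^-1; rewrite ltr_norml => /andP[_ h].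
    by rewrite ltrBlDr; apply: le_lt_trans kG _; rewrite addrC -ltrBlDr.
  move=> h; apply/hitting_leP => //.
  have [s st hs] := cpath_max (@cG w) t0; exists s => //.
  rewrite leNgt; apply/negP => Gk.
  have [m hm] : exists m, m.+1%:R^-1 <= k - G s w.
    exists (Num.truncn (k - G s w)^-1); rewrite -[leRHS]invrK lef_pV2 ?posrE ?invr_gt0 ?subr_gt0//.
    exact/ltW/truncnS_gt.
  have [q _ /= hq] := h m I.
  have := hs (clip_rat t q) (clip_rat_itv q t0) => /=.
  by move: hm hq; move: (m.+1%:R^-1) => e hm hq; lra.
apply: sigma_bigcap => // m; apply: sigma_bigcup_rat => // q.
have /andP[q0 qt] := clip_rat_itv q t0.
apply: sigma_lt => //; first exact: rv_cst.
by apply: (filt_rv usualF q0 qt); exact: aG.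
Qed.

(** If the level were exceeded at t it would already be exceeded slightly before t, hence before the
    hitting time. *)
Lemma hitting_bound k t w : G 0 w <= k -> 0 <= t -> (t%:E <= hitting G k w)%E ->
  G t w <= k.
Proof.
move=> G0 t0 tT; rewrite leNgt; apply/negP => kG.
have [t00|t00] := eqVneq t 0; first by rewrite t00 ltNge G0 in kG.
have e0 : 0 < G t w - k by rewrite subr_gt0.
have [dl d0 hd] := cpath_delta (@cG w) t0 e0.
have tp : 0 < t by rewrite lt_neqAle eq_sym t00.
pose r := Num.max 0 (t - dl / 2).
have r0 : 0 <= r by rewrite le_max lexx.
have rt : r < t by rewrite gt_max tp/=; lra.
have dlt : t - r < dl.
  by rewrite /r /Num.max; case: (ltP 0 (t - dl / 2)) => ?; lra.
have : `|G t w - G r w| < G t w - k by apply: hd => //; rewrite gtr0_norm ?subr_gt0.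
rewrite ltr_norml => /andP[_ h].
have : (hitting G k w <= r%:E)%E by apply/hitting_leP => //; exists r; rewrite ?r0 ?lexx//; lra.
by move=> /(le_trans tT); rewrite lee_fin leNgt rt.
Qed.

Lemma hitting_capped k t w : 0 <= t -> (hitting G k w <= t%:E)%E ->
  k <= G (capped (hitting G k) t w) w.
Proof.
move=> t0 h; have c := capped_le (hitting_ge0 k w) h.
have /andP[c0 ct] := capped_itv t0 (hitting_ge0 k w).
have : (hitting G k w <= (capped (hitting G k) t w)%:E)%E by rewrite c.
move=> /(hitting_leP _ _ c0)[s /andP[s0 sc] kG].
have : (hitting G k w <= s%:E)%E by apply/hitting_leP => //; exists s; rewrite ?s0 ?lexx.
rewrite -c lee_fin => cs.
by have <- : s = capped (hitting G k) t w by apply/le_anti/andP.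
Qed.

Lemma hitting_eventually t w : 0 <= t ->
  \forall n \near \oo, (t%:E <= hitting G n%:R w)%E.
Proof.
move=> t0; have [s st hs] := cpath_max (@cG w) t0.
near=> n; rewrite leNgt; apply/negP => /ltW/(hitting_leP _ _ t0)[r rt nG].
have := hs r rt; apply/negP; rewrite -ltNge (lt_le_trans _ nG)//.
near: n; exact: nbhs_infty_gtr.
Unshelve. all: by end_near. Qed.

End HittingOf.

Lemma capped_mono T s t w : (0 <= T w)%E -> 0 <= s -> s <= t -> capped T s w <= capped T t w.
Proof.
move=> T0 s0 st; have t0 := le_trans s0 st.
have /andP[c0 cs] := capped_itv s0 T0.
by apply: le_capped; [exact: capped_leT|exact: le_trans st].
Qed.

Lemma capped_lip T s t w : (0 <= T w)%E -> 0 <= s -> s <= t ->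
  capped T t w - capped T s w <= t - s.
Proof.
move=> T0 s0 st; have t0 := le_trans s0 st.
have /andP[_ ct] := capped_itv t0 T0.
have [h|h] := leP (T w) s%:E.
  rewrite (_ : capped T t w = capped T s w) ?subrr ?subr_ge0//.
  by apply: EFin_inj; rewrite !capped_le// (le_trans h)// lee_fin.
by rewrite (capped_ge (ltW h)) lerD2r.
Qed.

(* Unlike in [localized], the localization is required on every path. *)
Definition localizable Z := exists tau : nat -> Omega -> \bar R,
  [/\ forall n, stopping_time F (tau n),
      forall w t, 0 <= t -> \forall n \near \oo, stopped Z (tau n) t w = Z t w
    & forall n, martingale P F (stopped Z (tau n))].

Lemma stopped_bound Z T t c w : 0 <= t -> (0 <= T w)%E ->
  (forall t, 0 <= t -> (t%:E <= T w)%E -> `|Z t w| <= c) -> `|stopped Z T t w| <= c.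
Proof.
move=> t0 T0 h; have /andP[c0 _] := capped_itv t0 T0.
by apply: h => //; exact: capped_leT.
Qed.

Lemma continuous_stopped_path Z T w : cpath (Z ^~ w) -> (0 <= T w)%E ->
  cpath ((stopped Z T) ^~ w).
Proof.
move=> cZ tau0.
have c0 : cpath (fun t => Z (Num.max 0 (capped T (Num.max 0 t) w)) w).
  move=> t; apply: (@cvg_comp _ _ _ (fun t => capped T (Num.max 0 (Num.max 0 t)) w) (fun t => Z (Num.max 0 t) w)); last exact: cZ.
  apply/cvgrPdist_lt => e e0; near=> s.
  rewrite !(max_idPr (_ : 0 <= Num.max 0 _)) ?le_max ?lexx//.
  have le (x : R) : 0 <= Num.max 0 x by rewrite le_max lexx.
  have : `|capped T (Num.max 0 t) w - capped T (Num.max 0 s) w| <= `|t - s|.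
    have h1 := ler_norm (t - s); have h2 := ler_norm (s - t); rewrite distrC in h2.
    have [ts|ts] := leP (Num.max 0 t) (Num.max 0 s).
      have := capped_mono tau0 (le t) ts; have := capped_lip tau0 (le t) ts.
      move: ts; rewrite ler_norml /Num.max.
      by case: (ltP 0 t) => ?; case: (ltP 0 s) => ? ? ? ?; apply/andP; split; lra.
    have := capped_mono tau0 (le s) (ltW ts); have := capped_lip tau0 (le s) (ltW ts).
    move: ts; rewrite ler_norml /Num.max.
    by case: (ltP 0 t) => ?; case: (ltP 0 s) => ? ? ? ?; apply/andP; split; lra.
  move=> /le_lt_trans; apply; near: s; exact: cvgr_dist_lt.
apply: eq_cpath c0 => t t0.
have /andP[h _] := capped_itv t0 tau0.
by rewrite (max_idPr t0) (max_idPr h).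
Unshelve. all: by end_near. Qed.

(** The doubly stopped processes are martingales with the common bound c; bounded convergence then
    removes the localizing times. *)
Lemma localizable_stopped Z T c : adapted F Z -> sure_continuous Z -> localizable Z ->
  stopping_time F T ->
  (forall t w, 0 <= t -> (t%:E <= T w)%E -> `|Z t w| <= c) -> martingale P F (stopped Z T).
Proof.
move=> aZ cZ [tau [stau ev mtau]] sT Zc.
have mT n : martingale P F (stopped (stopped Z (tau n)) T).
  apply: martingale_stopped => // w.
  by apply: continuous_stopped_path => //; exact: (stau n).1.
have aT := adapted_stopped usualF aZ cZ sT.
have b0 t w : 0 <= t -> `|stopped Z T t w| <= c.
  by move=> t0; apply: stopped_bound => //; [exact: sT.1|move=> r r0 rT; exact: Zc].
have bn n t w : 0 <= t -> `|stopped (stopped Z (tau n)) T t w| <= c.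
  move=> t0; have /andP[c0 ct] := capped_itv t0 (sT.1 w).
  have /andP[c1 c2] := capped_itv c0 ((stau n).1 w).
  apply: Zc => //; apply: le_trans (capped_leT t0 (sT.1 w)).
  by rewrite lee_fin.
apply/martingaleP => //; split=> //.
  by move=> t t0; apply: (@Lone_bdd _ _ _ _ c); [exact: (adapted_mfun usualF aT)|move=> w; exact: b0].
have lim t E : 0 <= t -> measurable E ->
    Ex P (fun w => \1_E w * stopped (stopped Z (tau n)) T t w) @[n --> \oo] -->
    Ex P (fun w => \1_E w * stopped Z T t w).
  move=> t0 mE; apply: (@Ex_cvg_bdd _ _ _ _ c).
  - move=> n; apply: measurable_funM; first exact: measurable_indic.
    exact: Lone_meas (martingale_Lone usualF (mT n) t0).
  - move=> n w; rewrite normrM (le_trans _ (bn n t w t0))// ler_piMl// abs_indic_le1//.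
  - move=> w; apply: cvg_near_cst; near=> n; congr (_ * _).
    near: n; have /andP[c0 _] := capped_itv t0 (sT.1 w).
    exact: ev.
move=> s t E s0 st FE; have mE := filt_meas usualF s0 FE.
have hs := lim s E s0 mE; have ht := lim t E (le_trans s0 st) mE.
apply: (cvg_unique (@Rhausdorff R) hs); apply: cvg_trans ht.
apply: near_eq_cvg; apply: nearW => n.
by have [_ _ h] := (martingaleP usualF _).1 (mT n); rewrite (h s t E).
Unshelve. all: by end_near. Qed.

(** An increment is orthogonal to the value at its left end, so its second moment is the increment
    of the second moment. *)
Lemma telescope_sq_martingale D c (u : nat -> R) n : martingale P F D ->
  (forall t w, 0 <= t -> `|D t w| <= c) -> (forall k, 0 <= u k) ->
  (forall k, u k <= u k.+1) ->
  Ex P (fun w => \sum_(k < n) (D (u k.+1) w - D (u k) w) ^+ 2) =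
  Ex P (fun w => D (u n) w ^+ 2) - Ex P (fun w => D (u 0%N) w ^+ 2).
Proof.
move=> mD Dc u0 uS; have [aD ID _] := (martingaleP usualF D).1 mD.
have mDu k : measurable_fun setT (D (u k)) by exact: Lone_meas (ID _ (u0 k)).
have I2 k l : Lone P (fun w => D (u k) w * D (u l) w).
  by apply: (@LoneM_bdd _ _ _ _ c) => //; [exact: ID|move=> w; exact: Dc].
elim: n => [|n ih].
  by rewrite subrr -[RHS](Ex_cst P 0); apply: eq_Ex => w; rewrite big_ord0.
have Id k : Lone P (fun w => (D (u k.+1) w - D (u k) w) ^+ 2).
  rewrite (_ : (fun w => _) = fun w => (D (u k.+1) w * D (u k.+1) w - 2 * (D (u k.+1) w * D (u k) w)) + D (u k) w * D (u k) w); last by apply/funext => w; ring.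
  by apply: LoneD => //; apply: LoneB => //; exact: LoneZ.
have Is : Lone P (fun w => \sum_(k < n) (D (u k.+1) w - D (u k) w) ^+ 2).
  by apply: Lone_sum => k.
rewrite (_ : (fun w => _) = fun w => \sum_(k < n) (D (u k.+1) w - D (u k) w) ^+ 2 +
   (D (u n.+1) w - D (u n) w) ^+ 2); last first.
  by apply/funext => w; rewrite big_ord_recr.
rewrite ExD// ih; set a := Ex P (fun w => _ (u 0%N) _ ^+ 2).
have o := martingale_orth usualF mD (u0 n) (uS n) (aD _ (u0 n)) (fun w => Dc _ w (u0 n)).
rewrite (_ : (fun w => (_ - _) ^+ 2) = fun w => (D (u n.+1) w * D (u n.+1) w - 2 * (D (u n) w * D (u n.+1) w)) + D (u n) w * D (u n) w); last by apply/funext => w; ring.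
rewrite ExD//; last by apply: LoneB => //; exact: LoneZ.
rewrite ExB//; last exact: LoneZ.
rewrite ExZ// o.
have e k : Ex P (fun w => D (u k) w ^+ 2) = Ex P (fun w => D (u k) w * D (u k) w).
  by apply: eq_Ex => w.
by rewrite !e; ring.
Qed.

(* E (D t)^2 is the expected sum of the squared increments along a grid, at most
   their maximum times the variation, and the maximum tends to 0. *)
Lemma bounded_variation_martingale D V c t : martingale P F D -> sure_continuous D ->
  (forall t w, 0 <= t -> `|D t w| <= c) -> (forall w, D 0 w = 0) ->
  (forall s t w, 0 <= s -> s <= t -> `|D t w - D s w| <= V t w - V s w) ->
  (forall t w, 0 <= t -> `|V t w| <= c) -> 0 <= t ->
  Ex P (fun w => D t w ^+ 2) = 0.
Proof.
move=> mD cD Dc D0 DV Vc t0; have [aD ID _] := (martingaleP usualF D).1 mD.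
have g0 m k : 0 <= grid 0 t m k by exact: grid_ge.
have gS m k : grid 0 t m k <= grid 0 t m k.+1 by exact: grid_nd.
have mDg m k : measurable_fun setT (D (grid 0 t m k)) by exact: Lone_meas (ID _ (g0 m k)).
pose S m w := \sum_(k < m.+1) (D (grid 0 t m k.+1) w - D (grid 0 t m k) w) ^+ 2.
have ES m : Ex P (S m) = Ex P (fun w => D t w ^+ 2).
  rewrite (telescope_sq_martingale _ mD Dc (g0 m) (gS m)) grid_last grid0.
  rewrite [X in _ - X](_ : _ = 0) ?subr0//.
  by rewrite -[RHS](Ex_cst P 0); apply: eq_Ex => w; rewrite D0 expr0n.
have tel m w n : \sum_(k < n) (V (grid 0 t m k.+1) w - V (grid 0 t m k) w) =
    V (grid 0 t m n) w - V 0 w.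
  elim: n => [|n ih]; first by rewrite big_ord0 grid0 subrr.
  by rewrite big_ord_recr/= ih; ring.
have Sle m w om : (forall k, (k < m.+1)%N -> `|D (grid 0 t m k.+1) w - D (grid 0 t m k) w| <= om) ->
    S m w <= om * (V t w - V 0 w).
  move=> h; rewrite -[X in V X w](grid_last 0 t m) -tel mulr_sumr.
  apply: ler_sum => k _; have hk := h k (ltn_ord k).
  rewrite -(real_normK (num_real _)) expr2.
  have n0 : 0 <= `|D (grid 0 t m k.+1) w - D (grid 0 t m k) w| by [].
  by rewrite ler_pM//; exact: DV.
have S0 m w : 0 <= S m w by apply: sumr_ge0 => k _; exact: sqr_ge0.
have c0 : 0 <= c by rewrite (le_trans _ (Dc 0 point (lexx 0))).
have Vle w : V t w - V 0 w <= c + c.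
  by rewrite (le_trans (ler_norm _))// (le_trans (ler_normB _ _))// lerD// Vc.
have : Ex P (S m) @[m --> \oo] --> Ex P (fun=> 0 : R).
  apply: (@Ex_cvg_bdd _ _ _ _ ((c + c) * (c + c))).
  - move=> m; apply: measurable_sum => k; apply: measurable_funX.
    by apply: measurable_funB.
  - move=> m w; rewrite ger0_norm//; apply: le_trans (Sle m w (c + c) _) _.
      by move=> k _; rewrite (le_trans (ler_normB _ _))// lerD// Dc.
    by rewrite ler_wpM2l// addr_ge0.
  - move=> w; apply/cvgrPdist_le => e e0.
    (* The total variation V t - V 0 is at most 2c, and increments of D of this size make the sum of
       squares at most e. *)
    have e1 : 0 < e / (c + c + 1) by rewrite divr_gt0// ltr_wpDl// addr_ge0.
    have [dl d0 hd] := cpath_unif t (cD w) e1.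
    near=> m; rewrite sub0r normrN ger0_norm//.
    apply: le_trans (Sle m w (e / (c + c + 1)) _) _.
      move=> k km; have gkt j : (j <= m.+1)%N -> 0 <= grid 0 t m j <= t.
        by move=> jm; rewrite g0/= -[leRHS](grid_last 0 t m) grid_nd.
      apply: hd; [exact: gkt|exact/gkt/ltnW|].
      rewrite gridS addrC addKr ger0_norm ?divr_ge0 ?subr_ge0//.
      near: m; have /cvgrPdist_le/(_ _ d0) := mesh_cvg 0 t.
      by apply: filterS => m; rewrite sub0r normrN ger0_norm ?divr_ge0 ?subr_ge0.
    apply: le_trans (ler_wpM2l (ltW e1) (Vle w)) _.
    rewrite -mulrA ler_piMr//; first exact: ltW.
    by rewrite mulrC ler_pdivrMr ?ltr_wpDl ?addr_ge0// mul1r lerDl.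
rewrite (_ : (fun m => Ex P (S m)) = fun=> Ex P (fun w => D t w ^+ 2)); last by apply/funext.
by rewrite Ex_cst => h; exact: (cvg_unique (@Rhausdorff R) (cvg_cst _) h).
Unshelve. all: by end_near. Qed.

End Hitting.

(** * The local martingale M/I + log I *)

Section Compensator.
Context {R : realType} {d} {Omega : measurableType d} (P : probability Omega R).
Variable F : R -> set (set Omega).
Hypothesis usualF : usual_filtration P F.
Variable M : R -> Omega -> R.
Hypothesis aM : adapted F M.
Hypothesis cM : sure_continuous M.
Hypothesis M_gt0 : forall t w, 0 <= t -> 0 < M t w.
Let I t w := path_inf (M ^~ w) t.
Hypothesis aI : adapted F I.
Hypothesis cI : sure_continuous I.

Definition log_excess t w := M t w / I t w + ln (I t w).

Let I_gt0 t w : 0 <= t -> 0 < I t w.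
Proof. by move=> t0; apply: path_inf_gt0 => // s s0; exact: M_gt0. Qed.

Lemma adapted_log_excess : adapted F log_excess.
Proof.
move=> t t0; have sF := filt_sigma usualF t0.
apply: rvD => //; last by apply: rv_ln => //; exact: aI.
by apply: rvM => //; [exact: aM|apply: rvV => //; exact: aI].
Qed.

Lemma continuous_log_excess : sure_continuous log_excess.
Proof.
move=> w; apply: cpathD.
  apply: cpathM; first exact: cM.
  by apply: cpathV; [move=> t t0; rewrite gt_eqF// I_gt0|exact: cI].
by apply: cpath_ln; [move=> t t0; rewrite I_gt0|exact: cI].
Qed.

Variables (T : Omega -> \bar R) (c : R).
Hypothesis sT : stopping_time F T.
Hypothesis Mc : forall t w, 0 <= t -> (t%:E <= T w)%E -> M t w <= c /\ (M t w)^-1 <= c.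

Let Ic t w : 0 <= t -> (t%:E <= T w)%E -> I t w <= c /\ (I t w)^-1 <= c.
Proof.
move=> t0 tT; have [s /andP[s0 st] e] := path_inf_attained (@cM w) t0.
rewrite /I e; apply: Mc => //; apply: le_trans tT; rewrite lee_fin//.
Qed.

Lemma log_excess_bound t w : 0 <= t -> (t%:E <= T w)%E -> `|log_excess t w| <= c * c + c.
Proof.
move=> t0 tT; have [i1 i2] := Ic t0 tT; have [m1 m2] := Mc t0 tT.
have i0 := I_gt0 w t0; have m0 := M_gt0 w t0.
apply: le_trans (ler_normD _ _) _; apply: lerD.
  rewrite ger0_norm; last by rewrite divr_ge0// ltW.
  by apply: ler_pM => //; [exact: ltW|rewrite invr_ge0 ltW].
have h1 := ln_le_sub1 i0.
have iV : 0 < (I t w)^-1 by rewrite invr_gt0.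
have h2 := ln_le_sub1 iV; rewrite lnV// in h2.
by rewrite ler_norml; apply/andP; split; lra.
Qed.

Hypothesis mMT : martingale P F (stopped M T).

(** Left-point sums of dM/I along the stopped grid are orthogonal to [F s]. By [path_inf_sum] they
    converge pathwise to the increment of M/I + log I, and they are bounded, so the limit is
    orthogonal to [F s] too. *)
Lemma martingale_log_excess : martingale P F (stopped log_excess T).
Proof.
have T0 := sT.1.
have aL := adapted_stopped usualF adapted_log_excess continuous_log_excess sT.
have aMT := adapted_stopped usualF aM cM sT.
have aIT := adapted_stopped usualF aI cI sT.
have capT t w : 0 <= t -> ((capped T t w)%:E <= T w)%E by move=> t0; exact: capped_leT.
have cap0 t w : 0 <= t -> 0 <= capped T t w by move=> t0; have /andP[] := capped_itv t0 (T0 w).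
have bL t w : 0 <= t -> `|stopped log_excess T t w| <= c * c + c.
  by move=> t0; apply: log_excess_bound; [exact: cap0|exact: capT].
have IL t : 0 <= t -> Lone P (stopped log_excess T t).
  move=> t0; apply: (@Lone_bdd _ _ _ _ (c * c + c)); last by move=> w; exact: bL.
  exact: (adapted_mfun usualF aL).
have c0 : 0 <= c.
  have [h _] := @Mc 0 point (lexx 0) (T0 point).
  by rewrite (le_trans _ h)// ltW// M_gt0.
apply/(martingaleP usualF); split; [exact: aL|exact: IL|move=> s t E s0 st FE].
have t0 := le_trans s0 st; have mE := filt_meas usualF s0 FE.
pose u m k w := capped T (grid s t m k) w.
pose S m w := \sum_(k < m.+1) (M (u m k.+1 w) w - M (u m k w) w) / I (u m k w) w.
have g0 m k : 0 <= grid s t m k by rewrite (le_trans s0)// grid_ge.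
have gS m k : grid s t m k <= grid s t m k.+1 by exact: grid_nd.
have IT k m w : 0 <= (I (u m k w) w)^-1 <= c.
  have [_ ->] := Ic (cap0 _ w (g0 m k)) (capT _ w (g0 m k)).
  by rewrite invr_ge0 ltW// I_gt0// cap0.
have mV k m : rv_measurable (F (grid s t m k)) (fun w => (I (u m k w) w)^-1).
  by apply: (rvV (filt_sigma usualF (g0 m k))); exact: aIT.
have IMT m k : Lone P (fun w => M (u m k w) w) by exact: (martingale_Lone usualF mMT (g0 m k)).
have FE' m k : F (grid s t m k) E by apply: (filt_mono usualF s0) FE; exact: grid_ge.
have mc m k : rv_measurable (F (grid s t m k)) (fun w => \1_E w * (I (u m k w) w)^-1).
  have sg := filt_sigma usualF (g0 m k).
  by apply: rvM; [exact: sg|apply: (rv_indic sg); exact: FE'|exact: mV].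
have bc m k w : `|\1_E w * (I (u m k w) w)^-1| <= c.
  have /andP[i0 i1] := IT k m w.
  by rewrite normrM (le_trans (ler_piMl _ (abs_indic_le1 E w)))// ger0_norm.
have mc' m k : measurable_fun setT (fun w => \1_E w * (I (u m k w) w)^-1).
  exact: (rv_mfun (filt_meas usualF (g0 m k)) (mc m k)).
(* Each summand is a bounded coefficient known at the left grid point times an increment of the
   stopped M. *)
have ES m : Ex P (fun w => \1_E w * S m w) = 0.
  rewrite (_ : (fun w => _) = fun w => \sum_(k < m.+1)
     (\1_E w * (I (u m k w) w)^-1 * M (u m k.+1 w) w -
      \1_E w * (I (u m k w) w)^-1 * M (u m k w) w)); last first.
    by apply/funext => w; rewrite mulr_sumr; apply: eq_bigr => k _; ring.
  have I1 k l : Lone P (fun w => \1_E w * (I (u m k w) w)^-1 * M (u m l w) w).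
    exact: LoneM_bdd (IMT m l) (mc' m k) (bc m k).
  rewrite Ex_sum => [|k]; last exact: LoneB.
  apply: big1 => k _; rewrite ExB//.
  have := martingale_orth usualF mMT (g0 m k) (gS m k) (mc m k) (bc m k).
  by rewrite /stopped -/(capped _ _ _) => ->; rewrite subrr.
pose Dl w := stopped log_excess T t w - stopped log_excess T s w.
(* The pathwise error is the oscillation om of M times the increase of 1/I, itself at most c. *)
have Sdist m w om :
    (forall a b, 0 <= a <= capped T t w -> 0 <= b <= capped T t w ->
       `|a - b| <= (t - s) / m.+1%:R -> `|M a w - M b w| <= om) -> 0 <= om ->
    `|S m w - Dl w| <= om * c.
  move=> h om0.
  have ul k : (k <= m.+1)%N -> u m k w <= capped T t w.
    by move=> km; rewrite -(grid_last s t m); apply: capped_mono => //; exact: grid_nd.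
  have us k : u m k w <= u m k.+1 w by apply: capped_mono.
  have := @path_inf_sum _ (M ^~ w) (@cM w) (fun t t0 => M_gt0 w t0) (u m ^~ w) m.+1 om
    (cap0 _ w (g0 m 0%N)) us.
  rewrite /u grid0 grid_last => hp; apply: le_trans (hp _) _.
    move=> k km a b /andP[a1 a2] /andP[b1 b2]; apply: h.
    - by rewrite (le_trans (cap0 _ w (g0 m k)) a1) (le_trans a2)// ul.
    - by rewrite (le_trans (cap0 _ w (g0 m k)) b1) (le_trans b2)// ul.
    - have hl : u m k.+1 w - u m k w <= grid s t m k.+1 - grid s t m k.
        exact: capped_lip.
      have e : grid s t m k.+1 - grid s t m k = (t - s) / m.+1%:R by rewrite gridS; ring.
      rewrite e in hl.
      have a1' : u m k w <= a := a1; have a2' : a <= u m k.+1 w := a2.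
      have b1' : u m k w <= b := b1; have b2' : b <= u m k.+1 w := b2.
      move: hl a1' a2' b1' b2'; move: (_ / _) (u m k w) (u m k.+1 w) => q x y *.
      by rewrite ler_norml; apply/andP; split; lra.
  rewrite ler_wpM2l//.
  have [_ h1] := Ic (cap0 _ w t0) (capT _ w t0).
  have h2 : 0 <= (I (capped T s w) w)^-1 by rewrite invr_ge0 ltW// I_gt0// cap0.
  by rewrite lerBlDr (le_trans h1)// lerDl.
have Dlc : Ex P (fun w => \1_E w * S m w) @[m --> \oo] --> Ex P (fun w => \1_E w * Dl w).
  (* The first term is the distance estimate with om = c, valid because 0 < M <= c; the others bound
     the two stopped values whose difference is [Dl]. *)
  apply: (@Ex_cvg_bdd _ _ _ _ (c * c + ((c * c + c) + (c * c + c)))).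
  - move=> m; apply: measurable_funM; first exact: measurable_indic.
    apply: measurable_sum => k; apply: measurable_funM.
      by apply: measurable_funB; exact: Lone_meas (IMT m _).
    exact: (rv_mfun (filt_meas usualF (g0 m k)) (mV _ _)).
  - move=> m w; rewrite normrM (le_trans (ler_piMl _ (abs_indic_le1 E w)))//.
    rewrite (_ : S m w = (S m w - Dl w) + Dl w); last by ring.
    rewrite (le_trans (ler_normD _ _))// lerD//.
      apply: Sdist => // a b /andP[a0 a1] /andP[b0 b1] _.
      have [ma _] := Mc a0 (le_trans (a1 : (_%:E <= _%:E)%E) (capT t w t0)).
      have [mb _] := Mc b0 (le_trans (b1 : (_%:E <= _%:E)%E) (capT t w t0)).
      have := M_gt0 w a0; have := M_gt0 w b0.
      by rewrite ler_norml => ? ?; apply/andP; split; lra.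
    by rewrite (le_trans (ler_normB _ _))// lerD// bL.
  - move=> w; apply: cvgMr; apply/cvgrPdist_le => e e0.
    have e1 : 0 < e / (c + 1) by rewrite divr_gt0// ltr_wpDl.
    have [dl d0 hd] := cpath_unif (capped T t w) (@cM w) e1.
    near=> m; rewrite distrC; apply: le_trans (Sdist m w (e / (c + 1)) _ (ltW e1)) _.
      move=> a b ha hb hab; apply: hd => //; apply: le_trans hab _.
      near: m; have /cvgrPdist_le/(_ _ d0) := mesh_cvg s t.
      by apply: filterS => m; rewrite sub0r normrN ger0_norm ?divr_ge0 ?subr_ge0.
    rewrite -mulrA ler_piMr//; first exact: ltW.
    by rewrite mulrC ler_pdivrMr ?ltr_wpDl// mul1r lerDl.
have D0 : Ex P (fun w => \1_E w * Dl w) = 0.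
  move: Dlc; rewrite (_ : (fun m => _) = fun=> 0); last exact/funext.
  by move=> h; exact: (cvg_unique (@Rhausdorff R) h (cvg_cst _)).
have I1 r : 0 <= r -> Lone P (fun w => \1_E w * stopped log_excess T r w).
  by move=> r0; apply: LoneM_bdd (IL r r0) (measurable_indic mE) (abs_indic_le1 E).
apply/esym/eqP; rewrite -subr_eq0 -ExB; [|exact: I1|exact: I1].
by rewrite -[X in _ == X]D0; apply/eqP; apply: eq_Ex => w; rewrite /Dl; ring.
Unshelve. all: by end_near. Qed.

End Compensator.

(** * Uniform convergence in probability *)

Section LeftContinuity.
Context {R : realType}.
Implicit Types z : R -> R.

(** Simple integrands are left-continuous but not continuous. Left-continuity at positive times is
    enough to reduce suprema over ]0, t] to rational times. *)
Definition lcpath z := forall s, 0 < s -> z x @[x --> s^'-] --> z s.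

Lemma cpath_lc z : cpath z -> lcpath z.
Proof.
move=> cz s s0; apply/cvgrPdist_lt => e e0.
have [dl d0 hd] := cpath_delta cz (ltW s0) e0.
have sd : s - dl < s by lra.
near=> x; have xs : x < s by near: x; exact: nbhs_left_lt.
have x1 : s - dl < x by near: x; exact: nbhs_left_gt.
have x0 : 0 < x by near: x; exact: nbhs_left_gt.
by apply: hd; [exact: ltW|rewrite gtr0_norm ?subr_gt0//; lra].
Unshelve. all: by end_near. Qed.

Lemma lcpathB z z' : lcpath z -> lcpath z' -> lcpath (fun t => z t - z' t).
Proof. by move=> h h' s s0; apply: cvgB; [exact: h|exact: h']. Qed.

Lemma lcpathM z z' : lcpath z -> lcpath z' -> lcpath (fun t => z t * z' t).
Proof. by move=> h h' s s0; apply: cvgM; [exact: h|exact: h']. Qed.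

Lemma lcpath_cst c : lcpath (fun=> c).
Proof. by move=> s s0; exact: cvg_cst. Qed.

Lemma lcpath_sum (I : Type) (r : seq I) (h : I -> R -> R) :
  (forall i, lcpath (h i)) -> lcpath (fun t => \sum_(i <- r) h i t).
Proof.
move=> hh; elim: r => [|i r ih].
  have -> : (fun t => \sum_(i <- [::]) h i t) = fun=> 0.
    by apply/funext => t; rewrite big_nil.
  exact: lcpath_cst.
have -> : (fun t => \sum_(j <- i :: r) h j t) = fun t => h i t + \sum_(j <- r) h j t.
  by apply/funext => t; rewrite big_cons.
by move=> s s0; apply: cvgD; [exact: hh|exact: ih].
Qed.

Lemma lcpath_indic (a b : R) : lcpath (fun s => (a < s <= b)%R%:R).
Proof.
move=> s s0; apply: cvg_near_cst.
have [as_|sa] := ltP a s; last first.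
  near=> x; have xs : x < s by near: x; exact: nbhs_left_lt.
  by rewrite ltNge (ltW (lt_le_trans xs sa)).
have [sb|bs] := leP s b.
  near=> x; have xs : x < s by near: x; exact: nbhs_left_lt.
  have ax : a < x by near: x; exact: nbhs_left_gt.
  by rewrite (le_trans (ltW xs) sb) ax.
near=> x; have bx : b < x by near: x; exact: nbhs_left_gt.
by rewrite (leNgt x) bx /= !andbF.
Unshelve. all: by end_near. Qed.

Lemma cpath_min_cst z c : 0 <= c -> cpath z -> cpath (fun s => z (Num.min c s)).
Proof.
move=> c0 cz.
rewrite /cpath.
have -> : (fun s => z (Num.min c (Num.max 0 s))) = fun s => z (Num.max 0 (Num.min c s)).
  by apply/funext => s; rewrite min_maxr (min_idPr c0).
move=> t.
apply: (@cvg_comp _ _ _ (fun s => Num.min c s) (fun s => z (Num.max 0 s))); last exact: cz.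
apply/cvgrPdist_lt => eps e0; near=> s.
apply: (@le_lt_trans _ _ `|t - s|); last by near: s; exact: cvgr_dist_lt.
have h1 := ler_norm (t - s); have h2 := ler_norm (s - t); rewrite distrC in h2.
rewrite /Num.min ler_norml.
by case: (ltP c t) => ?; case: (ltP c s) => ?; apply/andP; split; lra.
Unshelve. all: by end_near. Qed.

End LeftContinuity.

Section Ucp.
Context {R : realType} {d} {Omega : measurableType d} (P : probability Omega R).
Variable F : R -> set (set Omega).
Hypothesis usualF : usual_filtration P F.
Implicit Types (Y Z V : R -> Omega -> R).

Definition sup_event Y (t e : R) := [set w | exists2 s, 0 < s <= t & e < `|Y s w|].

(** By left-continuity, an exceedance at s already occurs at a rational time just before s. *)
Lemma measurable_sup_event Y t e :
  (forall s, 0 <= s -> measurable_fun setT (Y s)) -> (forall w, lcpath (Y ^~ w)) ->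
  measurable (sup_event Y t e).
Proof.
move=> mY cY.
have -> : sup_event Y t e = \bigcup_(q : rat)
   (if (0 < (ratr q : R) <= t)%R then [set w | e < `|Y (ratr q) w|] else set0); last first.
  apply: bigcupT_measurable_rat => q; case: ifPn => // /andP[q0 _].
  by apply: measurable_lt => //; apply: measurable_norm; apply: mY; exact: ltW.
apply/seteqP; split=> w; last first.
  by move=> [q _]; case: ifPn => // h /= hq; exists (ratr q).
move=> [s /andP[s0 st] es].
have : \forall x \near s^'-, e < `|Y x w| /\ 0 < x.
  near=> x; split; last by near: x; exact: nbhs_left_gt.
  near: x; have /cvgrPdist_lt := cY w s s0.
  have e0 : 0 < `|Y s w| - e by rewrite subr_gt0.
  move=> /(_ _ e0); apply: filterS => x hx.
  have := ler_dist_dist (Y s w) (Y x w).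
  by move=> /(le_trans (ler_norm _)); lra.
move=> [dl /= d0 hd].
have h : s - dl < s by lra.
have [q] := rat_in_itvoo h; rewrite in_itv/= => /andP[q1 q2].
have [|eq q0] := hd (ratr q) _ q2.
  by rewrite /= ger0_norm ?subr_ge0 ?ltW//; lra.
by exists q => //; rewrite q0 (ltW (lt_le_trans q2 st)).
Unshelve. all: by end_near. Qed.

Lemma ucp_smallP (Y : nat -> R -> Omega -> R) Z :
  (forall n t e, measurable (sup_event (fun s w => Y n s w - Z s w) t e)) ->
  ucp_cvg P Y Z <-> (forall t e, 0 <= t -> 0 < e ->
    small P (fun n => sup_event (fun s w => Y n s w - Z s w) t e)).
Proof.
move=> mS; split=> h t e t0 e0; have sc := small_cvg P (fun n => mS n t e).
  by apply: sc.2; exact: h.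
by apply: sc.1; exact: h.
Qed.

(** The usual conditions put the negligible sets into [F 0], so the probability space is
    complete. *)
Lemma negligible_measurable (N : set Omega) : P.-negligible N -> measurable N.
Proof. by move=> h; apply: (filt_meas usualF (lexx 0)); exact: (filt_null usualF). Qed.

Lemma measure_ae_eq (S S' N : set Omega) : P.-negligible N -> measurable S ->
  (forall w, ~ N w -> S w <-> S' w) -> measurable S' /\ P S' = P S.
Proof.
move=> nN mS h; have mN := negligible_measurable nN.
have mSN : measurable (S' `&` N).
  by apply: negligible_measurable; apply: negligibleS nN; exact: subIsetr.
have e : S' `\` N = S `\` N.
  by apply/seteqP; split=> w [Sw Nw]; split=> //; apply/(h w Nw).
have mS' : measurable S'.
  rewrite -(setDUK (@subIsetl _ S' N)) setDIr setDv set0U e.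
  by apply: measurableU => //; exact: measurableD.
have PN : P N = 0%E by have [] := negligibleP P mN => h1 h2; exact: h1.
have red A : measurable A -> P A = P (A `\` N).
  move=> mA; have mAN : measurable (A `\` N) by exact: measurableD.
  apply/le_anti/andP; split; last by apply: le_measure; rewrite ?inE.
  apply: (@le_trans _ _ (P ((A `\` N) `|` N))).
    apply: le_measure; rewrite ?inE//; first exact: measurableU.
    by move=> w Aw; have [Nw|Nw] := pselect (N w); [right|left].
  by apply: le_trans (measureU2 _ mAN mN) _; rewrite -[leRHS]adde0 leeD//;
    rewrite le_eqVlt; apply/orP; left; apply/eqP; exact: PN.
by split=> //; rewrite (red S') // (red S)// e.
Qed.

(** Measurability is asked of one pair only; completeness transfers it to the other. *)
Lemma ucp_ae_eq (Y Y' : nat -> R -> Omega -> R) Z Z' (N : set Omega) :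
  P.-negligible N ->
  (forall n t e, measurable (sup_event (fun s w => Y n s w - Z s w) t e)) ->
  (forall w, ~ N w -> forall n s, 0 < s -> Y n s w - Z s w = Y' n s w - Z' s w) ->
  (ucp_cvg P Y Z <-> ucp_cvg P Y' Z').
Proof.
move=> nN mS h.
have e n t e : P (sup_event (fun s w => Y' n s w - Z' s w) t e) =
    P (sup_event (fun s w => Y n s w - Z s w) t e).
  have [] // := @measure_ae_eq _ (sup_event (fun s w => Y' n s w - Z' s w) t e) N nN (mS n t e).
  by move=> w /h hw; split=> -[s /andP[s0 st]]; rewrite ?(hw n s s0)// => es; exists s; rewrite ?s0// ?(hw n s s0)// -(hw n s s0).
split=> hu t e' t0 e0; have := hu t e' t0 e0.
  by move=> hh; apply: cvg_trans hh; apply: near_eq_cvg; apply: nearW => n; rewrite -[LHS]/(P (sup_event _ _ _)) -e.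
by move=> hh; apply: cvg_trans hh; apply: near_eq_cvg; apply: nearW => n; rewrite -[LHS]/(P (sup_event _ _ _)) e.
Qed.

(** Each path is uniformly continuous on [0, t] with a modulus depending on w; the modulus is made
    common to all w outside an event of small probability. That event is described by rational times
    in order to be measurable. *)
Lemma modulus_prob V t e eta : (forall s, 0 <= s -> measurable_fun setT (V s)) ->
  sure_continuous V -> 0 <= t -> 0 < e -> 0 < eta ->
  exists2 dl : R, 0 < dl & exists B, [/\ measurable B, (P B <= eta%:E)%E &
    forall w, ~ B w -> forall a b, 0 <= a <= t -> 0 <= b <= t ->
      `|a - b| <= dl -> `|V a w - V b w| <= e].
Proof.
move=> mV cV t0 e0 eta0; have e2 : 0 < e / 2 by rewrite divr_gt0.
have e4 : 0 < e / 4 by rewrite divr_gt0.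
pose h (n : nat) : R := n.+1%:R^-1.
have h0 n : 0 < h n by rewrite /h invr_gt0.
have mc q : measurable_fun setT (V (clip_rat t q)).
  by apply: mV; have /andP[] := clip_rat_itv q t0.
(* The distance allowed is 2 h n although |a - b| <= h n is the target: a and b are each moved by
   less than h n / 2 to a rational time. Likewise e/2 here leaves e/4 for each of these two
   moves. *)
pose O n := \bigcup_(q : rat) \bigcup_(q' : rat)
  (if (`|clip_rat t q - clip_rat t q'| < h n + h n)%R then
     [set w | e / 2 < `|V (clip_rat t q) w - V (clip_rat t q') w|] else set0).
have mO n : measurable (O n).
  apply: bigcupT_measurable_rat => q; apply: bigcupT_measurable_rat => q'.
  case: ifPn => // _; apply: measurable_lt => //; apply: measurable_norm.
  exact: measurable_funB.
have : small P O.
  apply: small_pointwise => // w.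
  have [dl d0 hd] := cpath_unif t (cV w) e2.
  have d2 : 0 < dl / 2 by rewrite divr_gt0.
  near=> n; move=> [q _ [q' _]]; case: ifPn => // hq /=; apply/negP; rewrite -leNgt.
  apply: hd; [exact: clip_rat_itv|exact: clip_rat_itv|apply: ltW; apply: lt_le_trans hq _].
  rewrite [leRHS]splitr lerD//.
    by near: n; have /cvgrPdist_le/(_ _ d2) := @cvg_harmonic R;
    apply: filterS => n; rewrite sub0r normrN ger0_norm// ltW// h0.
  by near: n; have /cvgrPdist_le/(_ _ d2) := @cvg_harmonic R;
    apply: filterS => n; rewrite sub0r normrN ger0_norm// ltW// h0.
move=> /(_ _ eta0)[n /(_ n (leqnn n))[B [mB OB PB]]].
exists (h n) => //; exists B; split=> // w wB a b ha hb ab.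
have wO : ~ O n w by move=> /OB.
have /andP[a0 a1] := ha; have /andP[b0 b1] := hb.
have [da da0 hda] := cpath_delta (cV w) a0 e4.
have [db db0 hdb] := cpath_delta (cV w) b0 e4.
have h2 : 0 < h n / 2 by rewrite divr_gt0.
have ma : 0 < Num.min da (h n / 2) by rewrite lt_min da0.
have mb : 0 < Num.min db (h n / 2) by rewrite lt_min db0.
have [q] := clip_rat_dense ha ma; rewrite lt_min => /andP[qa1 qa2].
have [q'] := clip_rat_dense hb mb; rewrite lt_min => /andP[qb1 qb2].
have /andP[cq0 _] := clip_rat_itv q t0; have /andP[cq0' _] := clip_rat_itv q' t0.
have va := hda _ cq0 qa1; have vb := hdb _ cq0' qb1.
have vm : `|V (clip_rat t q) w - V (clip_rat t q') w| <= e / 2.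
  rewrite leNgt; apply/negP => hv; apply: wO; exists q => //; exists q' => //.
  case: ifPn => //; rewrite -leNgt => hh; exfalso; move: hh; apply/negP; rewrite -ltNge.
  rewrite (_ : _ - _ = (a - b) - (a - clip_rat t q) + (b - clip_rat t q')); last by ring.
  rewrite (le_lt_trans (ler_normD _ _))//.
  by have := ler_normB (a - b) (a - clip_rat t q); lra.
rewrite (_ : V a w - V b w = (V a w - V (clip_rat t q) w) + (V (clip_rat t q) w - V (clip_rat t q') w) - (V b w - V (clip_rat t q') w)); last by ring.
rewrite (le_trans (ler_normB _ _))//.
have := ler_normD (V a w - V (clip_rat t q) w) (V (clip_rat t q) w - V (clip_rat t q') w).
by move: va vb => /=; lra.
Unshelve. all: by end_near. Qed.

Section SimpleIntegrand.
Variable J : simple_integrand F.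

Lemma si_time_mono i j : (i <= j)%N -> si_time J i <= si_time J j.
Proof. by move: i j; apply/nondecreasing_seqP; exact: si_time_nd. Qed.

Lemma si_time_nneg k : 0 <= si_time J k.
Proof. by rewrite (le_trans (si_time_ge0 J))// si_time_mono. Qed.

Lemma si_process_in k r w : (k < si_size J)%N -> si_time J k < r <= si_time J k.+1 ->
  si_process J r w = si_coef J k w.
Proof.
move=> kJ hr; have /andP[r1 r2] := hr.
rewrite /si_process (bigD1 (Ordinal kJ))//= hr mulr1 big1 ?addr0// => i ik.
rewrite (_ : _ && _ = false) ?mulr0//; apply/negbTE/negP => /andP[i1 i2].
have ik' : (i : nat) <> k by move=> e; move/eqP: ik; apply; exact: val_inj.
have [ki|ki|ki] := ltngtP k i; last by case: ik'.
  by have := le_lt_trans (si_time_mono ki) i1; rewrite ltNge r2.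
by have := le_lt_trans (si_time_mono ki) r1; rewrite ltNge i2.
Qed.

Lemma si_process_out r w : (forall k, (k < si_size J)%N -> ~~ (si_time J k < r <= si_time J k.+1)) ->
  si_process J r w = 0.
Proof. by move=> h; apply: big1 => k _; rewrite (negbTE (h k (ltn_ord k))) mulr0. Qed.

Lemma si_covered n r : si_time J 0%N < r <= si_time J n ->
  exists2 k, (k < n)%N & si_time J k < r <= si_time J k.+1.
Proof.
elim: n => [/andP[r0 r1]|n ih /andP[r0 r1]].
  by have := lt_le_trans r0 r1; rewrite ltxx.
have [h|h] := leP r (si_time J n); last by exists n => //; rewrite h.
by have [|k kn hk] := ih; [rewrite r0|exists k => //; exact: ltnW].
Qed.

Lemma measurable_si_process r : measurable_fun setT (si_process J r).
Proof.
apply: measurable_sum => k; apply: measurable_funM; last exact: measurable_cst.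
exact: (rv_mfun (filt_meas usualF (si_time_nneg k)) (si_coef_meas J k)).
Qed.

Lemma lcpath_si_process w : lcpath (si_process J ^~ w).
Proof.
apply: lcpath_sum => k; apply: lcpathM; [exact: lcpath_cst|exact: lcpath_indic].
Qed.

Lemma measurable_si_integral Z r : adapted F Z -> 0 <= r ->
  measurable_fun setT (si_integral J Z r).
Proof.
move=> aZ r0; apply: measurable_sum => k; apply: measurable_funM.
  exact: (rv_mfun (filt_meas usualF (si_time_nneg k)) (si_coef_meas J k)).
by apply: measurable_funB; apply: (adapted_mfun usualF aZ);
  rewrite le_min r0 si_time_nneg.
Qed.

Lemma lcpath_si_integral Z w : cpath (Z ^~ w) -> lcpath (si_integral J Z ^~ w).
Proof.
move=> cZ; apply: lcpath_sum => k; apply: lcpathM; first exact: lcpath_cst.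
apply: cpath_lc; apply: cpathB;
  by apply: (cpath_min_cst (z := Z ^~ w)) => //; exact: si_time_nneg.
Qed.

Lemma measurable_sup_si_process Z t e : adapted F Z -> sure_continuous Z ->
  measurable (sup_event (fun s w => si_process J s w - Z s w) t e).
Proof.
move=> aZ cZ; apply: measurable_sup_event => [s s0|w].
  apply: measurable_funB; first exact: measurable_si_process.
  exact: (adapted_mfun usualF aZ).
by apply: lcpathB; [exact: lcpath_si_process|exact: cpath_lc].
Qed.

Lemma measurable_sup_si_integral Z V t e : adapted F Z -> sure_continuous Z ->
  adapted F V -> sure_continuous V ->
  measurable (sup_event (fun s w => si_integral J Z s w - V s w) t e).
Proof.
move=> aZ cZ aV cV; apply: measurable_sup_event => [s s0|w].
  apply: measurable_funB; first exact: measurable_si_integral.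
  exact: (adapted_mfun usualF aV).
by apply: lcpathB; [exact: lcpath_si_integral|exact: cpath_lc].
Qed.

End SimpleIntegrand.
End Ucp.

(** * The stochastic logarithm of M *)

Section LogEstimates.
Context {R : realType}.
Implicit Types x y : R.

Lemma ln_remainder_ge0 x : -1 < x -> 0 <= x - ln (1 + x).
Proof. by move=> x1; rewrite subr_ge0; exact: le_ln1Dx. Qed.

(** From ln y <= y - 1 at y = 1/(1+x), the remainder is at most x^2/(1+x), and 1/(1+x) <= 2 in this
    range. *)
Lemma ln_remainder_le x : - (1 / 2) <= x -> x - ln (1 + x) <= 2 * x ^+ 2.
Proof.
move=> x1; have y0 : 0 < 1 + x by lra.
have yV : 0 < (1 + x)^-1 by rewrite invr_gt0.
have := ln_le_sub1 yV; rewrite lnV// => h.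
have y2 : (1 + x)^-1 <= 2 by rewrite -[leRHS]invrK lef_pV2 ?posrE//; lra.
have e : (1 + x)^-1 - 1 = - x + x ^+ 2 * (1 + x)^-1 by field; rewrite gt_eqF.
have : x ^+ 2 * (1 + x)^-1 <= x ^+ 2 * 2 by rewrite ler_wpM2l ?sqr_ge0.
by lra.
Qed.

(** With y = sqrt(1+x), ln(1+x) = 2 ln y <= 2(y-1), so the remainder is at least (y-1)^2, while x^2
    = (y-1)^2 (y+1)^2. Since y <= 3/2, the factor (y+1)^2 is below 8. *)
Lemma sqr_le_ln_remainder x : -1 < x -> x <= 1 / 2 -> x ^+ 2 <= 8 * (x - ln (1 + x)).
Proof.
move=> x1 x2; have x0 : 0 <= 1 + x by lra.
pose y := Num.sqrt (1 + x).
have y0 : 0 < y by rewrite sqrtr_gt0; lra.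
have yy : y ^+ 2 = 1 + x by exact: sqr_sqrtr.
have y32 : y <= 3 / 2.
  by rewrite leNgt; apply/negP => h; nra.
have : ln (1 + x) <= 2 * (y - 1).
  by rewrite -yy expr2 lnM//; have := ln_le_sub1 y0; lra.
have -> : x = y ^+ 2 - 1 by lra.
move=> h; apply: (@le_trans _ _ (8 * (y - 1) ^+ 2)); last first.
  by rewrite ler_pM2l//; rewrite yy in h *; nra.
have : (y + 1) ^+ 2 <= 8 by nra.
have := sqr_ge0 (y - 1); nra.
Qed.

Lemma sum_ord_stable (a : nat -> R) k n : (k <= n)%N -> (forall i, (k <= i)%N -> a i = 0) ->
  \sum_(i < n) a i = \sum_(i < k) a i.
Proof.
move=> kn a0; rewrite -(subnKC kn); elim: (n - k)%N => [|j ih]; first by rewrite addn0.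
by rewrite addnS big_ord_recr/= ih a0 ?addr0// leq_addr.
Qed.

End LogEstimates.

(** * Second moment of U against the expectation of log M at a bounding stopping time *)

Section StoppedLogIntegral.
Context {R : realType} {d} {Omega : measurableType d} (P : probability Omega R).
Variable F : R -> set (set Omega).
Hypothesis usualF : usual_filtration P F.
Variables M U : R -> Omega -> R.
Hypothesis aM : adapted F M.
Hypothesis cM : sure_continuous M.
Hypothesis M_gt0 : forall t w, 0 <= t -> 0 < M t w.
Hypothesis M0 : forall w, M 0 w = 1.
Hypothesis aU : adapted F U.
Hypothesis cU : sure_continuous U.
Hypothesis U0 : forall w, U 0 w = 0.
Hypothesis hU : forall J : nat -> simple_integrand F,
  ucp_cvg P (fun n => si_process (J n)) (fun t w => (M t w)^-1) ->
  ucp_cvg P (fun n => si_integral (J n) M) U.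

Lemma min_capped T (x y : R) (w : Omega) : 0 <= x -> x <= y -> (0 <= T w)%E ->
  Num.min x (capped T y w) = capped T x w.
Proof.
move=> x0 xy T0; have y0 := le_trans x0 xy.
have [h|h] := leP (T w) x%:E.
  rewrite (_ : capped T x w = capped T y w); last first.
    by apply: EFin_inj; rewrite !capped_le// (le_trans h)// lee_fin.
  by apply/min_idPr; rewrite -lee_fin capped_le// (le_trans h)// lee_fin.
rewrite (capped_ge (ltW h)); apply/min_idPl; apply: le_capped => //; exact: ltW.
Qed.

Section Grid.
Variables s t : R.
Hypothesis s0 : 0 <= s.
Hypothesis st : s < t.

(* Both s and t are points of the grid: the first m+1 steps lead from 0 to s,
   the next m+1 from s to t. *)
Definition two_grid m (i : nat) : R :=
  s * ((minn i m.+1)%:R / m.+1%:R) + (t - s) * ((i - m.+1)%N%:R / m.+1%:R).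

Let t0 : 0 < t. Proof. exact: le_lt_trans st. Qed.
Let ts0 : 0 < t - s. Proof. by rewrite subr_gt0. Qed.

Lemma two_grid0 m : two_grid m 0 = 0.
Proof. by rewrite /two_grid min0n sub0n !mul0r !mulr0 addr0. Qed.

Lemma two_grid_mid m : two_grid m m.+1 = s.
Proof. by rewrite /two_grid minnn subnn mul0r mulr0 addr0 divff ?pnatr_eq0// mulr1. Qed.

Lemma two_grid_add m j : two_grid m (m.+1 + j) = s + (t - s) * (j%:R / m.+1%:R).
Proof.
rewrite /two_grid (minn_idPr (leq_addr _ _)) addKn.
by rewrite divff ?pnatr_eq0// mulr1.
Qed.

Lemma two_grid_last m : two_grid m (m.+1 + m.+1) = t.
Proof. by rewrite two_grid_add divff ?pnatr_eq0// mulr1 addrC subrK. Qed.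

Lemma two_grid_step m i :
  0 <= two_grid m i.+1 - two_grid m i <= t / m.+1%:R.
Proof.
have m0 : 0 < m.+1%:R^-1 :> R by rewrite invr_gt0.
rewrite /two_grid; have [im|im] := ltnP i m.+1.
  have e1 : minn i.+1 m.+1 = i.+1 by lia.
  rewrite e1.
  have -> : (i.+1 - m.+1)%N = 0%N by lia.
  have -> : (i - m.+1)%N = 0%N by lia.
  rewrite -(natr1 i) (_ : _ - _ = s * m.+1%:R^-1); last by ring.
  by apply/andP; split; [rewrite mulr_ge0// ltW|rewrite ler_pM2r// ltW].
have e1 : minn i.+1 m.+1 = m.+1 by lia.
rewrite e1.
rewrite subSn//.
rewrite -(natr1 (i - _)) (_ : _ - _ = (t - s) * m.+1%:R^-1); last by ring.
by apply/andP; split; [rewrite mulr_ge0// ltW|rewrite ler_pM2r// lerBlDr lerDl].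
Qed.

Lemma two_gridS m i : two_grid m i <= two_grid m i.+1.
Proof. by rewrite -subr_ge0; have /andP[] := two_grid_step m i. Qed.

Lemma two_grid_nd m i j : (i <= j)%N -> two_grid m i <= two_grid m j.
Proof. by move: i j; apply/nondecreasing_seqP; exact: two_gridS. Qed.

Lemma two_grid_ge0 m i : 0 <= two_grid m i.
Proof. by rewrite -[leLHS](two_grid0 m) two_grid_nd. Qed.

Lemma inv_integrand_meas m k : rv_measurable (F (two_grid m k)) (fun w => (M (two_grid m k) w)^-1).
Proof.
by apply: rvV; [exact: (filt_sigma usualF (two_grid_ge0 _ _))|exact: aM (two_grid_ge0 _ _)].
Qed.

Lemma two_grid0_ge0 m : 0 <= two_grid m 0.
Proof. by rewrite two_grid0. Qed.

(** Left-point approximation of 1/M. The grid continues past t with the same step up to s + (t -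
    s)(m + 1), because ucp convergence must hold on every bounded interval and not only up to t. *)
Definition inv_integrand m : simple_integrand F :=
  @SimpleIntegrand _ _ _ F (m.+1 + m.+1 * m.+1)%N (two_grid m)
    (fun k w => (M (two_grid m k) w)^-1) (two_grid0_ge0 m) (two_gridS m)
    (inv_integrand_meas m).

Lemma continuous_inv : sure_continuous (fun t w => (M t w)^-1).
Proof. by move=> w; apply: cpathV => // r r0; rewrite gt_eqF// M_gt0. Qed.

Lemma adapted_inv : adapted F (fun t w => (M t w)^-1).
Proof. by move=> r r0; apply: rvV; [exact: (filt_sigma usualF)|exact: aM]. Qed.

Lemma ucp_inv_integrand :
  ucp_cvg P (fun m => si_process (inv_integrand m)) (fun t w => (M t w)^-1).
Proof.
apply/(ucp_smallP _).
  by move=> n r e; apply: (measurable_sup_si_process usualF); [exact: adapted_inv|exact: continuous_inv].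
move=> r e r0 e0 eta eta0.
have [dl d0 [B [mB PB hB]]] := modulus_prob P (fun q q0 => adapted_mfun usualF adapted_inv q0)
  continuous_inv r0 e0 eta0.
(* The mesh is eventually below the modulus, and the grid eventually covers the horizon r. *)
have : \forall m \near \oo, t / m.+1%:R <= dl /\ r <= s + (t - s) * m.+1%:R.
  near=> m; split.
    near: m; have /cvgrPdist_le/(_ _ d0) := mesh_cvg 0 t.
    apply: filterS => m; rewrite sub0r normrN subr0 ger0_norm//.
    by rewrite divr_ge0// ltW.
  rewrite -lerBlDl mulrC -ler_pdivrMr//.
  apply: (@le_trans _ _ m%:R); last by rewrite ler_nat.
  near: m; exact: nbhs_infty_ger.
move=> [m0 _ hm0]; exists m0 => m /hm0[h1 h2]; exists B; split=> // w [q /andP[q0 qr] eq].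
apply: contrapT => wB; have := hB w wB => hw.
have [k kJ hk] : exists2 k, (k < si_size (inv_integrand m))%N &
    si_time (inv_integrand m) k < q <= si_time (inv_integrand m) k.+1.
  apply: si_covered; rewrite /= two_grid0 q0/= two_grid_add (le_trans qr)//.
  by rewrite natrM mulfK ?pnatr_eq0.
rewrite (si_process_in w kJ hk) /= in eq.
have /andP[k1 k2] := hk; rewrite /= in k1 k2.
have : `|(M (two_grid m k) w)^-1 - (M q w)^-1| <= e.
  apply: hw.
  - by rewrite two_grid_ge0/= (le_trans (ltW k1)).
  - by rewrite (ltW q0).
  - rewrite ltr0_norm ?subr_lt0// opprB.
    have /andP[_ h] := two_grid_step m k.
    by apply: le_trans h1; apply: le_trans h; lra.
by rewrite leNgt eq.
Unshelve. all: by end_near. Qed.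

Variables (T : Omega -> \bar R) (c : R).
Hypothesis sT : stopping_time F T.
Hypothesis Mc : forall t w, 0 <= t -> (t%:E <= T w)%E ->
  [/\ M t w <= c, (M t w)^-1 <= c & `|U t w| <= c].
Hypothesis mMT : martingale P F (stopped M T).

Let T0 w : (0 <= T w)%E. Proof. exact: sT.1. Qed.
Let g0 m k : 0 <= two_grid m k. Proof. exact: two_grid_ge0. Qed.
Let last m := (m.+1 + m.+1)%N.

(** M is sampled along the stopped grid; [ratio] is a discrete dM/M and [logr] an increment of log
    M. The partial sums [Y] of the ratios are simple integrals of 1/M, as [si_Y] shows, and hence
    approximate U. *)
Let z m k w := M (capped T (two_grid m k) w) w.
Let ratio m k w := (z m k.+1 w - z m k w) / z m k w.
Let logr m k w := ln (z m k.+1 w) - ln (z m k w).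
Let Y m k w := \sum_(i < k) ratio m i w.
(* The expansion of the logarithm needs small ratios, and dominated convergence
   needs bounded partial sums: the sums are stopped when either fails, which
   becomes improbable as the mesh decreases. *)
Let alive m k := [set w | (forall j, (j < k)%N -> `|ratio m j w| <= 1 / 2) /\
  (forall j, (j < k.+1)%N -> `|Y m j w| <= c + 1)].
(** Whether step i is added is decided at the i-th grid time, so that these sums remain martingale
    transforms; the price is that the fatal step itself is still included. *)
Let Ya m k w := \sum_(i < k) \1_(alive m i) w * ratio m i w.
Let La m k w := \sum_(i < k) \1_(alive m i) w * logr m i w.

Let cap0 r w : 0 <= r -> 0 <= capped T r w.
Proof. by move=> r0; have /andP[] := capped_itv r0 (T0 w). Qed.

Let z_bound m k w : [/\ 0 < z m k w, z m k w <= c & (z m k w)^-1 <= c].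
Proof.
have [h1 h2 _] := Mc (cap0 w (g0 m k)) (capped_leT (g0 m k) (T0 w)).
by split=> //; apply: M_gt0; exact: cap0.
Qed.

Let c_ge1 : 1 <= c.
Proof. by have [h _ _] := @Mc 0 point (lexx 0) (T0 point); rewrite M0 in h. Qed.

Let c_ge0 : 0 <= c. Proof. exact: le_trans c_ge1. Qed.

Let lnz_bound m k w : `|ln (z m k w)| <= c.
Proof.
have [h0 h1 h2] := z_bound m k w; have zV : 0 < (z m k w)^-1 by rewrite invr_gt0.
have a1 := ln_le_sub1 h0; have a2 := ln_le_sub1 zV; rewrite lnV// in a2.
by rewrite ler_norml; apply/andP; split; lra.
Qed.

Let ratioE m k w : 1 + ratio m k w = z m k.+1 w / z m k w.
Proof. by have [h0 _ _] := z_bound m k w; rewrite /ratio; field; rewrite gt_eqF. Qed.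

Let ratio_gtN1 m k w : -1 < ratio m k w.
Proof.
have [h0 _ _] := z_bound m k w; have [h1 _ _] := z_bound m k.+1 w.
by have := divr_gt0 h1 h0; rewrite -ratioE; lra.
Qed.

Let logrE m k w : logr m k w = ln (1 + ratio m k w).
Proof.
have [h0 _ _] := z_bound m k w; have [h1 _ _] := z_bound m k.+1 w.
by rewrite ratioE ln_div.
Qed.

Let ratio_bound m k w : `|ratio m k w| <= c * c.
Proof.
have [h0 h0c h0V] := z_bound m k w; have [h1 h1c _] := z_bound m k.+1 w.
rewrite normrM [X in _ * X]gtr0_norm ?invr_gt0//.
apply: ler_pM => //; first by rewrite invr_ge0 ltW.
by rewrite ler_norml; apply/andP; split; lra.
Qed.

Let remainder_bound m k w : ratio m k w - logr m k w <= c * c + (c + c).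
Proof.
rewrite lerD//; first by rewrite (le_trans (ler_norm _))// ratio_bound.
rewrite (le_trans (ler_norm _))// normrN (le_trans (ler_normB _ _))// lerD// lnz_bound//.
Qed.

Let z_meas m k l : (k <= l)%N -> rv_measurable (F (two_grid m l)) (z m k).
Proof.
move=> kl; apply: (filt_rv usualF (g0 m k) (two_grid_nd m kl)).
exact: (adapted_stopped usualF aM cM sT).
Qed.

Let ratio_meas m k l : (k < l)%N -> rv_measurable (F (two_grid m l)) (ratio m k).
Proof.
move=> kl; have sg := filt_sigma usualF (g0 m l).
apply: (rvM sg); last by apply: (rvV sg); apply: z_meas; exact: ltnW.
by apply: (rvB sg); apply: z_meas => //; exact: ltnW.
Qed.

Let Y_meas m k l : (k <= l)%N -> rv_measurable (F (two_grid m l)) (Y m k).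
Proof.
move=> kl; have sg := filt_sigma usualF (g0 m l).
elim: k kl => [_|k ih kl].
  rewrite (_ : Y m 0 = fun=> 0); first exact: (rv_cst sg).
  by apply/funext => w; rewrite /Y big_ord0.
rewrite (_ : Y m k.+1 = fun w => Y m k w + ratio m k w).
  by apply: (rvD sg); [apply: ih; exact: ltnW|exact: ratio_meas].
by apply/funext => w; rewrite /Y big_ord_recr.
Qed.

Let alive_meas m k : F (two_grid m k) (alive m k).
Proof.
have sg := filt_sigma usualF (g0 m k).
apply: (sigmaI sg).
  apply: (sigma_forall sg (E := fun j => [set w | `|ratio m j w| <= 1 / 2])) => j jk.
  by apply: (sigma_le sg); [apply: (rv_norm sg); exact: ratio_meas|exact: (rv_cst sg)].
apply: (sigma_forall sg (E := fun j => [set w | `|Y m j w| <= c + 1])) => j jk.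
by apply: (sigma_le sg); [apply: (rv_norm sg); exact: Y_meas|exact: (rv_cst sg)].
Qed.

Let alive_measurable m k : measurable (alive m k).
Proof. exact: (filt_meas usualF (g0 m k)) (alive_meas m k). Qed.

Let aliveS m k w : alive m k.+1 w ->
  [/\ alive m k w, `|ratio m k w| <= 1 / 2 & `|Y m k.+1 w| <= c + 1].
Proof.
move=> [h1 h2]; split; [split=> j jk|exact: h1|exact: h2].
- by apply: h1; exact: ltnW.
- by apply: h2; exact: ltnW.
Qed.

Let alive_le m k l w : (k <= l)%N -> alive m l w -> alive m k w.
Proof.
by move=> kl; rewrite -(subnKC kl); elim: (l - k)%N => [|j ih]; rewrite ?addn0// addnS => /aliveS[/ih].
Qed.

Let indicT' A (w : Omega) : A w -> (\1_A : Omega -> R) w = 1.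
Proof. by move=> h; rewrite indicE mem_set. Qed.

Let indicF' A (w : Omega) : ~ A w -> (\1_A : Omega -> R) w = 0.
Proof. by move=> h; rewrite indicE memNset. Qed.

Let alive_sums m k w : alive m k w ->
  Ya m k w = Y m k w /\ La m k w = ln (z m k w) - ln (z m 0 w).
Proof.
elim: k => [_|k ih /aliveS[/[dup] ak /ih[h1 h2] _ _]].
  by rewrite /Ya /La /Y !big_ord0 subrr.
rewrite /Ya /La /Y !big_ord_recr/= -/(Ya m k w) -/(La m k w) -/(Y m k w) h1 h2 !indicT'// !mul1r.
by split=> //; rewrite /logr; ring.
Qed.

Let z0E m w : z m 0 w = 1.
Proof. by rewrite /z two_grid0 capped_ge ?M0. Qed.

(** While alive the partial sum is at most c + 1; the fatal step adds at most c * c. *)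
Let bound := c + 1 + c * c.

(** The sums are constant after the fatal step. [La] needs no allowance for that step, since it then
    still equals the logarithm of a sampled value of M. *)
Let sums_bound m k w : `|Ya m k w| <= bound /\ `|La m k w| <= c.
Proof.
have cc : 0 <= c * c by rewrite mulr_ge0.
have [ak|ak] := pselect (alive m k w).
  have [-> ->] := alive_sums ak; rewrite z0E ln1 subr0; split; last exact: lnz_bound.
  by have [_ h] := ak; rewrite (le_trans (h k (ltnSn k)))// lerDl.
elim: k ak => [|k ih] ak1.
  by rewrite /Ya /La !big_ord0 !normr0; split=> //; rewrite /bound !addr_ge0.
have [ak|ak] := pselect (alive m k w); last first.
  rewrite /Ya /La !big_ord_recr/= -/(Ya m k w) -/(La m k w) indicF'//.
  by rewrite !mul0r !addr0; exact: ih.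
rewrite /Ya /La !big_ord_recr/= -/(Ya m k w) -/(La m k w) indicT'// !mul1r.
have [-> ->] := alive_sums ak; rewrite z0E ln1 subr0.
split; last by rewrite /logr addrC subrK lnz_bound.
have [_ h] := ak; apply: le_trans (ler_normD _ _) _.
by apply: lerD; [exact: h|exact: ratio_bound].
Qed.

(** Steps with a ratio of size at most 1/2 contribute nonpositive terms by [sqr_le_ln_remainder].
    Only the fatal step can contribute positively, at most once and only on the dead event. *)
Let bad_sq m k w : \sum_(i < k) \1_(alive m i) w * (ratio m i w ^+ 2 - 8 * (ratio m i w - logr m i w))
  <= (c * c) ^+ 2 * (1 - \1_(alive m k) w).
Proof.
have C0 : 0 <= (c * c) ^+ 2 by exact: sqr_ge0.
elim: k => [|k ih].
  by rewrite big_ord0 mulr_ge0// subr_ge0 indicE lern1 leq_b1.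
rewrite big_ord_recr/=; have [ak|ak] := pselect (alive m k w); last first.
  rewrite (indicF' ak) in ih *; rewrite mul0r addr0 indicF' ?subr0; last by move=> /aliveS[].
  by rewrite subr0 in ih.
rewrite (indicT' ak) in ih *; rewrite subrr mulr0 in ih; rewrite mul1r.
have [ak1|ak1] := pselect (alive m k.+1 w).
  rewrite (indicT' ak1) subrr mulr0; have [_ /ler_normlW h _] := aliveS ak1.
  by have := sqr_le_ln_remainder (ratio_gtN1 m k w) h; rewrite -logrE; lra.
rewrite (indicF' ak1) subr0 mulr1.
have := ln_remainder_ge0 (ratio_gtN1 m k w); rewrite -logrE => h.
have : ratio m k w ^+ 2 <= (c * c) ^+ 2.
  rewrite -(real_normK (num_real (ratio m k w))).
  by rewrite ler_pXn2r ?nnegrE ?mulr_ge0 ?ratio_bound.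
by lra.
Qed.

(** The same accounting with [ln_remainder_le]; here the fatal step costs at most the bound of the
    logarithmic remainder. *)
Let bad_log m k w : \sum_(i < k) \1_(alive m i) w * ((ratio m i w - logr m i w) - 2 * ratio m i w ^+ 2)
  <= (c * c + (c + c)) * (1 - \1_(alive m k) w).
Proof.
have C0 : 0 <= c * c + (c + c) by rewrite !addr_ge0// mulr_ge0.
elim: k => [|k ih].
  by rewrite big_ord0 mulr_ge0// subr_ge0 indicE lern1 leq_b1.
rewrite big_ord_recr/=; have [ak|ak] := pselect (alive m k w); last first.
  rewrite (indicF' ak) in ih *; rewrite mul0r addr0 indicF' ?subr0; last by move=> /aliveS[].
  by rewrite subr0 in ih.
rewrite (indicT' ak) in ih *; rewrite subrr mulr0 in ih; rewrite mul1r.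
have [ak1|ak1] := pselect (alive m k.+1 w).
  rewrite (indicT' ak1) subrr mulr0; have [_ h _] := aliveS ak1.
  have h' : - (1 / 2) <= ratio m k w by move: h; rewrite ler_norml => /andP[].
  by have := ln_remainder_le h'; rewrite -logrE; lra.
rewrite (indicF' ak1) subr0 mulr1.
have h1 := remainder_bound m k w; have h2 := sqr_ge0 (ratio m k w).
by lra.
Qed.

Let Lz m k : Lone P (z m k).
Proof. exact: (martingale_Lone usualF mMT (g0 m k)). Qed.

Let ratio_orth m k g b : rv_measurable (F (two_grid m k)) g -> (forall w, `|g w| <= b) ->
  Ex P (fun w => g w * ratio m k w) = 0.
Proof.
move=> mg gb; have sg := filt_sigma usualF (g0 m k).
have mz : rv_measurable (F (two_grid m k)) (fun w => g w * (z m k w)^-1).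
  by apply: (rvM sg) => //; apply: (rvV sg); exact: z_meas.
have bz w : `|g w * (z m k w)^-1| <= b * c.
  have [h0 _ hV] := z_bound m k w.
  by rewrite normrM ler_pM// gtr0_norm ?invr_gt0.
have mz' := rv_mfun (filt_meas usualF (g0 m k)) mz.
rewrite (_ : (fun w => _) = fun w => (g w * (z m k w)^-1) * z m k.+1 w -
    (g w * (z m k w)^-1) * z m k w); last by apply/funext => w; rewrite /ratio; ring.
rewrite ExB; [|exact: LoneM_bdd (Lz m k.+1) mz' bz|exact: LoneM_bdd (Lz m k) mz' bz].
have := martingale_orth usualF mMT (g0 m k) (two_gridS m k) mz bz.
by rewrite /stopped -/(capped _ _ _) => ->; rewrite subrr.
Qed.

Let mfun_ratio m k : measurable_fun setT (ratio m k).
Proof. exact: (rv_mfun (filt_meas usualF (g0 m k.+1)) (ratio_meas m (ltnSn k))). Qed.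

Let mfun_z m k : measurable_fun setT (z m k).
Proof. exact: (rv_mfun (filt_meas usualF (g0 m k)) (z_meas m (leqnn k))). Qed.

Let mfun_logr m k : measurable_fun setT (logr m k).
Proof. by apply: measurable_funB; apply: measurableT_comp => //; exact: mfun_z. Qed.

Let rv_Ya m k l : (k <= l)%N -> rv_measurable (F (two_grid m l)) (Ya m k).
Proof.
move=> kl; have sg := filt_sigma usualF (g0 m l).
elim: k kl => [_|k ih kl].
  rewrite (_ : Ya m 0 = fun=> 0); first exact: (rv_cst sg).
  by apply/funext => w; rewrite /Ya big_ord0.
rewrite (_ : Ya m k.+1 = fun w => Ya m k w + \1_(alive m k) w * ratio m k w).
  apply: (rvD sg); first by apply: ih; exact: ltnW.
  apply: (rvM sg); last exact: ratio_meas.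
  apply: (rv_indic sg).
  by apply: (filt_mono usualF (g0 m k) (two_grid_nd m (ltnW kl))); exact: alive_meas.
by apply/funext => w; rewrite /Ya big_ord_recr.
Qed.

Let mfun_Ya m k : measurable_fun setT (Ya m k).
Proof. exact: (rv_mfun (filt_meas usualF (g0 m k)) (rv_Ya m (leqnn k))). Qed.

Let mfun_La m k : measurable_fun setT (La m k).
Proof.
apply: measurable_sum => i; apply: measurable_funM; last exact: mfun_logr.
exact: measurable_indic.
Qed.

Let Lone_alive_ratio m k : Lone P (fun w => \1_(alive m k) w * ratio m k w).
Proof.
apply: (@Lone_bdd _ _ _ _ (c * c)).
  by apply: measurable_funM; [exact: measurable_indic|exact: mfun_ratio].
move=> w; rewrite normrM (le_trans _ (ratio_bound m k w))// ler_piMl//.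
exact: abs_indic_le1.
Qed.

Let Ex_Ya_martingale m E : F s E ->
  Ex P (fun w => \1_E w * Ya m (last m) w) = Ex P (fun w => \1_E w * Ya m m.+1 w).
Proof.
move=> FE; have mE := filt_meas usualF s0 FE.
have I1 k : Lone P (fun w => \1_E w * Ya m k w).
  apply: (@Lone_bdd _ _ _ _ bound).
    by apply: measurable_funM; [exact: measurable_indic|exact: mfun_Ya].
  move=> w; have [h _] := sums_bound m k w.
  by rewrite normrM (le_trans _ h)// ler_piMl// abs_indic_le1.
have step j : Ex P (fun w => \1_E w * Ya m (m.+1 + j) w) = Ex P (fun w => \1_E w * Ya m m.+1 w).
  elim: j => [|j <-]; first by rewrite addn0.
  rewrite addnS; apply/eqP; rewrite -subr_eq0 -ExB//; apply/eqP.
  rewrite (_ : (fun w => _) = fun w => (\1_E w * \1_(alive m (m.+1 + j)) w) * ratio m (m.+1 + j) w); last first.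
    by apply/funext => w; rewrite /Ya big_ord_recr/=; ring.
  have sg := filt_sigma usualF (g0 m (m.+1 + j)).
  apply: (@ratio_orth _ _ _ 1).
    apply: (rvM sg); last by apply: (rv_indic sg); exact: alive_meas.
    apply: (rv_indic sg).
    by apply: (filt_mono usualF s0) FE; rewrite -[leLHS](two_grid_mid m) two_grid_nd// leq_addr.
  by move=> w; rewrite normrM mulr_ile1// abs_indic_le1.
exact: step.
Qed.

(** Discrete Ito isometry: the cross terms vanish by [ratio_orth], and an indicator is its own
    square. *)
Let Ex_sq m k : Ex P (fun w => Ya m k w ^+ 2) =
  Ex P (fun w => \sum_(i < k) \1_(alive m i) w * ratio m i w ^+ 2).
Proof.
have I2 i : Lone P (fun w => \1_(alive m i) w * ratio m i w ^+ 2).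
  apply: (@Lone_bdd _ _ _ _ ((c * c) ^+ 2)).
    by apply: measurable_funM; [exact: measurable_indic|exact/measurable_funX/mfun_ratio].
  move=> w; rewrite normrM (le_trans (ler_piMl _ (abs_indic_le1 _ _)))//.
  by rewrite normrX ler_pXn2r ?nnegrE ?mulr_ge0 ?ratio_bound.
have IYa i : Lone P (fun w => Ya m i w ^+ 2).
  apply: (@Lone_bdd _ _ _ _ (bound ^+ 2)); first exact/measurable_funX/mfun_Ya.
  move=> w; have [h _] := sums_bound m i w.
  by rewrite normrX ler_pXn2r ?nnegrE// (le_trans _ h).
elim: k => [|k ih].
  by apply: eq_Ex => w; rewrite /Ya !big_ord0 expr0n.
rewrite [in RHS](_ : (fun w => _) = fun w => \sum_(i < k) \1_(alive m i) w * ratio m i w ^+ 2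
  + \1_(alive m k) w * ratio m k w ^+ 2); last by apply/funext => w; rewrite big_ord_recr.
rewrite [RHS]ExD//; last by apply: Lone_sum => i.
rewrite -ih -ExD//.
apply/eqP; rewrite -subr_eq0 -ExB//; last exact: LoneD; apply/eqP.
rewrite (_ : (fun w => _) = fun w => (2 * Ya m k w * \1_(alive m k) w) * ratio m k w).
  have sg := filt_sigma usualF (g0 m k).
  apply: (@ratio_orth _ _ _ (2 * bound)).
    apply: (rvM sg); last by apply: (rv_indic sg); exact: alive_meas.
    by apply: (rvM sg); [exact: (rv_cst sg)|exact: rv_Ya].
  move=> w; have [h _] := sums_bound m k w.
  rewrite normrM (le_trans (ler_piMr _ (abs_indic_le1 _ _)))// normrM ger0_norm//.
  by rewrite ler_pM2l.
apply/funext => w; rewrite /Ya big_ord_recr/= -/(Ya m k w).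
have [ak|ak] := pselect (alive m k w).
  by rewrite (indicT' ak); ring.
by rewrite (indicF' ak); ring.
Qed.

(** The ratios have zero expectation against the alive events, so they can be added to the
    logarithmic increments at no cost. *)
Let Ex_log m k : - Ex P (La m k) =
  Ex P (fun w => \sum_(i < k) \1_(alive m i) w * (ratio m i w - logr m i w)).
Proof.
have Il i : Lone P (fun w => \1_(alive m i) w * logr m i w).
  apply: (@Lone_bdd _ _ _ _ (c + c)).
    by apply: measurable_funM; [exact: measurable_indic|exact: mfun_logr].
  move=> w; rewrite normrM (le_trans (ler_piMl _ (abs_indic_le1 _ _)))//.
  by rewrite (le_trans (ler_normB _ _))// lerD// lnz_bound.
rewrite /La Ex_sum// -sumrN Ex_sum; last first.
  move=> i; rewrite (_ : (fun w => _) = fun w => \1_(alive m i) w * ratio m i w -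
    \1_(alive m i) w * logr m i w); last by apply/funext => w; ring.
  by apply: LoneB; [exact: Lone_alive_ratio|exact: Il].
apply: eq_bigr => i _.
transitivity (Ex P (fun w => \1_(alive m i) w * ratio m i w -
    \1_(alive m i) w * logr m i w)); last by apply: eq_Ex => w; ring.
rewrite ExB// (@ratio_orth _ _ _ 1) ?sub0r//.
  by apply: (rv_indic (filt_sigma usualF (g0 m i))); exact: alive_meas.
by move=> w; exact: abs_indic_le1.
Qed.

Let si_Y m k w : (k <= last m)%N ->
  si_integral (inv_integrand m) M (capped T (two_grid m k) w) w = Y m k w.
Proof.
move=> kl; have kJ : (k <= m.+1 + m.+1 * m.+1)%N.
  by apply: leq_trans kl _; rewrite leq_add2l leq_pmulr.
pose a i := (M (two_grid m i) w)^-1 *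
  (M (Num.min (two_grid m i.+1) (capped T (two_grid m k) w)) w -
   M (Num.min (two_grid m i) (capped T (two_grid m k) w)) w).
rewrite (_ : si_integral _ _ _ _ = \sum_(i < m.+1 + m.+1 * m.+1) a i)//.
rewrite (sum_ord_stable kJ) => [|i ki]; last first.
  have /andP[_ ct] := capped_itv (g0 m k) (T0 w).
  rewrite /a !(min_idPr _) ?subrr ?mulr0//.
    by apply: le_trans ct _; exact: two_grid_nd.
  by apply: le_trans ct _; apply: two_grid_nd; exact: leqW.
apply: eq_bigr => i _; have ik := ltn_ord i.
rewrite /a (min_capped (g0 m i.+1) (two_grid_nd m ik) (T0 w)).
rewrite (min_capped (g0 m i) (two_grid_nd m (ltnW ik)) (T0 w)).
rewrite -/(z m i.+1 w) -/(z m i w) /ratio mulrC.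
(* After T the coefficients read at the grid point and at the stopped grid point may differ, but the
   increment they multiply is zero. *)
have [h|h] := leP (two_grid m i)%:E (T w); first by rewrite /z (capped_ge h).
have hS : (T w <= (two_grid m i.+1)%:E)%E.
  by apply: le_trans (ltW h) _; rewrite lee_fin; exact: two_gridS.
rewrite (_ : z m i.+1 w = z m i w) ?subrr ?mul0r//.
rewrite /z; congr M; apply: EFin_inj; rewrite !capped_le// ltW//.
Qed.

Let two_grid_le_t m k : (k <= last m)%N -> two_grid m k <= t.
Proof. by move=> kl; rewrite -[leRHS](two_grid_last m) two_grid_nd. Qed.

Let si_integral0 m w : si_integral (inv_integrand m) M 0 w = 0.
Proof.
apply: big1 => i _; rewrite !(min_idPr (_ : 0 <= _)) ?subrr ?mulr0//; exact: g0.
Qed.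

Let err m e := sup_event (fun r w => si_integral (inv_integrand m) M r w - U r w) t e.

Let err_small e : 0 < e -> small P (err ^~ e).
Proof.
move=> e0; have h := hU ucp_inv_integrand.
have := (ucp_smallP P (fun n q e' => measurable_sup_si_integral usualF (inv_integrand n) q e' aM cM aU cU)).1 h t e (ltW t0) e0.
exact.
Qed.

Let err_Y m e k w : 0 <= e -> (k <= last m)%N -> ~ err m e w ->
  `|Y m k w - U (capped T (two_grid m k) w) w| <= e.
Proof.
move=> e0 kl hw; have c0 := cap0 w (g0 m k).
(* Time 0 is excluded from [sup_event] and treated apart: both sides vanish there. *)
rewrite -si_Y//; move: c0; rewrite le_eqVlt => /predU1P[<-|c0].
  by rewrite si_integral0 U0 subrr normr0.
rewrite leNgt; apply/negP => h; apply: hw; exists (capped T (two_grid m k) w) => //.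
rewrite c0/=; have /andP[_ ct] := capped_itv (g0 m k) (T0 w).
by rewrite (le_trans ct)// two_grid_le_t.
Qed.

(** Off a small event M moves by at most 1/(2c) over a grid step, so the ratios are at most 1/2
    because 1/M <= c; and [Y] is within 1 of U along the stopped grid, so it is at most c + 1. *)
Let dead_small : small P (fun m => ~` alive m (last m)).
Proof.
move=> eta eta0; have eta2 : 0 < eta / 2 by rewrite divr_gt0.
have c1 : 0 < c by rewrite (lt_le_trans _ c_ge1).
have e0 : 0 < (2 * c)^-1 by rewrite invr_gt0 mulr_gt0.
have [dl d0 [B1 [mB1 PB1 hB1]]] := modulus_prob P (fun q q0 => adapted_mfun usualF aM q0)
  cM (ltW t0) e0 eta2.
have [m0 hm0] := err_small ltr01 eta2.
have [m1 _ hm1] : \forall m \near \oo, t / m.+1%:R <= dl.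
  have /cvgrPdist_le/(_ _ d0) := mesh_cvg 0 t.
  apply: filterS => m; rewrite sub0r normrN subr0 ger0_norm//.
  by rewrite divr_ge0// ltW.
exists (maxn m0 m1) => m; rewrite geq_max => /andP[/hm0[B2 [mB2 SB2 PB2]] /hm1 hm].
exists (B1 `|` B2); split; first exact: measurableU.
  move=> w /= dead; apply: contrapT => /not_orP[w1 w2]; apply: dead.
  have w2' : ~ err m 1 w by move=> /SB2.
  split=> j jl.
    have [h0 h1 hV] := z_bound m j w.
    have /andP[ca cb] := capped_itv (g0 m j) (T0 w).
    have /andP[ca' cb'] := capped_itv (g0 m j.+1) (T0 w).
    have hz : `|z m j.+1 w - z m j w| <= (2 * c)^-1.
      apply: (hB1 w w1).
      - by rewrite ca' (le_trans cb')// two_grid_le_t.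
      - by rewrite ca (le_trans cb)// two_grid_le_t// ltnW.
      - rewrite ger0_norm ?subr_ge0; last by apply: capped_mono => //; exact: two_gridS.
        apply: le_trans (capped_lip (T0 w) (g0 m j) (two_gridS m j)) _.
        by have /andP[_ h] := two_grid_step m j; exact: le_trans hm.
    rewrite /ratio normrM [X in _ * X]gtr0_norm ?invr_gt0//.
    apply: (@le_trans _ _ ((2 * c)^-1 * c)).
      by apply: ler_pM => //; rewrite invr_ge0 ltW.
    by rewrite invfM -mulrA mulVf ?gt_eqF// mulr1 mul1r.
  rewrite ltnS in jl; have := err_Y ler01 jl w2' => h.
  have [_ _ hu] := Mc (cap0 w (g0 m j)) (capped_leT (g0 m j) (T0 w)).
  rewrite (_ : Y m j w = U (capped T (two_grid m j) w) w + (Y m j w - U (capped T (two_grid m j) w) w)); last by ring.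
  by rewrite (le_trans (ler_normD _ _))// lerD.
apply: le_trans (measureU2 _ mB1 mB2) _.
by rewrite [eta]splitr EFinD leeD.
Qed.

(** [kk m] is the index of the fixed time r in the m-th grid; the cases of interest are r = s, with
    index m + 1, and r = t. *)
Let Ya_small (kk : nat -> nat) r e : (forall m, (kk m <= last m)%N) ->
  (forall m, two_grid m (kk m) = r) -> 0 < e ->
  small P (fun m => [set w | e < `|Ya m (kk m) w - stopped U T r w|]).
Proof.
move=> kl kr e0; apply: small_sub (smallU (dead_small) (err_small e0)) => m w /= he.
have [al|] := pselect (alive m (last m) w); last by left.
right; apply: contrapT => nerr.
have [h1 _] := alive_sums (alive_le (kl m) al).
have := err_Y (ltW e0) (kl m) nerr; rewrite kr -h1 leNgt.
by rewrite -[U (capped T r w) w]/(stopped U T r w) he.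
Qed.

Let UT_bound r w : 0 <= r -> `|stopped U T r w| <= c.
Proof.
move=> r0; have [_ _ hu] := Mc (cap0 w r0) (capped_leT r0 (T0 w)).
exact: hu.
Qed.

Let UT_mfun r : 0 <= r -> measurable_fun setT (stopped U T r).
Proof. by move=> r0; exact: (adapted_mfun usualF (adapted_stopped usualF aU cU sT)). Qed.

Let c_le_bound : c <= bound.
Proof. by rewrite /bound -addrA lerDl addr_ge0// mulr_ge0. Qed.

Let Ex_Ya_cvg (kk : nat -> nat) r E : (forall m, (kk m <= last m)%N) ->
  (forall m, two_grid m (kk m) = r) -> 0 <= r -> measurable E ->
  Ex P (fun w => \1_E w * Ya m (kk m) w) @[m --> \oo] --> Ex P (fun w => \1_E w * stopped U T r w).
Proof.
move=> kl kr r0 mE; apply: (@Ex_cvg_small _ _ _ _ bound).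
- by move=> m; apply: measurable_funM; [exact: measurable_indic|exact: mfun_Ya].
- by apply: measurable_funM; [exact: measurable_indic|exact: UT_mfun].
- move=> m w; have [h _] := sums_bound m (kk m) w.
  by rewrite normrM (le_trans _ h)// ler_piMl// abs_indic_le1.
- move=> w; rewrite normrM (le_trans _ c_le_bound)//.
  by rewrite (le_trans _ (UT_bound w r0))// ler_piMl// abs_indic_le1.
- move=> e e0; apply: small_sub (Ya_small kl kr e0) => m w /= h.
  apply: lt_le_trans h _; rewrite -mulrBr normrM ler_piMl//; exact: abs_indic_le1.
Qed.

(** For the killed sums the identity holds on every grid; s and t being grid points throughout,
    bounded convergence in probability applies at both times. *)
Lemma stopped_integral_martingale E : F s E ->
  Ex P (fun w => \1_E w * stopped U T s w) = Ex P (fun w => \1_E w * stopped U T t w).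
Proof.
move=> FE; have mE := filt_meas usualF s0 FE.
have h1 := @Ex_Ya_cvg (fun m => m.+1) s E (fun m => leq_addr _ _) two_grid_mid s0 mE.
have h2 := @Ex_Ya_cvg last t E (fun m => leqnn _) two_grid_last (ltW t0) mE.
rewrite (_ : (fun m => _) = fun m => Ex P (fun w => \1_E w * Ya m m.+1 w)) in h2.
  exact: (cvg_unique (@Rhausdorff R) h1 h2).
by apply/funext => m; exact: Ex_Ya_martingale.
Qed.

Let Ex_sq_cvg : Ex P (fun w => Ya m (last m) w ^+ 2) @[m --> \oo] -->
  Ex P (fun w => stopped U T t w ^+ 2).
Proof.
have b0 : 0 <= bound by exact: le_trans c_le_bound.
have sqb x : `|x| <= bound -> `|x ^+ 2| <= bound ^+ 2.
  by move=> h; rewrite normrX ler_pXn2r ?nnegrE.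
apply: (@Ex_cvg_small _ _ _ _ (bound ^+ 2)).
- by move=> m; exact/measurable_funX/mfun_Ya.
- by apply/measurable_funX/UT_mfun; exact: ltW.
- by move=> m w; apply: sqb; have [h _] := sums_bound m (last m) w.
- by move=> w; apply: sqb; rewrite (le_trans (UT_bound w (ltW t0))).
move=> e e0; have b1 : 0 < 2 * bound + 1 by rewrite ltr_wpDl// mulr_ge0.
apply: small_sub (Ya_small (fun m => leqnn (last m)) two_grid_last (divr_gt0 e0 b1)) => m w /= h.
rewrite ltr_pdivrMr//; apply: lt_le_trans h _.
rewrite subr_sqr normrM ler_wpM2l//.
have [h1 _] := sums_bound m (last m) w; have h2 := UT_bound w (ltW t0).
by have := ler_normD (Ya m (last m) w) (stopped U T t w); have := c_le_bound; lra.
Qed.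

Let Ex_log_cvg : Ex P (La m (last m)) @[m --> \oo] --> Ex P (fun w => ln (stopped M T t w)).
Proof.
have lnE m w : ln (stopped M T t w) = ln (z m (last m) w) by rewrite /z two_grid_last.
apply: (@Ex_cvg_small _ _ _ _ c).
- by move=> m; exact: mfun_La.
- apply: measurableT_comp => //.
  by apply: (adapted_mfun usualF (adapted_stopped usualF aM cM sT)); exact: ltW.
- by move=> m w; have [] := sums_bound m (last m) w.
- by move=> w; rewrite (lnE 0%N) lnz_bound.
move=> e e0; apply: small_sub dead_small => m w /= h al.
have [_ h2] := alive_sums al.
by move: h; rewrite (lnE m) h2 z0E ln1 subr0 subrr normr0 ltNge ltW.
Qed.

Let Ex_dead_cvg : Ex P (fun w => 1 - \1_(alive m (last m)) w) @[m --> \oo] --> (0 : R).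
Proof.
have := @Ex_cvg_small _ _ _ P 1 (fun m w => 1 - \1_(alive m (last m)) w) (fun=> 0).
rewrite Ex_cst; apply.
- by move=> m; apply: measurable_funB => //; exact: measurable_indic.
- exact: measurable_cst.
- by move=> m w; rewrite indicE; case: (_ \in _); rewrite /= ?mulr1n ?mulr0n ?subrr ?subr0 ?normr0 ?normr1.
- by move=> w; rewrite normr0.
move=> e e0; apply: small_sub dead_small => m w /= h al.
by move: h; rewrite (indicT' al) subrr subr0 normr0 ltNge ltW.
Qed.

Let Lone_dead m k C : Lone P (fun w => C * (1 - \1_(alive m k) w)).
Proof. by apply: LoneZ; apply: LoneB; [exact: Lone_cst|exact: Lone_indic]. Qed.

Let Lone_sq m k : Lone P (fun w => \1_(alive m k) w * ratio m k w ^+ 2).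
Proof.
apply: (@Lone_bdd _ _ _ _ ((c * c) ^+ 2)).
  by apply: measurable_funM; [exact: measurable_indic|exact/measurable_funX/mfun_ratio].
move=> w; rewrite normrM (le_trans (ler_piMl _ (abs_indic_le1 _ _)))//.
by rewrite normrX ler_pXn2r ?nnegrE ?mulr_ge0 ?ratio_bound.
Qed.

Let Lone_rem m k : Lone P (fun w => \1_(alive m k) w * (ratio m k w - logr m k w)).
Proof.
apply: (@Lone_bdd _ _ _ _ (c * c + (c + c))).
  by apply: measurable_funM; [exact: measurable_indic|apply: measurable_funB; [exact: mfun_ratio|exact: mfun_logr]].
move=> w; rewrite normrM (le_trans (ler_piMl _ (abs_indic_le1 _ _)))//.
rewrite (le_trans (ler_normB _ _))// lerD ?ratio_bound//.
by rewrite (le_trans (ler_normB _ _))// lerD// lnz_bound.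
Qed.

(** Isometry and [bad_sq] give the inequality for the killed sums up to a multiple of the
    probability of the dead event, which tends to 0. *)
Lemma stopped_sq_le_log : Ex P (fun w => stopped U T t w ^+ 2) <=
  8 * - Ex P (fun w => ln (stopped M T t w)).
Proof.
have key m : Ex P (fun w => Ya m (last m) w ^+ 2) - 8 * - Ex P (La m (last m)) <=
    (c * c) ^+ 2 * Ex P (fun w => 1 - \1_(alive m (last m)) w).
  rewrite Ex_sq Ex_log -(ExZ 8); last exact: Lone_sum.
  rewrite -ExB; [|exact: Lone_sum|exact/LoneZ/Lone_sum].
  rewrite -ExZ; last by apply: LoneB; [exact: Lone_cst|exact: Lone_indic].
  apply: Ex_le; [apply: LoneB; [exact: Lone_sum|exact/LoneZ/Lone_sum]|exact: Lone_dead|].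
  move=> w; apply: le_trans (bad_sq m (last m) w).
  rewrite mulr_sumr -sumrB le_eqVlt; apply/orP; left; apply/eqP.
  by apply: eq_bigr => i _; ring.
rewrite -subr_le0.
have h1 : Ex P (fun w => Ya m (last m) w ^+ 2) - 8 * - Ex P (La m (last m)) @[m --> \oo] -->
    Ex P (fun w => stopped U T t w ^+ 2) - 8 * - Ex P (fun w => ln (stopped M T t w)).
  by apply: cvgB; [exact: Ex_sq_cvg|apply: cvgMr; apply: cvgN; exact: Ex_log_cvg].
have h2 : (c * c) ^+ 2 * Ex P (fun w => 1 - \1_(alive m (last m)) w) @[m --> \oo] --> (0 : R).
  by rewrite -[X in _ --> X](mulr0 ((c * c) ^+ 2)); apply: cvgMr; exact: Ex_dead_cvg.
by apply: (ler_cvg_to h1 h2); apply: nearW.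
Qed.

Lemma stopped_log_le_sq : - Ex P (fun w => ln (stopped M T t w)) <=
  2 * Ex P (fun w => stopped U T t w ^+ 2).
Proof.
have key m : - Ex P (La m (last m)) - 2 * Ex P (fun w => Ya m (last m) w ^+ 2) <=
    (c * c + (c + c)) * Ex P (fun w => 1 - \1_(alive m (last m)) w).
  rewrite Ex_sq Ex_log -(ExZ 2); last exact: Lone_sum.
  rewrite -ExB; [|exact: Lone_sum|exact/LoneZ/Lone_sum].
  rewrite -ExZ; last by apply: LoneB; [exact: Lone_cst|exact: Lone_indic].
  apply: Ex_le; [apply: LoneB; [exact: Lone_sum|exact/LoneZ/Lone_sum]|exact: Lone_dead|].
  move=> w; apply: le_trans (bad_log m (last m) w).
  rewrite mulr_sumr -sumrB le_eqVlt; apply/orP; left; apply/eqP.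
  by apply: eq_bigr => i _; ring.
rewrite -subr_le0.
have h1 : - Ex P (La m (last m)) - 2 * Ex P (fun w => Ya m (last m) w ^+ 2) @[m --> \oo] -->
    - Ex P (fun w => ln (stopped M T t w)) - 2 * Ex P (fun w => stopped U T t w ^+ 2).
  by apply: cvgB; [apply: cvgN; exact: Ex_log_cvg|apply: cvgMr; exact: Ex_sq_cvg].
have h2 : (c * c + (c + c)) * Ex P (fun w => 1 - \1_(alive m (last m)) w) @[m --> \oo] --> (0 : R).
  by rewrite -[X in _ --> X](mulr0 (c * c + (c + c))); apply: cvgMr; exact: Ex_dead_cvg.
by apply: (ler_cvg_to h1 h2); apply: nearW.
Qed.

End Grid.
End StoppedLogIntegral.

(** * Convergence of positive martingales *)

Section MartingaleConvergence.
Context {R : realType} {d} {Omega : measurableType d} (P : probability Omega R).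
Variable F : R -> set (set Omega).
Hypothesis usualF : usual_filtration P F.

Lemma measure_nondecreasing_le (B : nat -> set Omega) b : (forall n, measurable (B n)) ->
  (forall n, B n `<=` B n.+1) -> (forall n, (P (B n) <= b%:E)%E) ->
  (P (\bigcup_n B n) <= b%:E)%E.
Proof.
move=> mB BS Bb.
have h : P (B n) @[n --> \oo] --> P (\bigcup_n B n).
  apply: nondecreasing_cvg_mu => //; first exact: bigcupT_measurable.
  by apply/nondecreasing_seqP => n; apply/subsetPset; exact: BS.
rewrite -(cvg_lim (@ereal_hausdorff R) h); apply: lime_le; last exact: nearW.
by apply/cvg_ex; exists (P (\bigcup_n B n)); exact: h.
Qed.

(** * Bounded martingales: maximal inequality and convergence of second moments *)

Section BoundedMartingale.
Variables (Z : R -> Omega -> R) (c : R).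
Hypothesis mZ : martingale P F Z.
Hypothesis cZ : sure_continuous Z.
Hypothesis Zc : forall t w, 0 <= t -> `|Z t w| <= c.

Let aZ : adapted F Z. Proof. by have [] := (martingaleP usualF Z).1 mZ. Qed.
Let mfZ t : 0 <= t -> measurable_fun setT (Z t).
Proof. by move=> t0; exact: (adapted_mfun usualF aZ). Qed.
Let c0 : 0 <= c. Proof. by rewrite (le_trans _ (Zc point (lexx 0))). Qed.

Let diff_bound s t w : 0 <= s -> 0 <= t -> `|Z t w - Z s w| <= c + c.
Proof. by move=> s0 t0; rewrite (le_trans (ler_normB _ _))// lerD// Zc. Qed.

Let Lone_sqdiff s t : 0 <= s -> 0 <= t -> Lone P (fun w => (Z t w - Z s w) ^+ 2).
Proof.
move=> s0 t0; apply: (@Lone_bdd _ _ _ _ ((c + c) ^+ 2)).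
  by apply/measurable_funX/measurable_funB; exact: mfZ.
by move=> w; rewrite normrX ler_pXn2r ?nnegrE ?addr_ge0// diff_bound.
Qed.

Let Lone_sqZ t : 0 <= t -> Lone P (fun w => Z t w ^+ 2).
Proof.
move=> t0; apply: (@Lone_bdd _ _ _ _ (c ^+ 2)); first exact/measurable_funX/mfZ.
by move=> w; rewrite normrX ler_pXn2r ?nnegrE// Zc.
Qed.

Lemma sqdiff_martingale s t E : 0 <= s -> s <= t -> F s E ->
  Ex P (fun w => \1_E w * (Z t w - Z s w) ^+ 2) =
  Ex P (fun w => \1_E w * Z t w ^+ 2) - Ex P (fun w => \1_E w * Z s w ^+ 2).
Proof.
move=> s0 st FE; have t0 := le_trans s0 st; have mE := filt_meas usualF s0 FE.
have I1 f : Lone P f -> Lone P (fun w => \1_E w * f w).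
  by move=> If; exact: LoneM_bdd If (measurable_indic mE) (abs_indic_le1 E).
have sg := filt_sigma usualF s0.
have mg : rv_measurable (F s) (fun w => \1_E w * (2 * Z s w)).
  apply: (rvM sg); first exact: rv_indic.
  by apply: (rvM sg); [exact: (rv_cst sg)|exact: aZ].
have gb w : `|\1_E w * (2 * Z s w)| <= 2 * c.
  rewrite normrM (le_trans (ler_piMl _ (abs_indic_le1 _ _)))//.
  by rewrite normrM ger0_norm// ler_pM2l// Zc.
have mg' := rv_mfun (filt_meas usualF s0) mg.
have o := martingale_orth usualF mZ s0 st mg gb.
have It := LoneM_bdd (martingale_Lone usualF mZ t0) mg' gb.
have Is := LoneM_bdd (martingale_Lone usualF mZ s0) mg' gb.
rewrite (_ : (fun w => \1_E w * (Z t w - Z s w) ^+ 2) = fun w =>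
   (\1_E w * Z t w ^+ 2 - \1_E w * Z s w ^+ 2) -
   (\1_E w * (2 * Z s w) * Z t w - \1_E w * (2 * Z s w) * Z s w)); last first.
  by apply/funext => w; ring.
rewrite ExB; [|by apply: LoneB; apply/I1/Lone_sqZ|exact: LoneB].
rewrite ExB; [|exact/I1/Lone_sqZ|exact/I1/Lone_sqZ].
by rewrite ExB// o subrr subr0.
Qed.

(** The displacement after s, extended by 0 before s so as to be adapted and continuous from time 0
    on. *)
Let V s r w := `|Z (Num.max s r) w - Z s w|.

Let V_adapted s : 0 <= s -> adapted F (V s).
Proof.
move=> s0 r r0; have sg := filt_sigma usualF r0; apply: (rv_norm sg).
have [sr|rs] := leP s r; last first.
  rewrite (_ : (fun w => _) = fun=> 0); first exact: (rv_cst sg).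
  by apply/funext => w; rewrite subrr.
apply: (rvB sg); first exact: aZ.
by apply: (filt_rv usualF s0 sr); exact: aZ.
Qed.

Let V_continuous s : 0 <= s -> sure_continuous (V s).
Proof.
move=> s0 w; apply: cpath_norm; apply: cpathB; last exact: cpath_cst.
rewrite /cpath.
have -> : (fun t => Z (Num.max s (Num.max 0 t)) w) = fun t => Z (Num.max 0 (Num.max s t)) w.
  by apply/funext => t; rewrite maxCA.
move=> t; apply: (@cvg_comp _ _ _ (fun t => Num.max s t) (fun t => Z (Num.max 0 t) w)); last exact: cZ.
apply/cvgrPdist_lt => e e0; near=> x.
apply: (@le_lt_trans _ _ `|t - x|); last by near: x; exact: cvgr_dist_lt.
have h1 := ler_norm (t - x); have h2 := ler_norm (x - t); rewrite distrC in h2.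
rewrite /Num.max ler_norml.
by case: (ltP s t) => ?; case: (ltP s x) => ?; apply/andP; split; lra.
Unshelve. all: by end_near. Qed.

(** Doob's argument with the first time the displacement reaches e: the squared displacement is a
    nonnegative submartingale, at least e^2 at that time, and optional sampling bounds its mean by
    b. The horizon s + n then increases to infinity. *)
Lemma maximal_inequality s e b : 0 <= s -> 0 < e ->
  (forall t, s <= t -> Ex P (fun w => (Z t w - Z s w) ^+ 2) <= b) ->
  exists B, [/\ measurable B, (P B <= (b / e ^+ 2)%:E)%E &
    forall w, ~ B w -> forall t, s <= t -> `|Z t w - Z s w| <= e].
Proof.
move=> s0 e0 hb; pose S := hitting (V s) e.
have sS : stopping_time F S by apply: (hitting_stopping usualF); [exact: V_adapted|exact: V_continuous].
pose B n := [set w | (S w <= (s + n%:R)%:E)%E].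
have n0 (n : nat) : 0 <= s + n%:R :> R by rewrite addr_ge0.
have mB n : measurable (B n) by apply: (filt_meas usualF (n0 n)); apply: sS.2.
have Vmax t w : s <= t -> V s t w = `|Z t w - Z s w| by move=> st; rewrite /V (max_idPr st).
exists (\bigcup_n B n); split; first exact: bigcupT_measurable.
- apply: measure_nondecreasing_le => // n.
    by move=> w /= h; apply: le_trans h _; rewrite lee_fin lerD2l ler_nat.
  pose t := s + n%:R; have t0 : 0 <= t := n0 n.
  have st : s <= t by rewrite /t lerDl.
  pose W r w := V s r w ^+ 2.
  have aW : adapted F W by move=> r r0; apply: (rvX (filt_sigma usualF r0)); exact: V_adapted.
  have cW : sure_continuous W.
    by move=> w; apply: cpathM; exact: V_continuous.
  have IW r : 0 <= r -> Lone P (W r).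
    move=> r0; rewrite (_ : W r = fun w => (Z (Num.max s r) w - Z s w) ^+ 2).
      by apply: Lone_sqdiff; rewrite // le_max s0.
    by apply/funext => w; rewrite /W /V real_normK// num_real.
  have W0 r w : 0 <= W r w by exact: sqr_ge0.
  (* The submartingale inequality for the squared displacement; before s the left side is zero. *)
  have dom r E : 0 <= r <= t -> F r E ->
      Ex P (fun w => \1_E w * `|W r w|) <= Ex P (fun w => \1_E w * W t w).
    move=> /andP[r0 rt] FE; have mE := filt_meas usualF r0 FE.
    have [sr|rs] := leP s r; last first.
      rewrite (_ : (fun w => _) = fun=> 0).
        by rewrite Ex_cst; apply: Ex_ge0 => w; rewrite mulr_ge0// ler0n.
      by apply/funext => w; rewrite /W /V (max_idPl (ltW rs)) subrr normr0 expr0n/= normr0 mulr0.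
    have I1 f : Lone P f -> Lone P (fun w => \1_E w * f w).
      by move=> If; exact: LoneM_bdd If (measurable_indic mE) (abs_indic_le1 E).
    have sg := filt_sigma usualF r0.
    have mg : rv_measurable (F r) (fun w => \1_E w * (2 * (Z r w - Z s w))).
      apply: (rvM sg); first exact: rv_indic.
      apply: (rvM sg); first exact: (rv_cst sg).
      by apply: (rvB sg); [exact: aZ|apply: (filt_rv usualF s0 sr); exact: aZ].
    have gb w : `|\1_E w * (2 * (Z r w - Z s w))| <= 2 * (c + c).
      rewrite normrM (le_trans (ler_piMl _ (abs_indic_le1 _ _)))//.
      by rewrite normrM ger0_norm// ler_pM2l// diff_bound.
    have mg' := rv_mfun (filt_meas usualF r0) mg.
    have o := martingale_orth usualF mZ r0 rt mg gb.
    have It := LoneM_bdd (martingale_Lone usualF mZ t0) mg' gb.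
    have Ir := LoneM_bdd (martingale_Lone usualF mZ r0) mg' gb.
    rewrite -subr_ge0 -ExB; [|exact/I1/IW|exact/I1/Lone_abs/IW].
    rewrite (_ : (fun w => _) = fun w => \1_E w * (Z t w - Z r w) ^+ 2 +
      (\1_E w * (2 * (Z r w - Z s w)) * Z t w - \1_E w * (2 * (Z r w - Z s w)) * Z r w)); last first.
      apply/funext => w; rewrite (ger0_norm (W0 _ _)) /W !Vmax//.
      by rewrite !real_normK ?num_real//; ring.
    rewrite ExD; [|exact/I1/Lone_sqdiff|exact: LoneB].
    rewrite [X in _ + X]ExB// o subrr addr0.
    by apply: Ex_ge0 => w; rewrite mulr_ge0 ?sqr_ge0// ler0n.
  have := stopped_dominated_le usualF (IW t t0) (W0 t) aW cW sS t0 IW dom.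
  have IB : Lone P (fun w => e ^+ 2 * \1_(B n) w) by exact/LoneZ/Lone_indic.
  have le1 : (\int[P]_w (e ^+ 2 * \1_(B n) w)%:E <= \int[P]_w (`|stopped W S t w|)%:E)%E.
    apply: ge0_le_integral => //.
    - by move=> w _; rewrite lee_fin mulr_ge0 ?sqr_ge0// ler0n.
    - by apply/measurable_EFinP; exact: Lone_meas IB.
    - apply/measurable_EFinP/measurable_norm.
      exact: (adapted_mfun usualF (adapted_stopped usualF aW cW sS)).
    move=> w _; rewrite lee_fin; have [Bw|Bw] := pselect (B n w); last first.
      by rewrite indicE memNset// mulr0.
    rewrite indicE mem_set// mulr1 ger0_norm; last exact: W0.
    have h : e <= V s (capped S t w) w by apply: hitting_capped => //; exact: V_continuous.
    by rewrite /stopped -/(capped S t w) /W; apply: lerXn2r;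
      [rewrite nnegrE ltW|rewrite nnegrE; exact: normr_ge0|exact: h].
  move=> /(le_trans le1); rewrite ExE// ExZ ?lee_fin; last exact: Lone_indic.
  move=> h; rewrite -Ex_indic// lee_fin ler_pdivlMr ?exprn_gt0// mulrC.
  apply: le_trans h _; apply: le_trans (hb t st).
  apply: Ex_le; [exact: IW|exact: Lone_sqdiff|].
  by move=> w; rewrite /W Vmax// real_normK// num_real.
- move=> w Bw t st; have t0 := le_trans s0 st; rewrite leNgt; apply/negP => h; apply: Bw.
  exists (Num.truncn t).+1 => //; apply/hitting_leP => //; first exact: V_continuous.
  exists t; last by rewrite Vmax// ltW.
  by rewrite t0/= (le_trans (ltW (truncnS_gt t)))// lerDr.
Qed.

(** E (Z t)^2 is bounded and E (Z t - Z s)^2 is its increment, so s may be taken where it comes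
    within b of its supremum. *)
Lemma bounded_martingale_cauchy b : 0 < b ->
  exists2 s, 0 <= s & forall t, s <= t -> Ex P (fun w => (Z t w - Z s w) ^+ 2) <= b.
Proof.
move=> b0; pose f t := Ex P (fun w => Z t w ^+ 2).
pose A := [set f t | t in [set t | 0 <= t]].
have ubA : has_ubound A.
  exists (c ^+ 2) => _ [t t0 <-]; rewrite /f -[leRHS](Ex_cst P).
  apply: Ex_le; [exact: Lone_sqZ|exact: Lone_cst|].
  move=> w; rewrite -(real_normK (num_real _)) ler_pXn2r ?nnegrE//; exact: Zc.
have supA : has_sup A by split=> //; exists (f 0), 0 => //=.
have [_ [s s0 <-] hs] := sup_adherent b0 supA.
exists s => // t st; have t0 := le_trans s0 st.
have := sqdiff_martingale s0 st (sigmaT (filt_sigma usualF s0)).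
rewrite (_ : (fun w => _) = fun w => (Z t w - Z s w) ^+ 2); last first.
  by apply/funext => w; rewrite indicT mul1r.
move=> ->.
rewrite [X in X - _](_ : _ = f t); last by apply: eq_Ex => w; rewrite indicT mul1r.
rewrite [X in _ - X](_ : _ = f s); last by apply: eq_Ex => w; rewrite indicT mul1r.
have : f t <= sup A by apply: ub_le_sup => //; exists t.
by move: hs => /=; lra.
Qed.

End BoundedMartingale.

Variable M : R -> Omega -> R.
Hypothesis mM : martingale P F M.
Hypothesis cM : sure_continuous M.
Hypothesis M_ge0 : forall t w, 0 <= t -> 0 <= M t w.
Hypothesis M0 : forall w, M 0 w = 1.

Let aM : adapted F M. Proof. by have [] := (martingaleP usualF M).1 mM. Qed.

(** Stopped at the level K, the martingale is bounded and the maximal inequality applies. Since the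
    stopped mean stays equal to 1, the level is reached with probability at most 1/K, and on the
    other paths stopping changes nothing. *)
Lemma positive_martingale_cauchy e eta : 0 < e -> 0 < eta ->
  exists B, [/\ measurable B, (P B <= eta%:E)%E &
    forall w, ~ B w -> exists2 s, 0 <= s & forall t, s <= t -> `|M t w - M s w| <= e].
Proof.
move=> e0 eta0; have eta2 : 0 < eta / 2 by rewrite divr_gt0.
pose K := (Num.truncn (eta / 2)^-1).+2.
have K0 : 0 < K%:R :> R by rewrite ltr0n.
have KK : K%:R^-1 <= eta / 2.
  rewrite -[leRHS]invrK lef_pV2 ?posrE ?invr_gt0//.
  by rewrite (le_trans (ltW (truncnS_gt _)))// ler_nat.
pose T := hitting M K%:R.
have sT : stopping_time F T by exact: (hitting_stopping usualF).
have mZ := martingale_stopped usualF mM cM sT.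
have MK w : M 0 w <= K%:R by rewrite M0 ler1n.
have Zc t w : 0 <= t -> `|stopped M T t w| <= K%:R.
  move=> t0; apply: stopped_bound => //; first exact: sT.1.
  by move=> r r0 rT; rewrite ger0_norm ?M_ge0//; apply: (hitting_bound cM).
have cZ : sure_continuous (stopped M T).
  move=> w; apply: continuous_stopped_path => //; exact: sT.1.
(* The factor e^2 cancels the one in the maximal inequality and leaves probability eta/2. *)
have [s s0 hs] := bounded_martingale_cauchy mZ Zc (mulr_gt0 eta2 (exprn_gt0 2 e0)).
have [B1 [mB1 PB1 hB1]] := maximal_inequality mZ cZ Zc s0 e0 hs.
rewrite mulfK ?gt_eqF ?exprn_gt0// in PB1.
pose C n := [set w | (T w <= (n%:R : R)%:E)%E].
have mC n : measurable (C n) by apply: (filt_meas usualF (ler0n R n)); apply: sT.2.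
have PC : (P (\bigcup_n C n) <= (eta / 2)%:E)%E.
  apply: measure_nondecreasing_le => // n.
    by move=> w /= h; apply: le_trans h _; rewrite lee_fin ler_nat.
  have n0 : 0 <= n%:R :> R by [].
  have [_ IZ hZ] := (martingaleP usualF _).1 mZ.
  have E1 : Ex P (stopped M T n%:R) = 1.
    have := hZ 0 n%:R setT (lexx 0) n0 (sigmaT (filt_sigma usualF (lexx 0))).
    rewrite [X in _ = X -> _](_ : _ = Ex P (stopped M T n%:R)); last first.
      by apply: eq_Ex => w; rewrite indicT mul1r.
    move=> <-; rewrite -[RHS](Ex_cst P 1); apply: eq_Ex => w.
    by rewrite indicT mul1r /stopped -/(capped T 0 w) capped_ge ?M0// sT.1.
  have : K%:R * Ex P (\1_(C n) : Omega -> R) <= 1.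
    rewrite -[leRHS]E1 -ExZ; last exact: Lone_indic.
    apply: Ex_le; [exact/LoneZ/Lone_indic|exact: IZ|].
    move=> w; have /andP[c0 _] := capped_itv n0 (sT.1 w).
    have [Cw|Cw] := pselect (C n w); last first.
      by rewrite indicE memNset// mulr0; exact: M_ge0.
    rewrite indicE mem_set// mulr1.
    exact: (@hitting_capped _ _ _ M cM K%:R n%:R w n0 Cw).
  rewrite -ler_pdivlMl// mulr1 -Ex_indic// lee_fin => /le_trans; exact.
have mCC : measurable (\bigcup_n C n) by exact: bigcupT_measurable.
exists (B1 `|` \bigcup_n C n); split; first exact: measurableU.
  apply: le_trans (measureU2 _ mB1 mCC) _.
  by rewrite [eta]splitr EFinD leeD.
move=> w /not_orP[w1 w2]; exists s => // t st; have t0 := le_trans s0 st.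
have ZM r : 0 <= r -> stopped M T r w = M r w.
  move=> r0; rewrite /stopped -/(capped T r w) capped_ge// leNgt; apply/negP => h.
  apply: w2; exists (Num.truncn r).+1 => //=; apply: le_trans (ltW h) _.
  by rewrite lee_fin ltW// truncnS_gt.
by rewrite -!ZM//; exact: hB1.
Qed.

(** For each precision 1/(k+1) the bad paths lie in sets of arbitrarily small probability, hence
    form a negligible set; the remaining paths satisfy the Cauchy criterion. *)
Lemma positive_martingale_cvg : {ae P, forall w, cvg (M t w @[t --> +oo])}.
Proof.
pose Nk k := [set w | ~ exists2 s, 0 <= s & forall t, s <= t -> `|M t w - M s w| <= k.+1%:R^-1].
have nk k : P.-negligible (Nk k).
  have k0 : 0 < k.+1%:R^-1 :> R by rewrite invr_gt0.
  have /choice[B hB] : forall n : nat, exists B, [/\ measurable B, (P B <= (n.+1%:R^-1)%:E)%E &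
    forall w, ~ B w -> exists2 s, 0 <= s & forall t, s <= t -> `|M t w - M s w| <= k.+1%:R^-1].
    by move=> n; apply: positive_martingale_cauchy => //; rewrite invr_gt0.
  exists (\bigcap_n B n); split.
  - by apply: bigcapT_measurable => n; have [] := hB n.
  - apply/eqP; rewrite eq_le measure_ge0 andbT; apply/lee_addgt0Pr => eps eps0; rewrite add0e.
    have [n hn] : exists n : nat, n.+1%:R^-1 <= eps.
      exists (Num.truncn eps^-1); rewrite -[leRHS]invrK lef_pV2 ?posrE ?invr_gt0//.
      exact/ltW/truncnS_gt.
    have [mB PB _] := hB n.
    apply: (@le_trans _ _ (P (B n))).
      apply: le_measure; rewrite ?inE//.
        by apply: bigcapT_measurable => j; have [] := hB j.
      by move=> w; apply.
    by rewrite (le_trans PB)// lee_fin.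
  - move=> w hw n _; apply: contrapT => Bw; apply: hw.
    by have [_ _ h] := hB n; exact: h.
apply: negligibleS (negligible_bigcup nk) => w /= hw.
apply: contrapT => hN; apply: hw.
apply/cauchy_cvgP/cauchy_exP => eps eps0.
have [k hk] : exists k : nat, k.+1%:R^-1 < eps.
  exists (Num.truncn eps^-1); rewrite -[ltRHS]invrK ltf_pV2 ?posrE ?invr_gt0//.
  exact: truncnS_gt.
have [s s0 hs] : exists2 s, 0 <= s & forall t, s <= t -> `|M t w - M s w| <= k.+1%:R^-1.
  by apply: contrapT => h; apply: hN; exists k.
exists (M s w); exists s; split; first exact: num_real.
by move=> t st; rewrite /= /ball/= distrC (le_lt_trans _ hk)// hs// ltW.
Qed.

End MartingaleConvergence.

(** * The integral of 1/(1+X) against N *)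

Section Refinement.
Context {R : realType} {d} {Omega : measurableType d} (P : probability Omega R).
Variable F : R -> set (set Omega).
Hypothesis usualF : usual_filtration P F.

Lemma sum_blocks (a : nat -> R) n m :
  \sum_(i < n * m) a i = \sum_(k < n) \sum_(j < m) a (k * m + j)%N.
Proof.
elim: n => [|n ih]; first by rewrite mul0n !big_ord0.
by rewrite mulSnr big_split_ord /= ih big_ord_recr.
Qed.

Lemma measurable_tight (f : Omega -> R) eta : measurable_fun setT f -> 0 < eta ->
  exists2 K : R, 0 < K & (P [set w | (K < f w)%R] <= eta%:E)%E.
Proof.
move=> mf eta0; pose S (n : nat) := [set w | n.+1%:R < f w].
have mS n : measurable (S n) by exact: measurable_lt.
have : small P S.
  apply: small_pointwise => // w; near=> n; apply/negP; rewrite -leNgt.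
  apply: (@le_trans _ _ n%:R); last by rewrite ler_nat.
  near: n; exact: nbhs_infty_ger.
move=> /(_ _ eta0)[n /(_ n (leqnn n))[B [mB SB PB]]]; exists n.+1%:R => //.
by apply: le_trans PB; apply: le_measure; rewrite ?inE//; exact: mS.
Unshelve. all: by end_near. Qed.

Variables (M : R -> Omega -> R).
Hypothesis aM : adapted F M.
Hypothesis cM : sure_continuous M.
Hypothesis M_gt0 : forall t w, 0 <= t -> 0 < M t w.
Let I t w := path_inf (M ^~ w) t.
Hypothesis aI : adapted F I.
Hypothesis cI : sure_continuous I.

Let I_gt0 t w : 0 <= t -> 0 < I t w.
Proof. by move=> t0; apply: path_inf_gt0 => // s s0; exact: M_gt0. Qed.

Let I_le_M t w : 0 <= t -> I t w <= M t w.
Proof. by move=> t0; apply: path_inf_le => //; rewrite ?t0 ?lexx// => s s0; exact: M_gt0. Qed.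

Let V t w := (I t w)^-1.

Let aV : adapted F V.
Proof. by move=> t t0; apply: (rvV (filt_sigma usualF t0)); exact: aI. Qed.

Let cV : sure_continuous V.
Proof. by move=> w; apply: cpathV => // t t0; rewrite gt_eqF// I_gt0. Qed.

Let V_gt0 t w : 0 <= t -> 0 < V t w.
Proof. by move=> t0; rewrite invr_gt0 I_gt0. Qed.

Let V_mono s t w : 0 <= s -> s <= t -> V s w <= V t w.
Proof.
move=> s0 st; rewrite lef_pV2 ?posrE ?I_gt0//; last exact: le_trans st.
by apply: path_inf_anti => // r r0; exact: M_gt0.
Qed.

Section Refine.
Variables (J : simple_integrand F) (m : nat).

(* [refine J m] approximates the integrand J/I, whose integral against M is that
   of J against N: each interval of J is divided into m+1 equal steps. *)
Definition refine_time (i : nat) : R :=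
  si_time J (i %/ m.+1) + (i %% m.+1)%N%:R / m.+1%:R *
    (si_time J (i %/ m.+1).+1 - si_time J (i %/ m.+1)).

(** The case j = m + 1 is included: the end of a block is the beginning of the next one. *)
Lemma refine_timeE k j : (j <= m.+1)%N -> refine_time (k * m.+1 + j) =
  si_time J k + j%:R / m.+1%:R * (si_time J k.+1 - si_time J k).
Proof.
rewrite leq_eqVlt => /predU1P[->|jm].
  rewrite /refine_time -mulSnr mulnK// modnMl mul0r mul0r addr0.
  by rewrite divff ?pnatr_eq0// mul1r addrC subrK.
by rewrite /refine_time divnMDl// modnMDl divn_small// modn_small// addn0.
Qed.

Lemma refine_step k j : (j < m.+1)%N ->
  refine_time (k * m.+1 + j.+1) - refine_time (k * m.+1 + j) =
  (si_time J k.+1 - si_time J k) / m.+1%:R.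
Proof.
move=> jm; rewrite !refine_timeE//; last exact: ltnW.
by rewrite -(natr1 j); ring.
Qed.

Lemma refine_timeS i : refine_time i <= refine_time i.+1.
Proof.
rewrite {1 2}(divn_eq i m.+1) -addnS -subr_ge0 refine_step ?ltn_pmod//.
by rewrite divr_ge0// subr_ge0 si_time_nd.
Qed.

Lemma refine_time_ge i : si_time J (i %/ m.+1) <= refine_time i.
Proof. by rewrite /refine_time lerDl mulr_ge0 ?divr_ge0// subr_ge0 si_time_nd. Qed.

Lemma refine_time_ge0 i : 0 <= refine_time i.
Proof. by rewrite (le_trans (si_time_nneg J (i %/ m.+1)))// refine_time_ge. Qed.

Definition refine_coef i w := si_coef J (i %/ m.+1) w * V (refine_time i) w.

Lemma refine_coef_meas i : rv_measurable (F (refine_time i)) (refine_coef i).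
Proof.
have sg := filt_sigma usualF (refine_time_ge0 i); apply: (rvM sg).
  by apply: (filt_rv usualF (si_time_nneg J _) (refine_time_ge i)); exact: si_coef_meas.
exact: aV (refine_time_ge0 i).
Qed.

Definition refine : simple_integrand F :=
  @SimpleIntegrand _ _ _ F (si_size J * m.+1)%N refine_time refine_coef
    (refine_time_ge0 0) refine_timeS refine_coef_meas.

Variable L : R.
Hypothesis hL : forall k, (k < si_size J)%N -> si_time J k.+1 - si_time J k <= L.

(** Here 1/I is read at the last refined time before s, less than one refined step earlier. Off the
    intervals of [J] both integrands vanish and r = s is taken. *)
Lemma refine_process s w : 0 < s -> exists2 r, 0 <= r <= s &
  s - r <= L / m.+1%:R /\ si_process refine s w = si_process J s w * V r w
  \/ s = r /\ si_process refine s w = si_process J s w * V r w.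
Proof.
move=> s0.
have [[k kJ hk]|hn] := pselect (exists2 k, (k < si_size J)%N & si_time J k < s <= si_time J k.+1).
  have /andP[k1 k2] := hk.
  have [j jm hj] : exists2 j, (j < m.+1)%N &
      refine_time (k * m.+1 + j) < s <= refine_time (k * m.+1 + j.+1).
    have cov q : refine_time (k * m.+1 + 0) < s <= refine_time (k * m.+1 + q) ->
        exists2 j, (j < q)%N & refine_time (k * m.+1 + j) < s <= refine_time (k * m.+1 + j.+1).
      elim: q => [/andP[h1 h2]|q ih /andP[h1 h2]].
        by have := lt_le_trans h1 h2; rewrite ltxx.
      have [h|h] := leP s (refine_time (k * m.+1 + q)).
        by have [|j jq hj] := ih; [rewrite h1|exists j => //; exact: ltnW].
      by exists q => //; rewrite h.
    apply: cov; rewrite !refine_timeE// mul0r mul0r addr0.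
    by rewrite divff ?pnatr_eq0// mul1r (addrC (si_time J k)) subrK.
  have /andP[j1 j2] := hj; exists (refine_time (k * m.+1 + j)).
    by rewrite refine_time_ge0 ltW.
  left; split.
    have h := refine_step k jm.
    have h2 : (si_time J k.+1 - si_time J k) / m.+1%:R <= L / m.+1%:R.
      by rewrite ler_pM2r ?invr_gt0//; exact: hL.
    by move: h2; rewrite -h; move: (L / _) => q ?; lra.
  rewrite (si_process_in w kJ hk).
  have iJ : (k * m.+1 + j < si_size refine)%N.
    rewrite /=; apply: (@leq_trans (k.+1 * m.+1)); last by rewrite leq_pmul2r.
    by rewrite mulSnr ltn_add2l.
  have hi : si_time refine (k * m.+1 + j) < s <= si_time refine (k * m.+1 + j).+1.
    by rewrite /= -addnS.
  by rewrite (si_process_in w iJ hi) /= /refine_coef divnMDl// divn_small// addn0.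
exists s; first by rewrite lexx ltW.
right; split=> //; rewrite !si_process_out ?mul0r// => i iJ; apply/negP => hi.
  by apply: hn; exists i.
apply: hn; exists (i %/ m.+1)%N; first by rewrite ltn_divLR.
have /andP[i1 i2] := hi; apply/andP; split; first exact: le_lt_trans (refine_time_ge i) i1.
apply: (le_trans i2); rewrite /= {1}(divn_eq i m.+1) -addnS refine_timeE ?ltn_pmod//.
rewrite -lerBrDl ler_piMl ?subr_ge0 ?si_time_nd//.
by rewrite ler_pdivrMr// mul1r ler_nat ltn_pmod.
Qed.

Variable N : R -> Omega -> R.
Hypothesis NE : forall t w, 0 <= t -> N t w = M t w / I t w + ln (I t w) - 1.

(** On an interval of [J] the coefficient is constant, so the claim is [path_inf_sum] for the
    refined points of that interval, capped at s. Summing over the intervals costs the sum of the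
    absolute coefficients. *)
Lemma refine_integral t s om w : 0 <= s -> s <= t -> 0 <= om ->
  (forall a b, 0 <= a <= t -> 0 <= b <= t -> `|a - b| <= L / m.+1%:R -> `|M a w - M b w| <= om) ->
  `|si_integral J N s w - si_integral refine M s w| <=
  om * ((\sum_(k < si_size J) `|si_coef J k w|) * V t w).
Proof.
move=> s0 st om0 hom.
have t0 := le_trans s0 st.
rewrite /si_integral /= (sum_blocks (fun i => refine_coef i w *
  (M (Num.min (refine_time i.+1) s) w - M (Num.min (refine_time i) s) w))).
rewrite -sumrB mulr_suml mulr_sumr; apply: le_trans (ler_norm_sum _ _ _) _.
apply: ler_sum => k _; have kJ := ltn_ord k.
pose u j := Num.min (refine_time (k * m.+1 + j)) s.
have u0 j : 0 <= u j by rewrite le_min s0 refine_time_ge0.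
have us j : u j <= s by rewrite /u ge_min lexx orbT.
have uS j : u j <= u j.+1.
  rewrite /u le_min ge_min addnS refine_timeS/= ge_min lexx orbT//.
have ulen j : (j < m.+1)%N -> u j.+1 - u j <= L / m.+1%:R.
  move=> jm; have h := refine_step k jm.
  have h2 : (si_time J k.+1 - si_time J k) / m.+1%:R <= L / m.+1%:R.
    by rewrite ler_pM2r ?invr_gt0//; exact: hL.
  have h3 := refine_timeS (k * m.+1 + j); rewrite -addnS in h3.
  rewrite -h in h2; apply: le_trans h2; rewrite /u /Num.min.
  by case: (ltP (refine_time (k * m.+1 + j.+1)) s) => ?;
     case: (ltP (refine_time (k * m.+1 + j)) s) => ?; lra.
have inner : \sum_(j < m.+1) refine_coef (k * m.+1 + j) w *
    (M (Num.min (refine_time (k * m.+1 + j).+1) s) w - M (Num.min (refine_time (k * m.+1 + j)) s) w) =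
    si_coef J k w * \sum_(j < m.+1) (M (u j.+1) w - M (u j) w) / I (u j) w.
  rewrite mulr_sumr; apply: eq_bigr => j _; rewrite -addnS -/(u j) -/(u j.+1).
  rewrite /refine_coef divnMDl// divn_small// addn0 -mulrA; congr (_ * _).
  (* At refined times beyond s the factor 1/I is read at s instead, which is harmless since the
     increment of M is zero. *)
  have [h|h] := leP (refine_time (k * m.+1 + j)) s.
    by rewrite /u (min_idPl h) /V mulrC.
  have e1 : u j = s by rewrite /u; apply/min_idPr; exact: ltW.
  have e2 : u j.+1 = s.
    by apply/le_anti; rewrite us/= -[leLHS]e1 uS.
  by rewrite e1 e2 subrr mulr0 mul0r.
rewrite inner -mulrBr normrM -mulrCA mulrA -mulrA; apply: ler_wpM2l => //.
have ul : u m.+1 = Num.min (si_time J k.+1) s.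
  by rewrite /u refine_timeE// divff ?pnatr_eq0// mul1r (addrC (si_time J k)) subrK.
have uf : u 0%N = Num.min (si_time J k) s.
  by rewrite /u refine_timeE// mul0r mul0r addr0.
rewrite -ul -uf !NE// distrC.
have := @path_inf_sum _ (M ^~ w) (@cM w) (fun t t0 => M_gt0 w t0) u m.+1 om (u0 0%N) uS.
rewrite -/(I _ _) -/(I _ _); set S := \sum_(_ < _) _ => h.
rewrite (_ : S - _ = S - (M (u m.+1) w / I (u m.+1) w + ln (I (u m.+1) w) -
   (M (u 0%N) w / I (u 0%N) w + ln (I (u 0%N) w)))); last by ring.
apply: le_trans (h _) _.
  move=> j jm a b /andP[a1 a2] /andP[b1 b2]; apply: hom.
  - by rewrite (le_trans (u0 j) a1)/= (le_trans a2)// (le_trans (us _)).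
  - by rewrite (le_trans (u0 j) b1)/= (le_trans b2)// (le_trans (us _)).
  - move: (ulen j jm) a1 a2 b1 b2; move: (u j) (u j.+1) (L / _) => x y q *.
    by rewrite ler_norml; apply/andP; split; lra.
rewrite ler_wpM2l// lerBlDr -[leLHS]addr0 lerD//.
  by apply: V_mono => //; exact: le_trans (us _) st.
by apply: ltW; exact: V_gt0.
Qed.

End Refine.

Variables (H N U : R -> Omega -> R).
Hypothesis NE : forall t w, 0 <= t -> N t w = M t w / I t w + ln (I t w) - 1.
Hypothesis HE : forall t w, 0 <= t -> H t w = I t w / M t w.
Hypothesis aH : adapted F H.
Hypothesis cH : sure_continuous H.
Hypothesis aN : adapted F N.
Hypothesis cN : sure_continuous N.
Hypothesis aU : adapted F U.
Hypothesis cU : sure_continuous U.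

Let aW : adapted F (fun t w => (M t w)^-1).
Proof. by move=> t t0; apply: (rvV (filt_sigma usualF t0)); exact: aM. Qed.

Let cW : sure_continuous (fun t w => (M t w)^-1).
Proof. by move=> w; apply: cpathV => // t t0; rewrite gt_eqF// M_gt0. Qed.

Lemma max_length (J : simple_integrand F) : exists2 L, 0 <= L &
  forall k, (k < si_size J)%N -> si_time J k.+1 - si_time J k <= L.
Proof.
exists (\sum_(k < si_size J) (si_time J k.+1 - si_time J k)).
  by apply: sumr_ge0 => k _; rewrite subr_ge0 si_time_nd.
move=> k kJ; rewrite (bigD1 (Ordinal kJ))//= lerDl.
by apply: sumr_ge0 => i _; rewrite subr_ge0 si_time_nd.
Qed.

(** Off a small event the random factor of [refine_integral] is at most K, so it suffices that M
    oscillates by at most e/K over a refined step. This also makes the refined steps short. *)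
Lemma exists_refinement (J : simple_integrand F) t e eta : 0 <= t -> 0 < e -> 0 < eta ->
  exists m L, [/\ forall k, (k < si_size J)%N -> si_time J k.+1 - si_time J k <= L,
    L / m.+1%:R <= e & exists B, [/\ measurable B, (P B <= eta%:E)%E &
    forall w, ~ B w -> forall s, 0 <= s <= t ->
      `|si_integral J N s w - si_integral (refine J m) M s w| <= e]].
Proof.
move=> t0 e0 eta0; have [L L0 hL] := max_length J.
have eta2 : 0 < eta / 2 by rewrite divr_gt0.
pose C w := (\sum_(k < si_size J) `|si_coef J k w|) * V t w.
have mC : measurable_fun setT C.
  apply: measurable_funM; last exact: (adapted_mfun usualF aV).
  apply: measurable_sum => k; apply: measurable_norm.
  exact: (rv_mfun (filt_meas usualF (si_time_nneg J k)) (si_coef_meas J k)).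
have [K K0 PK] := measurable_tight mC eta2.
have eK : 0 < e / K by rewrite divr_gt0.
have [dl d0 [B [mB PB hB]]] := modulus_prob P (fun q q0 => adapted_mfun usualF aM q0) cM t0 eK eta2.
have de0 : 0 < Num.min dl e by rewrite lt_min d0.
have [m hm] : exists m : nat, L / m.+1%:R <= Num.min dl e.
  exists (Num.truncn (L / Num.min dl e)).
  by rewrite ler_pdivrMr// mulrC -ler_pdivrMr// ltW// truncnS_gt.
exists m, L; split=> //; first by rewrite (le_trans hm)// ge_min lexx orbT.
exists (B `|` [set w | K < C w]); split.
- by apply: measurableU => //; exact: measurable_lt.
- have mKC : measurable [set w | K < C w] by exact: measurable_lt.
  apply: le_trans (measureU2 _ mB mKC) _.
  by rewrite [eta]splitr EFinD leeD.
move=> w /not_orP[wB wK] s /andP[s0 st].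
apply: le_trans (refine_integral hL NE s0 st (ltW eK) _) _.
  move=> a b ha hb hab; apply: (hB w wB) => //.
  by rewrite (le_trans hab)// (le_trans hm)// ge_min lexx.
have CK : C w <= K by rewrite leNgt; exact/negP.
apply: le_trans (ler_wpM2l (ltW eK) CK) _.
by rewrite mulfVK// gt_eqF.
Qed.

(** A sequence approximating I/M is divided by I, after refinement, into a sequence approximating
    1/M. The integrals of the latter against M tend to U, and they differ little from those of the
    former against N. *)
Lemma ucp_integral_excess (J : nat -> simple_integrand F) :
  (forall J : nat -> simple_integrand F,
    ucp_cvg P (fun n => si_process (J n)) (fun t w => (M t w)^-1) ->
    ucp_cvg P (fun n => si_integral (J n) M) U) ->
  ucp_cvg P (fun n => si_process (J n)) H -> ucp_cvg P (fun n => si_integral (J n) N) U.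
Proof.
move=> hU hJ.
(* The n-th integrand is refined to precision 1/(n+1), off an event of probability 1/(n+1), up to
   the horizon n. *)
have /choice[mL hm] : forall n : nat, exists mL : nat * R,
    [/\ forall k, (k < si_size (J n))%N -> si_time (J n) k.+1 - si_time (J n) k <= mL.2,
    mL.2 / mL.1.+1%:R <= n.+1%:R^-1 & exists B, [/\ measurable B, (P B <= (n.+1%:R^-1)%:E)%E &
    forall w, ~ B w -> forall s, 0 <= s <= n%:R ->
      `|si_integral (J n) N s w - si_integral (refine (J n) mL.1) M s w| <= n.+1%:R^-1]].
  move=> n; have n0 : 0 < n.+1%:R^-1 :> R by rewrite invr_gt0.
  have [m [L h]] := exists_refinement (J n) (ler0n R n) n0 n0.
  by exists (m, L).
pose Jp n := refine (J n) (mL n).1.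
have harm e : 0 < e -> \forall n \near \oo, n.+1%:R^-1 <= e :> R.
  move=> e0; have /cvgrPdist_le/(_ _ e0) := @cvg_harmonic R.
  by apply: filterS => n /=; rewrite sub0r normrN ger0_norm// invr_ge0.
have mSJ n r e : measurable (sup_event (fun s w => si_process (J n) s w - H s w) r e).
  exact: (measurable_sup_si_process usualF).
have sJ := (ucp_smallP P mSJ).1 hJ.
have hp : ucp_cvg P (fun n => si_process (Jp n)) (fun t w => (M t w)^-1).
  apply/(ucp_smallP P).
    by move=> n r e; exact: (measurable_sup_si_process usualF).
  move=> t e t0 e0 eta eta0.
  have eta2 : 0 < eta / 2 by rewrite divr_gt0.
  have eta4 : 0 < eta / 2 / 2 by rewrite divr_gt0.
  have e2 : 0 < e / 2 by rewrite divr_gt0.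
  have [K K0 PK] := measurable_tight (adapted_mfun usualF aV t0) eta4.
  have mK : measurable [set w | K < V t w].
    by apply: measurable_lt => //; exact: (adapted_mfun usualF aV).
  have [dl d0 [B [mB PB hB]]] := modulus_prob P (fun q q0 => adapted_mfun usualF aV q0) cV t0 e2 eta4.
  have [n0 hn0] := sJ t _ t0 (divr_gt0 e2 K0) _ eta2.
  have [n1 _ hn1] := harm _ d0.
  exists (maxn n0 n1) => n; rewrite geq_max => /andP[/hn0[B2 [mB2 SB2 PB2]] /hn1 dn].
  exists (([set w | K < V t w] `|` B) `|` B2); split; last 1 first.
  - have mKB : measurable ([set w | K < V t w] `|` B) by exact: measurableU.
    apply: le_trans (measureU2 _ mKB mB2) _.
    rewrite [eta]splitr EFinD leeD//.
    apply: le_trans (measureU2 _ mK mB) _.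
    by rewrite [eta / 2]splitr EFinD leeD.
  - by apply: measurableU => //; exact: measurableU.
  move=> w [s /andP[s0 st] es]; apply: contrapT => /not_orP[/not_orP[wK wB] wB2].
  have [hL hLn _] := hm n.
  have Js : `|si_process (J n) s w - H s w| <= e / 2 / K.
    rewrite leNgt; apply/negP => h; apply: wB2; apply: SB2; exists s => //.
    by rewrite s0.
  have VK : V t w <= K by rewrite leNgt; exact/negP.
  have [r /andP[r0 rs] hr] := refine_process (mL n).1 hL w s0.
  have [sr eq] : `|s - r| <= dl /\ si_process (Jp n) s w = si_process (J n) s w * V r w.
    case: hr => -[h1 h2]; split=> //.
      by rewrite ger0_norm ?subr_ge0// (le_trans h1)// (le_trans hLn).
    by rewrite h1 subrr normr0 ltW.
  have H1 : `|H s w| <= 1.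
    have i0 := I_gt0 w (ltW s0); have m0 := M_gt0 w (ltW s0).
    rewrite HE ?(ltW s0)// ger0_norm; last by rewrite divr_ge0// ltW.
    by rewrite ler_pdivrMr// mul1r; apply: I_le_M; exact: ltW.
  have Vrs : `|V s w - V r w| <= e / 2.
    by apply: (hB w wB) => //; [rewrite (ltW s0)|rewrite r0 (le_trans rs)].
  have Vr : 0 <= V r w <= K.
    by rewrite ltW ?V_gt0//= (le_trans _ VK)// V_mono// (le_trans rs).
  have eM : (M s w)^-1 = H s w * V s w.
    rewrite HE ?(ltW s0)// /V mulrAC divff ?mul1r// gt_eqF// I_gt0// ltW//.
  move: es; rewrite eq eM ltNge => /negP; apply.
  (* Two errors: that of [J n], multiplied by 1/I <= K, and the variation of 1/I between r and s,
     multiplied by H <= 1. *)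
  rewrite (_ : _ - _ = (si_process (J n) s w - H s w) * V r w - H s w * (V s w - V r w)); last by ring.
  have /andP[Vr0 VrK] := Vr.
  apply: le_trans (ler_normB _ _) _; rewrite [e]splitr; apply: lerD.
    rewrite normrM (ger0_norm Vr0); apply: (@le_trans _ _ (e / 2 / K * K)).
      by apply: ler_pM.
    by rewrite mulfVK// gt_eqF.
  rewrite normrM; apply: le_trans (ler_piMl _ H1) Vrs; exact: normr_ge0.
have mSp n r e : measurable (sup_event (fun s w => si_integral (Jp n) M s w - U s w) r e).
  exact: (measurable_sup_si_integral usualF).
have sp := (ucp_smallP P mSp).1 (hU _ hp).
apply/(ucp_smallP P).
  by move=> n r e; exact: (measurable_sup_si_integral usualF).
move=> t e t0 e0 eta eta0.
have eta2 : 0 < eta / 2 by rewrite divr_gt0.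
have e2 : 0 < e / 2 by rewrite divr_gt0.
have [n0 hn0] := sp t _ t0 e2 _ eta2.
have [n1 _ hn1] := harm _ e2.
have [n2 _ hn2] := harm _ eta2.
(* The refinement of index n controls the paths up to time n only. *)
have [n3 hn3] : exists n : nat, t <= n%:R by exists (Num.truncn t).+1; apply/ltW/truncnS_gt.
exists (maxn (maxn n0 n1) (maxn n2 n3)) => n; rewrite !geq_max.
move=> /andP[/andP[/hn0[B2 [mB2 SB2 PB2]] /hn1 h1] /andP[/hn2 h2 h3]].
have [_ _ [B [mB PB hB]]] := hm n.
exists (B `|` B2); split; [exact: measurableU| |]; last first.
  apply: le_trans (measureU2 _ mB mB2) _.
  by rewrite [eta]splitr EFinD leeD// (le_trans PB)// lee_fin.
move=> w [s /andP[s0 st] es]; apply: contrapT => /not_orP[wB wB2].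
have b1 : `|si_integral (Jp n) M s w - U s w| <= e / 2.
  rewrite leNgt; apply/negP => h; apply: wB2; apply: SB2; exists s => //.
  by rewrite s0.
have b2 : `|si_integral (J n) N s w - si_integral (Jp n) M s w| <= e / 2.
  apply: le_trans h1; apply: hB => //.
  by rewrite ltW//= (le_trans st)// (le_trans hn3)// ler_nat.
move: es; rewrite ltNge => /negP; apply.
rewrite (_ : _ - _ = (si_integral (J n) N s w - si_integral (Jp n) M s w) + (si_integral (Jp n) M s w - U s w)); last by ring.
by rewrite (le_trans (ler_normD _ _))// [e]splitr lerD.
Qed.

End Refinement.

(** * Reducing sequences of stopping times *)

Section Completeness.
Context {R : realType} {d} {Omega : measurableType d} (P : probability Omega R).
Variable F : R -> set (set Omega).
Hypothesis usualF : usual_filtration P F.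

Lemma measurable_fun_ae_eq d' (S : measurableType d') (f g : Omega -> S) (N : set Omega) :
  P.-negligible N -> (forall w, ~ N w -> f w = g w) ->
  measurable_fun setT f -> measurable_fun setT g.
Proof.
move=> nN fg mf _ B mB; rewrite setTI.
have mfB : measurable (f @^-1` B) by rewrite -[X in measurable X]setTI; exact: mf.
have [] // := measure_ae_eq usualF nN mfB (S' := g @^-1` B).
by move=> w /fg e; rewrite /preimage /= e.
Qed.

Lemma integral_ae_eq (f g : Omega -> \bar R) (N : set Omega) :
  P.-negligible N -> (forall w, ~ N w -> f w = g w) -> measurable_fun setT f ->
  (\int[P]_w f w = \int[P]_w g w)%E.
Proof.
move=> nN fg mf; apply: ae_eq_integral => //.
  exact: measurable_fun_ae_eq nN fg mf.
by apply: negligibleS nN => w /= h; apply: contrapT => /fg e; exact: h.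
Qed.

Lemma Lone_ae_eq (f g : Omega -> R) (N : set Omega) : P.-negligible N ->
  (forall w, ~ N w -> f w = g w) -> Lone P f -> Lone P g.
Proof.
move=> nN fg If; have mf := Lone_meas If; have mg := measurable_fun_ae_eq nN fg mf.
have /integrableP[_ h] := If; apply/integrableP; split; first exact/measurable_EFinP.
rewrite -(@integral_ae_eq (fun w => `|(f w)%:E|%E) (fun w => `|(g w)%:E|%E) N)//.
- by move=> w /fg ->.
- exact/measurableT_comp/measurable_EFinP.
Qed.

Lemma integral_ae_eq_EFin E (f g : Omega -> R) (N : set Omega) : P.-negligible N ->
  (forall w, ~ N w -> f w = g w) -> measurable E -> Lone P f ->
  (\int[P]_(w in E) (f w)%:E = \int[P]_(w in E) (g w)%:E)%E.
Proof.
move=> nN fg mE If; have mf := Lone_meas If; have mg := measurable_fun_ae_eq nN fg mf.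
apply: ae_eq_integral => //.
- by apply/measurable_EFinP; exact: measurable_funTS.
- by apply/measurable_EFinP; exact: measurable_funTS.
apply: negligibleS nN => w /= h; apply: contrapT => /fg e; apply: h => _.
by rewrite e.
Qed.

Lemma Ex_ae_eq (f g : Omega -> R) (N : set Omega) : P.-negligible N ->
  (forall w, ~ N w -> f w = g w) -> Lone P f -> Ex P f = Ex P g.
Proof.
move=> nN fg If; have Ig := Lone_ae_eq nN fg If.
by apply: EFin_inj; rewrite -!ExE//; exact: (integral_ae_eq_EFin nN).
Qed.

Lemma Ex_sq_eq0 f : Lone P (fun w => f w ^+ 2) -> measurable_fun setT f ->
  Ex P (fun w => f w ^+ 2) = 0 -> P.-negligible [set w | f w != 0].
Proof.
move=> I2 mf E0.
have : (\int[P]_w `|(f w ^+ 2)%:E| = 0)%E.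
  rewrite (eq_integral (fun w => (f w ^+ 2)%:E)).
    by rewrite ExE// E0.
  by move=> w _; rewrite abse_EFin ger0_norm// sqr_ge0.
have mf2 : measurable_fun setT (fun w => (f w ^+ 2)%:E).
  by apply/measurable_EFinP/measurable_funX.
move=> /(ae_eq_integral_abs P measurableT mf2) h; apply: negligibleS h => w /= fw0 h.
have := h I; rewrite /= => -[] /eqP; rewrite sqrf_eq0; exact/negP.
Qed.

End Completeness.

(** Meant for a = A, increasing, and l = log I, decreasing: the variation of A + log I is controlled
    by the increments of A - log I. *)
Lemma dist_add_le_sub (R : realType) (a a' l l' : R) : a <= a' -> l' <= l ->
  `|a' + l' - (a + l)| <= a' - l' - (a - l).
Proof. by move=> aa ll; rewrite ler_norml; apply/andP; split; lra. Qed.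

(* The inequalities stand for E U_T^2 = -2 E log M_T. *)
Record reducing {R : realType} {d} {Omega : measurableType d} (P : probability Omega R)
    (F : R -> set (set Omega)) (M X U : R -> Omega -> R) (T : nat -> Omega -> \bar R) : Prop := {
  reducing_stopping : forall k, stopping_time F (T k);
  reducing_eventually : forall t w, 0 <= t -> \forall k \near \oo, (t%:E <= T k w)%E;
  reducing_M : forall k, martingale P F (stopped M (T k));
  reducing_U : forall k, martingale P F (stopped U (T k));
  reducing_U_sq : forall k t, 0 <= t -> Lone P (fun w => stopped U (T k) t w ^+ 2);
  reducing_ln : forall k t, 0 <= t -> Lone P (fun w => ln (stopped M (T k) t w));
  reducing_X : forall k t, 0 <= t -> Lone P (stopped X (T k) t);
  reducing_inf : forall k t, 0 <= t ->
    Lone P (fun w => - ln (path_inf (M ^~ w) (capped (T k) t w)));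
  reducing_excess : forall k t, 0 <= t -> Ex P (stopped X (T k) t) =
    Ex P (fun w => - ln (path_inf (M ^~ w) (capped (T k) t w)));
  reducing_sq_le : forall k t, 0 < t ->
    Ex P (fun w => stopped U (T k) t w ^+ 2) <= 8 * - Ex P (fun w => ln (stopped M (T k) t w));
  reducing_ln_le : forall k t, 0 < t ->
    - Ex P (fun w => ln (stopped M (T k) t w)) <= 2 * Ex P (fun w => stopped U (T k) t w ^+ 2) }.

(** * One localizing sequence for M, X, N and U *)

Section Core.
Context {R : realType} {d} {Omega : measurableType d} (P : probability Omega R).
Variable F : R -> set (set Omega).
Hypothesis usualF : usual_filtration P F.
Variables M X N U : R -> Omega -> R.
Hypothesis aM : adapted F M.
Hypothesis cM : sure_continuous M.
Hypothesis M_gt0 : forall t w, 0 <= t -> 0 < M t w.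
Hypothesis M0 : forall w, M 0 w = 1.
Hypothesis locM : localizable P F M.
Hypothesis aX : adapted F X.
Hypothesis cX : sure_continuous X.
Hypothesis XE : forall t w, 0 <= t -> X t w = M t w / path_inf (M ^~ w) t - 1.
Hypothesis aN : adapted F N.
Hypothesis cN : sure_continuous N.
Hypothesis aU : adapted F U.
Hypothesis cU : sure_continuous U.
Hypothesis U0 : forall w, U 0 w = 0.
Hypothesis hU : forall J : nat -> simple_integrand F,
  ucp_cvg P (fun n => si_process (J n)) (fun t w => (M t w)^-1) ->
  ucp_cvg P (fun n => si_integral (J n) M) U.

Let I t w := path_inf (M ^~ w) t.

Lemma inf_gt0 t w : 0 <= t -> 0 < I t w.
Proof. by move=> t0; apply: path_inf_gt0 => // s s0; exact: M_gt0. Qed.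

Lemma inf_le t s w : 0 <= s -> s <= t -> I t w <= M s w.
Proof. by move=> s0 st; apply: path_inf_le => [r|]; [exact: M_gt0|rewrite s0]. Qed.

Lemma excess_ge0 t w : 0 <= t -> 0 <= X t w.
Proof.
move=> t0; rewrite XE// subr_ge0 ler_pdivlMr ?inf_gt0// mul1r.
exact: inf_le.
Qed.

(** Adaptedness and continuity of I are read off this formula from those of M and X. *)
Let infE t w : 0 <= t -> I t w = M t w / (1 + X t w).
Proof.
move=> t0; rewrite XE// (addrC 1) subrK invf_div mulrCA divff ?mulr1//.
by rewrite gt_eqF// M_gt0.
Qed.

Lemma adapted_inf : adapted F I.
Proof.
move=> t t0; have sg := filt_sigma usualF t0.
rewrite (_ : I t = fun w => M t w * (1 + X t w)^-1); last by apply/funext => w; rewrite infE.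
apply: (rvM sg); first exact: aM.
by apply: (rvV sg); apply: (rvD sg); [exact: (rv_cst sg)|exact: aX].
Qed.

Lemma continuous_inf : sure_continuous I.
Proof.
move=> w; apply: (@eq_cpath _ (fun t => M t w * (1 + X t w)^-1)).
  by move=> t t0; rewrite infE.
apply: cpathM; first exact: cM.
apply: cpathV.
  by move=> t t0; rewrite gt_eqF// ltr_wpDr// excess_ge0.
by apply: cpathD; [exact: cpath_cst|exact: cX].
Qed.

(** A bound on this one process bounds M, 1/M, N and U simultaneously. *)
Let G t w := (M t w + (M t w)^-1) + (`|N t w| + `|U t w|).

Let aG : adapted F G.
Proof.
move=> t t0; have sg := filt_sigma usualF t0.
apply: (rvD sg).
  by apply: (rvD sg); [exact: aM|apply: (rvV sg); exact: aM].
by apply: (rvD sg); apply: (rv_norm sg); [exact: aN|exact: aU].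
Qed.

Let cG : sure_continuous G.
Proof.
move=> w; apply: cpathD.
  apply: cpathD; first exact: cM.
  by apply: cpathV; [move=> t t0; rewrite gt_eqF// M_gt0|exact: cM].
by apply: cpathD; apply: cpath_norm; [exact: cN|exact: cU].
Qed.

Hypothesis N0 : forall w, N 0 w = 0.

(** The levels start at 2 because G starts at 1 + 1 and a hitting time bounds the process only if it
    starts below the level. *)
Let T (k : nat) := hitting G k.+2%:R.
Let c (k : nat) : R := k.+2%:R.

Let sT k : stopping_time F (T k). Proof. exact: (hitting_stopping usualF). Qed.

Let T_ge0 k w : (0 <= T k w)%E. Proof. exact: (sT k).1. Qed.

Let G_bound k t w : 0 <= t -> (t%:E <= T k w)%E -> G t w <= c k.
Proof.
move=> t0 tT; apply: (hitting_bound cG) tT => //.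
rewrite /G M0 N0 U0 invr1 normr0 !addr0 /c -[in leRHS]addn2 natrD.
by rewrite lerDr.
Qed.

Let bounds k t w : 0 <= t -> (t%:E <= T k w)%E ->
  [/\ M t w <= c k, (M t w)^-1 <= c k, `|N t w| <= c k & `|U t w| <= c k].
Proof.
move=> t0 tT; have := G_bound t0 tT; rewrite /G.
have m0 := M_gt0 w t0; have mV : 0 < (M t w)^-1 by rewrite invr_gt0.
have n0 := normr_ge0 (N t w); have u0 := normr_ge0 (U t w).
by move=> h; split; lra.
Qed.

Let boundsM k t w : 0 <= t -> (t%:E <= T k w)%E -> M t w <= c k /\ (M t w)^-1 <= c k.
Proof. by move=> t0 tT; have [] := bounds t0 tT. Qed.

Let boundsMU k t w : 0 <= t -> (t%:E <= T k w)%E ->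
  [/\ M t w <= c k, (M t w)^-1 <= c k & `|U t w| <= c k].
Proof. by move=> t0 tT; have [] := bounds t0 tT. Qed.

Let T_eventually t w : 0 <= t -> \forall k \near \oo, (t%:E <= T k w)%E.
Proof.
move=> t0; have [n _ h] := hitting_eventually cG w t0.
by exists n => // k nk; apply: h => /=; apply: leq_trans nk _; rewrite -addn2 leq_addr.
Qed.

Let stopped_eventually Z t w : 0 <= t -> \forall k \near \oo, stopped Z (T k) t w = Z t w.
Proof.
move=> t0; have := T_eventually w t0; apply: filterS => k h.
by rewrite /stopped -/(capped (T k) t w) capped_ge.
Qed.

Let mMT k : martingale P F (stopped M (T k)).
Proof.
apply: (localizable_stopped usualF aM cM locM (sT k) (c := c k)) => t w t0 tT.
by have [h _] := boundsM t0 tT; rewrite ger0_norm// ltW// M_gt0.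
Qed.

Let L := log_excess M.

Let aL : adapted F L.
Proof. by apply: (adapted_log_excess usualF); [exact: aM|exact: adapted_inf]. Qed.

Let cL : sure_continuous L.
Proof. by apply: continuous_log_excess; [exact: cM|exact: M_gt0|exact: continuous_inf]. Qed.

Let L_bound k t w : 0 <= t -> (t%:E <= T k w)%E -> `|L t w| <= c k * c k + c k.
Proof. by apply: log_excess_bound; [exact: cM|exact: M_gt0|exact: boundsM]. Qed.

Let mLT k : martingale P F (stopped L (T k)).
Proof.
by apply: (martingale_log_excess usualF aM cM M_gt0 adapted_inf continuous_inf (sT k) (boundsM (k := k))).
Qed.

Let LE t w : 0 <= t -> L t w = 1 + X t w + ln (I t w).
Proof. by move=> t0; rewrite /L /log_excess XE//; ring. Qed.

Let L0 w : L 0 w = 1.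
Proof. by rewrite /L /log_excess path_inf0// M0 divr1 ln1 addr0. Qed.

Let stop_point k t w : 0 <= t -> 0 <= capped (T k) t w <= t.
Proof. by move=> t0; exact: capped_itv. Qed.

Let stop_bounds k t w : 0 <= t ->
  [/\ 0 <= capped (T k) t w, M (capped (T k) t w) w <= c k, (M (capped (T k) t w) w)^-1 <= c k,
     `|N (capped (T k) t w) w| <= c k & `|U (capped (T k) t w) w| <= c k].
Proof.
move=> t0; have /andP[h _] := stop_point k w t0.
by have [] := bounds h (capped_leT t0 (T_ge0 k w)).
Qed.

Let inf_bound k t w : 0 <= t -> 0 <= - ln (I (capped (T k) t w) w) <= c k.
Proof.
move=> t0; have /andP[c0 ct] := stop_point k w t0.
have i0 := inf_gt0 w c0.
have [s /andP[s0 st] e] := path_inf_attained (@cM w) c0.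
have [_ h] : M s w <= c k /\ (M s w)^-1 <= c k.
  apply: boundsM => //; apply: le_trans (capped_leT t0 (T_ge0 k w)).
  by rewrite lee_fin.
rewrite -/(I _ w) in e; rewrite -e in h.
have iV : 0 < (I (capped (T k) t w) w)^-1 by rewrite invr_gt0.
have := ln_le_sub1 iV; rewrite lnV// => h2; apply/andP; split; last by lra.
by rewrite oppr_ge0 ln_le0// (le_trans (inf_le w (lexx 0) c0))// M0.
Qed.

Let Lone_X k t : 0 <= t -> Lone P (stopped X (T k) t).
Proof.
move=> t0; apply: (@Lone_bdd _ _ _ _ (c k * c k + c k + (1 + c k))).
  exact: (adapted_mfun usualF (adapted_stopped usualF aX cX (sT k))).
move=> w; have /andP[c0 ct] := stop_point k w t0.
have h := L_bound c0 (capped_leT t0 (T_ge0 k w)).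
have /andP[i0 i1] := inf_bound k w t0.
rewrite /stopped -/(capped (T k) t w).
have -> : X (capped (T k) t w) w = L (capped (T k) t w) w + (- 1 - ln (I (capped (T k) t w) w)).
  by rewrite LE//; ring.
apply: le_trans (ler_normD _ _) _; apply: lerD => //.
by rewrite ler_norml; apply/andP; split; lra.
Qed.

Let Lone_I k t : 0 <= t -> Lone P (fun w => - ln (I (capped (T k) t w) w)).
Proof.
move=> t0; apply: (@Lone_bdd _ _ _ _ (c k)).
  apply: measurable_funN; apply: measurableT_comp => //.
  exact: (adapted_mfun usualF (adapted_stopped usualF adapted_inf continuous_inf (sT k))).
by move=> w; have /andP[i0 i1] := inf_bound k w t0; rewrite ger0_norm.
Qed.

(** The process L = 1 + X + log I, once stopped, is a martingale starting from 1. *)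
Lemma Ex_excess_inf k t : 0 <= t ->
  Ex P (stopped X (T k) t) = Ex P (fun w => - ln (I (capped (T k) t w) w)).
Proof.
move=> t0; have [_ IL h] := (martingaleP usualF _).1 (mLT k).
have := h 0 t setT (lexx 0) t0 (sigmaT (filt_sigma usualF (lexx 0))).
rewrite (_ : (fun w => _) = fun=> 1); last first.
  apply/funext => w; rewrite indicT mul1r /stopped -/(capped (T k) 0 w).
  by rewrite capped_ge.
rewrite Ex_cst => e1.
have e2 : Ex P (fun w => stopped L (T k) t w - 1) = 0.
  rewrite ExB; [|exact: IL|exact: Lone_cst].
  rewrite Ex_cst [X in _ - X]e1; apply/eqP; rewrite subr_eq0; apply/eqP/eq_Ex => w.
  by rewrite indicT mul1r.
apply/eqP; rewrite -subr_eq0 -ExB; [|exact: Lone_X|exact: Lone_I].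
rewrite -[X in _ == X]e2; apply/eqP/eq_Ex => w.
have /andP[c0 _] := stop_point k w t0.
by rewrite /stopped -/(capped (T k) t w) LE//; ring.
Qed.

(** * Uniqueness of the decomposition of X *)

Section Decomposition.
Variable A : R -> Omega -> R.
Hypothesis locN : localizable P F N.
Hypothesis XNA : forall t w, 0 <= t -> X t w = N t w + A t w.
Hypothesis A_mono : forall s t w, 0 <= s -> s <= t -> A s w <= A t w.
Hypothesis A0 : forall w, A 0 w = 0.

Let mNT k : martingale P F (stopped N (T k)).
Proof.
apply: (localizable_stopped usualF aN cN locN (sT k) (c := c k)) => t w t0 tT.
by have [] := bounds t0 tT.
Qed.

Let D t w := L t w - 1 - N t w.

Let DE t w : 0 <= t -> D t w = A t w + ln (I t w).
Proof. by move=> t0; rewrite /D LE// XNA//; ring. Qed.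

(** The stopped D = L - 1 - N is a bounded martingale, and as D = A + log I its increments are
    dominated by those of the bounded increasing process A - log I; its second moment therefore
    vanishes. *)
Let stopped_D_zero k t : 0 <= t -> P.-negligible [set w | stopped D (T k) t w != 0].
Proof.
move=> t0.
have [aLT ILT hLT] := (martingaleP usualF _).1 (mLT k).
have [aNT INT hNT] := (martingaleP usualF _).1 (mNT k).
have DTE s w : stopped D (T k) s w = (stopped L (T k) s w - 1) - stopped N (T k) s w by [].
have ID s : 0 <= s -> Lone P (stopped D (T k) s).
  by move=> s0; apply: LoneB; [apply: LoneB; [exact: ILT|exact: Lone_cst]|exact: INT].
have mD : martingale P F (stopped D (T k)).
  apply/(martingaleP usualF); split.
  - move=> s s0; have sg := filt_sigma usualF s0; apply: (rvB sg); last exact: aNT.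
    by apply: (rvB sg); [exact: aLT|exact: (rv_cst sg)].
  - exact: ID.
  move=> s r E s0 sr FE; have r0 := le_trans s0 sr; have mE := filt_meas usualF s0 FE.
  have I1 f : Lone P f -> Lone P (fun w => \1_E w * f w).
    by move=> If; exact: LoneM_bdd If (measurable_indic mE) (abs_indic_le1 E).
  have ex q : 0 <= q -> Ex P (fun w => \1_E w * stopped D (T k) q w) =
      Ex P (fun w => \1_E w * stopped L (T k) q w) - Ex P (fun w => \1_E w * 1) -
      Ex P (fun w => \1_E w * stopped N (T k) q w).
    move=> q0; rewrite -ExB; [|exact/I1/ILT|exact/I1/Lone_cst].
    rewrite -ExB; [|by apply: LoneB; [exact/I1/ILT|exact/I1/Lone_cst]|exact/I1/INT].
    by apply: eq_Ex => w; rewrite DTE; ring.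
  by rewrite (ex s s0) (ex r r0) (hLT s r E s0 sr FE) (hNT s r E s0 sr FE).
(* One bound for D and for A - log I: the first two terms bound L, the parenthesis contains the
   constant 1, and N and log I account for the multiples of c k. *)
pose B := c k * c k + c k + (1 + c k) + c k + c k.
have ck0 : 0 <= c k by [].
have Dc s w : 0 <= s -> `|stopped D (T k) s w| <= B.
  move=> s0; have /andP[c0 _] := stop_point k w s0.
  have h := L_bound c0 (capped_leT s0 (T_ge0 k w)).
  have [_ _ _ hN _] := stop_bounds k w s0.
  rewrite DTE /stopped -/(capped (T k) s w) /B.
  apply: le_trans (ler_normB _ _) _.
  have := ler_normB (L (capped (T k) s w) w) 1; rewrite normr1.
  by lra.
pose V s w := A (capped (T k) s w) w - ln (I (capped (T k) s w) w).
have Vc s w : 0 <= s -> `|V s w| <= B.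
  move=> s0; have /andP[c0 _] := stop_point k w s0.
  have /andP[i0 i1] := inf_bound k w s0.
  have := Dc s w s0; rewrite {1}/stopped -/(capped (T k) s w) DE// => h.
  have a0 : 0 <= A (capped (T k) s w) w by rewrite -(A0 w) A_mono.
  have h1 : A (capped (T k) s w) w <= c k * c k + c k + (1 + c k) + c k.
    have := L_bound c0 (capped_leT s0 (T_ge0 k w)); rewrite LE// XNA// => hL.
    have [_ _ _ hN _] := stop_bounds k w s0.
    by move: hL hN; rewrite !ler_norml => /andP[_ hL] /andP[hN _]; lra.
  have e : V s w = A (capped (T k) s w) w - ln (I (capped (T k) s w) w) by [].
  have h2 : c k * c k >= 0 by rewrite mulr_ge0.
  have h3 : V s w <= B.
    have := L_bound c0 (capped_leT s0 (T_ge0 k w)); rewrite LE// XNA// => hL.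
    have [_ _ _ hN _] := stop_bounds k w s0.
    move: hL hN; rewrite !ler_norml => /andP[_ hL] /andP[hN _]; rewrite e /B.
    by move: h; rewrite ler_norml => /andP[_ h]; lra.
  by rewrite ler_norml h3 andbT (le_trans _ (_ : 0 <= _)) ?e; lra.
have DV s r w : 0 <= s -> s <= r -> `|stopped D (T k) r w - stopped D (T k) s w| <= V r w - V s w.
  move=> s0 sr; have r0 := le_trans s0 sr.
  have /andP[cs0 _] := stop_point k w s0; have /andP[cr0 _] := stop_point k w r0.
  have cc : capped (T k) s w <= capped (T k) r w by exact: capped_mono.
  rewrite {1 2}/stopped -/(capped (T k) s w) -/(capped (T k) r w) !DE// /V.
  have a1 : A (capped (T k) s w) w <= A (capped (T k) r w) w by exact: A_mono.
  have i1 : ln (I (capped (T k) r w) w) <= ln (I (capped (T k) s w) w).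
    rewrite ler_ln ?posrE ?inf_gt0//; apply: path_inf_anti => // q q0; exact: M_gt0.
  exact: dist_add_le_sub.
have D0 w : stopped D (T k) 0 w = 0.
  rewrite /stopped -/(capped (T k) 0 w) capped_ge// DE// A0 add0r.
  by rewrite /I path_inf0// M0 ln1.
have cD : sure_continuous (stopped D (T k)).
  move=> w; apply: continuous_stopped_path => //.
  by apply: cpathB; [apply: cpathB; [exact: cL|exact: cpath_cst]|exact: cN].
have E0 := bounded_variation_martingale usualF mD cD Dc D0 DV Vc t0.
apply: Ex_sq_eq0 E0; last exact: Lone_meas (ID t t0).
apply: (@Lone_bdd _ _ _ _ (B ^+ 2)); first exact/measurable_funX/Lone_meas/(ID t t0).
by move=> w; rewrite normrX ler_pXn2r ?nnegrE// ?Dc// (le_trans _ (Dc 0 w (lexx 0))).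
Qed.

(** For a fixed time and level the equality holds off a negligible set. Rational times and integer
    levels leave a single negligible set, and continuity extends the equality to all times. *)
Lemma decomposition_unique :
  {ae P, forall w, forall t, 0 <= t -> N t w = L t w - 1}.
Proof.
have nq (q : rat) : P.-negligible (\bigcup_k [set w | stopped D (T k) (Num.max 0 (ratr q)) w != 0]).
  by apply: negligible_bigcup => k; apply: stopped_D_zero; rewrite le_max lexx.
(* The rationals are enumerated by [unpickle], since the countable union is indexed by [nat]. *)
have nQ : P.-negligible (\bigcup_n (if unpickle n is Some q then
     \bigcup_k [set w | stopped D (T k) (Num.max 0 (ratr (q : rat))) w != 0] else set0)).
  apply: negligible_bigcup => n.
  by case: (unpickle n) => [q|]; [exact: nq|exact: negligible_set0].
apply: negligibleS nQ => w /= h; apply: contrapT => hn; apply: h => t t0.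
have cD : cpath (D ^~ w).
  by apply: cpathB; [apply: cpathB; [exact: cL|exact: cpath_cst]|exact: cN].
have Dq (q : rat) : D (Num.max 0 (ratr q)) w = 0.
  have q0 : 0 <= Num.max 0 (ratr q : R) by rewrite le_max lexx.
  have [k _ hk] := stopped_eventually D w q0.
  have {}hk := hk k (leqnn k); have [//|ne] := eqVneq (D (Num.max 0 (ratr q)) w) 0.
  exfalso; apply: hn; exists (pickle q); first exact: Logic.I.
  rewrite pickleK; exists k; first exact: Logic.I.
  by move: hk; rewrite /= => ->.
have D0 : D t w = 0.
  apply/eqP; rewrite -normr_eq0 eq_le normr_ge0 andbT; apply/ler_addgt0Pr => e e0.
  have [dl dl0 hd] := cpath_delta cD t0 e0.
  have tdl : t < t + dl by rewrite ltrDl.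
  have [q] := rat_in_itvoo tdl; rewrite in_itv/= => /andP[tq qt].
  have q0 : 0 <= ratr q :> R by exact: le_trans (ltW tq).
  have := hd _ q0; have := Dq q; rewrite (max_idPr q0) => ->; rewrite subr0 add0r => /(_ _)/ltW; apply.
  by rewrite ltr_distlC; apply/andP; split; lra.
by move: D0; rewrite /D => /eqP; rewrite subr_eq0 => /eqP ->.
Qed.

End Decomposition.
Let aUT k : adapted F (stopped U (T k)).
Proof. exact: (adapted_stopped usualF aU cU (sT k)). Qed.

Let UT_bound k t w : 0 <= t -> `|stopped U (T k) t w| <= c k.
Proof. by move=> t0; have [] := stop_bounds k w t0. Qed.

Let Lone_U k t : 0 <= t -> Lone P (stopped U (T k) t).
Proof.
move=> t0; apply: (@Lone_bdd _ _ _ _ (c k)); last by move=> w; exact: UT_bound.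
exact: (adapted_mfun usualF (aUT k)).
Qed.

Let mUT k : martingale P F (stopped U (T k)).
Proof.
apply/(martingaleP usualF); split; [exact: aUT|by move=> t; exact: Lone_U|].
move=> s t E s0; rewrite le_eqVlt => /predU1P[->//|st] FE.
exact: (stopped_integral_martingale usualF aM cM M_gt0 M0 aU cU U0 hU s0 st
  (sT k) (boundsMU (k := k)) (mMT k) FE).
Qed.

Let Lone_ln k t : 0 <= t -> Lone P (fun w => ln (stopped M (T k) t w)).
Proof.
move=> t0; apply: (@Lone_bdd _ _ _ _ (c k)).
  apply: measurableT_comp => //.
  exact: (adapted_mfun usualF (adapted_stopped usualF aM cM (sT k))).
move=> w; have [c0 h1 h2 _ _] := stop_bounds k w t0; rewrite /stopped -/(capped (T k) t w).
have m0 := M_gt0 w c0; move: h1 h2 m0; move: (M _ w) => m h1 h2 m0.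
have mV : 0 < m^-1 by rewrite invr_gt0.
have := ln_le_sub1 mV; have := ln_le_sub1 m0; rewrite lnV// => h3 h4.
by rewrite ler_norml; apply/andP; split; lra.
Qed.

Lemma exists_reducing : exists T, reducing P F M X U T.
Proof.
exists T; split=> [||||k t t0|||||k t t0|k t t0].
- exact: sT.
- by move=> t w; exact: T_eventually.
- exact: mMT.
- exact: mUT.
- apply: (@Lone_bdd _ _ _ _ (c k ^+ 2)); first exact/measurable_funX/Lone_meas/Lone_U.
  by move=> w; rewrite normrX ler_pXn2r ?nnegrE// UT_bound.
- by move=> k t; exact: Lone_ln.
- by move=> k t; exact: Lone_X.
- by move=> k t; exact: Lone_I.
- exact: Ex_excess_inf.
- exact: (stopped_sq_le_log usualF aM cM M_gt0 M0 aU cU U0 hU (lexx 0) t0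
    (sT k) (boundsMU (k := k)) (mMT k)).
- exact: (stopped_log_le_sq usualF aM cM M_gt0 M0 aU cU U0 hU (lexx 0) t0
    (sT k) (boundsMU (k := k)) (mMT k)).
Qed.

End Core.

(** * The equivalence for everywhere regular versions *)

Lemma le_natr_ceil {R : realType} (x : R) n : (`|Num.ceil x| <= n)%N -> x <= n%:R.
Proof.
move=> xn; apply: le_trans (ceil_ge _) _; rewrite -[n%:R]/(n%:Z%:~R) ler_int.
by apply: le_trans (ler_norm _) _; rewrite -abszE lez_nat.
Qed.

Lemma clip_sq_le {R : realType} (c x : R) : 0 <= c -> clip c x ^+ 2 <= clip c x * x.
Proof.
rewrite /clip expr2 => c0; have [xc|cx] := ltP c x.
  rewrite (@max_r _ _ (- c)); first by rewrite ler_wpM2l// ltW.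
  lra.
by have [h|h] := ltP (- c) x; rewrite // !mulNr lerN2 ler_wpM2l//; lra.
Qed.

Lemma cvg_stopped {R : realType} {d} {Omega : measurableType d} (T : nat -> Omega -> \bar R)
    (Z : R -> Omega -> R) t w :
  (\forall k \near \oo, (t%:E <= T k w)%E) ->
  stopped Z (T k) t w @[k --> \oo] --> Z t w.
Proof.
move=> h; apply: cvg_near_cst; apply: filterS h => k h.
by rewrite /stopped -/(capped (T k) t w) capped_ge.
Qed.

(** * Behaviour of M and I at infinity *)

Section InfiniteHorizon.
Context {R : realType} {d} {Omega : measurableType d} (P : probability Omega R).
Variable F : R -> set (set Omega).
Hypothesis usualF : usual_filtration P F.
Variable M : R -> Omega -> R.
Hypothesis aM : adapted F M.
Hypothesis cM : sure_continuous M.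
Hypothesis M_gt0 : forall t w, 0 <= t -> 0 < M t w.
Hypothesis M0 : forall w, M 0 w = 1.
Let I t w := path_inf (M ^~ w) t.
Hypothesis aI : adapted F I.

Lemma inf_infty_ge0 w : 0 <= inf_infty M w.
Proof.
apply: lb_le_inf; first by exists (M 0 w); exists 0 => //; rewrite /= in_itv/= lexx.
by move=> _ [t + <-]; rewrite /= in_itv/= andbT => t0; apply/ltW/M_gt0.
Qed.

Lemma inf_infty_le_path t w : 0 <= t -> inf_infty M w <= M t w.
Proof.
move=> t0; apply: ge_inf; last by exists t => //; rewrite /= in_itv/= andbT.
by exists 0 => _ [s + <-]; rewrite /= in_itv/= andbT => s0; apply/ltW/M_gt0.
Qed.

Lemma inf_infty_le t w : 0 <= t -> inf_infty M w <= I t w.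
Proof.
move=> t0; have [s /andP[s0 st] h] := path_inf_attained (@cM w) t0.
by rewrite /I h; exact: inf_infty_le_path.
Qed.

Lemma inf_infty_lt w a : inf_infty M w < a -> \forall n \near \oo, I n%:R w < a.
Proof.
move=> h; have hi : has_inf [set M s w | s in `[0, +oo[].
  split; first by exists (M 0 w); exists 0 => //; rewrite /= in_itv/= lexx.
  by exists 0 => _ [s + <-]; rewrite /= in_itv/= andbT => s0; apply/ltW/M_gt0.
have [_ [s + <-] sa] : exists2 x, [set M s w | s in `[0, +oo[] x & x < a.
  have ha : 0 < a - inf_infty M w by rewrite subr_gt0.
  have [x xS hx] := inf_adherent ha hi; exists x => //.
  by apply: lt_le_trans hx _; rewrite -/(inf_infty M w) addrC subrK.
rewrite /= in_itv/= andbT => s0.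
exists (`|Num.ceil s|)%N => // n /= sn; apply: le_lt_trans sa.
apply: path_inf_le => //; first by move=> r; exact: M_gt0.
rewrite s0/=.
exact: le_natr_ceil.
Qed.

Lemma cvg_inf_infty w : I n%:R w @[n --> \oo] --> inf_infty M w.
Proof.
apply/cvgrPdist_lt => e e0; have h : inf_infty M w < inf_infty M w + e by rewrite ltrDl.
apply: filterS (inf_infty_lt h) => n hn.
rewrite ler0_norm; first by lra.
by rewrite subr_le0 inf_infty_le.
Qed.

Lemma measurable_inf_infty : measurable_fun setT (inf_infty M).
Proof.
apply: (@measurable_fun_cvg _ _ _ _ (fun n => I n%:R)) => //.
  by move=> n; exact: (adapted_mfun usualF aI).
by move=> w _; exact: cvg_inf_infty.
Qed.

Lemma ln_inf_inftyE w : lne ((inf_infty M w)%:E^-1) =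
  if inf_infty M w == 0 then +oo%E else (- ln (inf_infty M w))%:E.
Proof.
rewrite inver; case: eqP => // /eqP h.
have i0 : 0 < inf_infty M w by rewrite lt_neqAle eq_sym h inf_infty_ge0.
by rewrite /lne leNgt invr_gt0 i0/= lnV.
Qed.

Lemma measurable_ln_inf_infty :
  measurable_fun setT (fun w => lne ((inf_infty M w)%:E^-1)).
Proof.
have mJ := measurable_inf_infty.
under eq_fun do rewrite ln_inf_inftyE.
apply: measurable_fun_ifT => //.
  exact: measurable_fun_eqr.
by apply/measurable_EFinP; apply: measurable_funN; exact: measurableT_comp.
Qed.

Lemma ln_inf_infty_ge w t : 0 <= t ->
  ((- ln (I t w))%:E <= lne ((inf_infty M w)%:E^-1))%E.
Proof.
move=> t0; rewrite ln_inf_inftyE; case: eqP => [_|/eqP h]; first by rewrite leey.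
have i0 : 0 < inf_infty M w by rewrite lt_neqAle eq_sym h inf_infty_ge0.
by rewrite lee_fin lerN2 ler_ln ?posrE ?inf_infty_le ?(lt_le_trans i0)// inf_infty_le.
Qed.

Lemma ln_inf_infty_ge0 w : (0 <= lne ((inf_infty M w)%:E^-1))%E.
Proof.
by have := ln_inf_infty_ge w (lexx 0); rewrite /I path_inf0// M0 ln1 oppr0.
Qed.

Lemma ln_inf_infty_liminf w : (lne ((inf_infty M w)%:E^-1) <=
  limn_einf (fun n => (- ln (I n%:R w))%:E))%E.
Proof.
suff h : (- ln (I n%:R w))%:E @[n --> \oo] --> lne ((inf_infty M w)%:E^-1).
  rewrite is_cvg_limn_einfE; last by apply/cvg_ex; eexists; exact: h.
  by rewrite (cvg_lim _ h).
have iP n : 0 < I n%:R w by apply: path_inf_gt0 => // r; exact: M_gt0.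
rewrite ln_inf_inftyE; case: eqP => [J0|/eqP h].
  apply/cvgeyPge => A; have : inf_infty M w < expR (- A) by rewrite J0 expR_gt0.
  move=> /inf_infty_lt; apply: filterS => n hn; rewrite lee_fin lerNr.
  by rewrite -[leRHS]expRK ler_ln ?posrE ?expR_gt0 ?ltW.
have i0 : 0 < inf_infty M w by rewrite lt_neqAle eq_sym h inf_infty_ge0.
apply: cvg_EFin; first exact: nearW.
apply: cvgN; apply: (@cvg_comp _ _ _ (fun n => I n%:R w) (@ln R)); first exact: cvg_inf_infty.
exact: continuous_ln.
Qed.

Lemma cvg_lim_infty w : cvg (M t w @[t --> +oo]) ->
  M n%:R w @[n --> \oo] --> lim_infty M w.
Proof. by move=> h; apply: (@cvg_comp _ _ _ (fun n : nat => n%:R : R) (M ^~ w)); [exact: cvgr_idn|exact: h]. Qed.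

Lemma lim_infty_ge0 w : cvg (M t w @[t --> +oo]) -> 0 <= lim_infty M w.
Proof.
move=> /cvg_lim_infty h; apply: (cvgr_to_ge h); apply: nearW => n.
exact/ltW/M_gt0.
Qed.

(** On a bounded interval the path stays above a positive value, so an infimum equal to 0 can only
    be approached at infinity. On these paths the terminal quotient has the form 0 times
    infinity. *)
Lemma lim_infty_eq0 w : cvg (M t w @[t --> +oo]) -> inf_infty M w = 0 -> lim_infty M w = 0.
Proof.
move=> cv J0; apply/eqP; apply: contrapT => /negP l0.
have l1 : 0 < lim_infty M w by rewrite lt_neqAle eq_sym l0 lim_infty_ge0.
have l2 : 0 < lim_infty M w / 2 by rewrite divr_gt0.
have /cvgrPdist_lt/(_ _ l2)[s [sr hs]] : M t w @[t --> +oo] --> lim_infty M w by exact: cv.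
pose s0 := Num.max 0 s.
have s00 : 0 <= s0 by rewrite le_max lexx.
have i0 : 0 < I s0 w by apply: path_inf_gt0 => // r; exact: M_gt0.
have : inf_infty M w < Num.min (lim_infty M w / 2) (I s0 w) by rewrite J0 lt_min l2.
move=> /inf_infty_lt[n _ /(_ n (leqnn n))]/=; apply/negP; rewrite -leNgt.
have [r /andP[r0 rn]] := path_inf_attained (@cM w) (ler0n R n).
rewrite -/(I n%:R w) => ->.
have [rs|sr'] := leP r s0; first by rewrite ge_min path_inf_le ?r0 ?orbT// => q; exact: M_gt0.
have := hs r (le_lt_trans _ sr'); rewrite le_max lexx orbT => /(_ isT).
by rewrite ltr_distlC => /andP[h _]; rewrite ge_min; apply/orP; left; lra.
Qed.

End InfiniteHorizon.

Section Criteria.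
Context {R : realType} {d} {Omega : measurableType d} (P : probability Omega R).
Variable F : R -> set (set Omega).
Hypothesis usualF : usual_filtration P F.
Implicit Types (Z : R -> Omega -> R) (T : Omega -> \bar R) (f g : Omega -> R).

Lemma capped_stopping T t : 0 <= t -> stopping_time F T ->
  stopping_time F (EFin \o capped T t).
Proof.
move=> t0 sT; split=> [w|r r0].
  by rewrite lee_fin; have /andP[] := capped_itv t0 (sT.1 w).
have [tr|rt] := leP t r.
  rewrite (_ : [set w | _] = setT); first exact: (sigmaT (filt_sigma usualF r0)).
  apply/seteqP; split=> // w _ /=; rewrite lee_fin; apply: le_trans tr.
  by have /andP[] := capped_itv t0 (sT.1 w).
rewrite (_ : [set w | _] = [set w | (T w <= r%:E)%E]); first exact: sT.2.
apply/seteqP; split=> w /= h.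
  have [Tt|tT] := leP (T w) t%:E; first by rewrite -(capped_le (sT.1 w) Tt).
  have := h; rewrite lee_fin capped_ge; last exact: ltW.
  by move=> /(lt_le_trans rt); rewrite ltxx.
by rewrite capped_le ?sT.1// (le_trans h)// lee_fin ltW.
Qed.

Lemma cst_stopping t : 0 <= t -> stopping_time F (EFin \o cst t : Omega -> \bar R).
Proof.
move=> t0; split=> [w|r r0]; first by rewrite lee_fin.
have sg := filt_sigma usualF r0.
have [tr|rt] := leP t r.
  rewrite (_ : [set w | _] = setT); first exact: (sigmaT sg).
  by apply/seteqP; split=> // w _ /=; rewrite lee_fin.
rewrite (_ : [set w | _] = set0); first exact: (sigma0 sg).
by apply/seteqP; split=> // w /=; rewrite lee_fin leNgt rt.
Qed.

Lemma cvg_finite_stopping Z (S : Omega -> R) w :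
  stopped Z (EFin \o S) n%:R w @[n --> \oo] --> Z (S w) w.
Proof.
apply: cvg_near_cst; exists (`|Num.ceil (S w)|)%N => // n /= sn.
rewrite /stopped min_r// lee_fin.
exact: le_natr_ceil.
Qed.

Lemma measurable_finite_stopping Z (S : Omega -> R) : adapted F Z -> sure_continuous Z ->
  stopping_time F (EFin \o S) -> measurable_fun setT (fun w => Z (S w) w).
Proof.
move=> aZ cZ sS.
apply: (@measurable_fun_cvg _ _ _ _ (fun n => stopped Z (EFin \o S) n%:R)) => //.
  by move=> n; exact: (adapted_mfun usualF (adapted_stopped usualF aZ cZ sS)).
by move=> w _; exact: cvg_finite_stopping.
Qed.

(** Vitali is applied at the two times of the martingale identity separately, so uniform
    integrability over k at each fixed time suffices. *)
Lemma martingale_of_stopped Z (T : nat -> Omega -> \bar R) : adapted F Z -> sure_continuous Z ->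
  (forall k, martingale P F (stopped Z (T k))) ->
  (forall t w, 0 <= t -> \forall k \near \oo, (t%:E <= T k w)%E) ->
  (forall t, 0 <= t -> ui_tail P (range (fun k => stopped Z (T k) t))) ->
  martingale P F Z.
Proof.
move=> aZ cZ mT ev ui.
have key t : 0 <= t -> [/\ forall k, Lone P (stopped Z (T k) t), Lone P (Z t) &
    forall b g, measurable_fun setT g -> (forall w, `|g w| <= b) ->
      Ex P (fun w => g w * stopped Z (T k) t w) @[k --> \oo] --> Ex P (fun w => g w * Z t w)].
  move=> t0; apply: vitali => [k|w|]; last exact: ui.
    by have [aT _ _] := mT k; exact: (adapted_mfun usualF aT).
  by apply: cvg_stopped; exact: ev.
apply/(martingaleP usualF); split; first exact: aZ.
  by move=> t t0; have [] := key t t0.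
move=> s t E s0 st FE; have t0 := le_trans s0 st; have mE := filt_meas usualF s0 FE.
have [_ _ hs] := key s s0; have [_ _ ht] := key t t0.
have cs := hs _ _ (measurable_indic mE) (abs_indic_le1 E).
have ct := ht _ _ (measurable_indic mE) (abs_indic_le1 E).
rewrite (_ : (fun k => _) = (fun k => Ex P (fun w => \1_E w * stopped Z (T k) t w))) in cs.
  exact: (cvg_unique (@Rhausdorff R) cs ct).
by apply/funext => k; have [_ _ h] := (martingaleP usualF _).1 (mT k); exact: h.
Qed.

Lemma Ex_le_int f K : Lone P f -> (\int[P]_w (f w)%:E <= K%:E)%E -> Ex P f <= K.
Proof. by move=> If; rewrite ExE// lee_fin. Qed.

Lemma Lone_of_int f K : measurable_fun setT f -> (forall w, 0 <= f w) ->
  (\int[P]_w (f w)%:E <= K%:E)%E -> Lone P f.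
Proof.
move=> mf f0 h; apply/integrableP; split; first exact/measurable_EFinP.
rewrite (eq_integral (fun w => (f w)%:E)); first exact: le_lt_trans h (ltry _).
by move=> w _; rewrite gee0_abs// lee_fin.
Qed.

Lemma tail_mono (c x y : R) : `|x| <= `|y| -> tail c x <= tail c y.
Proof. by move=> h; rewrite /tail ge_max !le_max lexx/= lerD2r h orbT. Qed.

Lemma int_tail_mono c f g K : measurable_fun setT f -> measurable_fun setT g ->
  (forall w, `|f w| <= `|g w|) ->
  (\int[P]_w (tail c (g w))%:E <= K)%E -> (\int[P]_w (tail c (f w))%:E <= K)%E.
Proof.
move=> mf mg fg h; apply: le_trans h; apply: ge0_le_integral => //.
- by move=> w _; rewrite lee_fin tail_ge0.
- by apply/measurable_EFinP; exact: measurable_tail.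
- by apply/measurable_EFinP; exact: measurable_tail.
- by move=> w _; rewrite lee_fin tail_mono.
Qed.

End Criteria.

(** * The four conditions compared through a uniform bound on the stopped excess *)

Section Equivalence.
Context {R : realType} {d} {Omega : measurableType d} (P : probability Omega R).
Variable F : R -> set (set Omega).
Hypothesis usualF : usual_filtration P F.
Variables M X U : R -> Omega -> R.
Hypothesis aM : adapted F M.
Hypothesis cM : sure_continuous M.
Hypothesis M_gt0 : forall t w, 0 <= t -> 0 < M t w.
Hypothesis M0 : forall w, M 0 w = 1.
Hypothesis aX : adapted F X.
Hypothesis cX : sure_continuous X.
Hypothesis XE : forall t w, 0 <= t -> X t w = M t w / path_inf (M ^~ w) t - 1.
Hypothesis aU : adapted F U.
Hypothesis cU : sure_continuous U.
Hypothesis U0 : forall w, U 0 w = 0.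
Variable T : nat -> Omega -> \bar R.
Hypothesis redT : reducing P F M X U T.
Let I t w := path_inf (M ^~ w) t.

Let X_ge0 t w : 0 <= t -> 0 <= X t w.
Proof. exact: (excess_ge0 cM M_gt0 XE). Qed.

Let I_gt0 t w : 0 <= t -> 0 < I t w.
Proof. exact: (inf_gt0 cM M_gt0). Qed.

Let aI : adapted F I.
Proof. exact: (adapted_inf usualF aM M_gt0 aX XE). Qed.

Let cI : sure_continuous I.
Proof. exact: (continuous_inf cM M_gt0 cX XE). Qed.

Let I_le1 t w : 0 <= t -> I t w <= 1.
Proof. by move=> t0; rewrite -(M0 w); exact: (inf_le M_gt0 w (lexx 0) t0). Qed.

Let ME t w : 0 <= t -> M t w = I t w * (1 + X t w).
Proof.
by move=> t0; rewrite XE// (addrC 1) subrK mulrCA divff ?mulr1// gt_eqF// I_gt0.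
Qed.

Let M_le t w : 0 <= t -> M t w <= 1 + X t w.
Proof. by move=> t0; rewrite ME// ler_piMl ?I_le1// addr_ge0// X_ge0. Qed.

Let mX t : 0 <= t -> measurable_fun setT (X t).
Proof. exact: (adapted_mfun usualF). Qed.
Let mM t : 0 <= t -> measurable_fun setT (M t).
Proof. exact: (adapted_mfun usualF). Qed.
Let mU t : 0 <= t -> measurable_fun setT (U t).
Proof. exact: (adapted_mfun usualF). Qed.
Let mI t : 0 <= t -> measurable_fun setT (I t).
Proof. exact: (adapted_mfun usualF aI). Qed.

Let T_itv k t w : 0 <= t -> 0 <= capped (T k) t w <= t.
Proof. by move=> t0; apply: capped_itv => //; exact: (reducing_stopping redT k).1. Qed.

Let T_ge0 k t w : 0 <= t -> 0 <= capped (T k) t w.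
Proof. by move=> /(T_itv k w)/andP[]. Qed.

Definition bounded_excess := exists C : R, forall k t, 0 <= t ->
  Ex P (stopped X (T k) t) <= C.

Let ui_stopped : class_D P F X ->
  forall e, 0 < e -> exists2 c, 0 <= c & forall S : Omega -> R, stopping_time F (EFin \o S) ->
    (\int[P]_w (tail c (X (S w) w))%:E <= e%:E)%E.
Proof.
move=> /unif_integrable_tail h e e0.
have [|c c0 hc] := h _ e e0.
  by move=> _ [S sS <-]; exact: (measurable_finite_stopping usualF aX cX sS).
by exists c => // S sS; apply: hc; exists S.
Qed.

Lemma class_D_bounded_excess : class_D P F X -> bounded_excess.
Proof.
move=> /ui_stopped/(_ 1 ltr01)[c c0 hc]; exists (c + 1) => k t t0.
have sT := capped_stopping usualF t0 (reducing_stopping redT k).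
have := hc _ sT; have IX := reducing_X redT k t0.
move=> /(Ex_le_int (Lone_tail c0 IX)) h.
apply: (@le_trans _ _ (Ex P (fun w => c + tail c (stopped X (T k) t w)))).
  apply: Ex_le => //; first by apply: LoneD; [exact: Lone_cst|exact: Lone_tail].
  by move=> w; apply: le_trans (norm_le_tail c _); exact: ler_norm.
by rewrite ExD ?Ex_cst ?lerD2l//; [exact: Lone_cst|exact: Lone_tail].
Qed.

Lemma class_D_ui_martingale : class_D P F X -> ui_martingale P F M.
Proof.
move=> /ui_stopped h.
have {}h e : 0 < e -> exists2 c, 0 <= c & forall S : Omega -> R, stopping_time F (EFin \o S) ->
    (\int[P]_w (tail c (M (S w) w))%:E <= e%:E)%E.
  (* Because M <= 1 + X, the tail of M at level c + 1 lies below the tail of X at level c. *)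
  move=> /h[c c0 hc]; exists (c + 1); first by rewrite addr_ge0.
  move=> S sS; apply: le_trans (hc S sS); apply: ge0_le_integral => //.
  - by move=> w _; rewrite lee_fin tail_ge0.
  - by apply/measurable_EFinP/measurable_tail; exact: (measurable_finite_stopping usualF aM cM sS).
  - by apply/measurable_EFinP/measurable_tail; exact: (measurable_finite_stopping usualF aX cX sS).
  move=> w _; have S0 : 0 <= S w by rewrite -lee_fin; exact: sS.1.
  have x0 := X_ge0 w S0; have m0 := ltW (M_gt0 w S0).
  rewrite lee_fin /tail ge_max !le_max lexx/= (ger0_norm x0) (ger0_norm m0).
  by apply/orP; right; have := M_le w S0; lra.
split.
  apply: (@martingale_of_stopped _ _ _ P F usualF M T) => //.
  - exact: reducing_M redT.
  - by move=> t w; exact: reducing_eventually redT t w.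
  move=> t t0 e /h[c c0 hc]; exists c => // _ [k _ <-].
  exact: hc (capped_stopping usualF t0 (reducing_stopping redT k)).
apply: tail_unif_integrable => [_ [t + <-]|e /h[c c0 hc]].
  by rewrite /= in_itv/= andbT; exact: mM.
exists c => // _ [t + <-]; rewrite /= in_itv/= andbT => t0.
exact: hc (cst_stopping usualF t0).
Qed.

(** Fatou is used twice: along the reducing sequence at a fixed time n, then as n tends to
    infinity. *)
Lemma bounded_excess_log : bounded_excess ->
  (\int[P]_w lne ((inf_infty M w)%:E^-1) < +oo)%E.
Proof.
move=> [C hC]; apply: (@le_lt_trans _ _ C%:E); last exact: ltry.
apply: (@fatou_le _ _ _ P C (fun n w => - ln (I n%:R w))) => //.
- by move=> n; apply: measurable_funN; apply: measurableT_comp => //; exact: mI.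
- by move=> n w; rewrite oppr_ge0 ln_le0// I_le1.
- exact: (measurable_ln_inf_infty usualF cM M_gt0 aI).
- by move=> w; exact: (ln_inf_infty_ge0 cM M_gt0 M0).
- by move=> w; exact: (ln_inf_infty_liminf cM M_gt0 w).
move=> n; apply: (@fatou_cvg _ _ _ P C (fun k => (fun w => - ln (I (capped (T k) n%:R w) w)))) => //.
- by move=> k; exact: Lone_meas (reducing_inf redT k (ler0n _ _)).
- by move=> k w; rewrite oppr_ge0 ln_le0// I_le1// T_ge0.
- move=> w; apply: cvgN.
  exact: (@cvg_stopped _ _ _ T (fun t w => ln (I t w))) (reducing_eventually redT w (ler0n _ _)).
- move=> k; rewrite ExE; last exact: (reducing_inf redT k (ler0n _ _)).
  by rewrite lee_fin -(reducing_excess redT)// hC.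
Qed.

Lemma log_bounded_excess : (\int[P]_w lne ((inf_infty M w)%:E^-1) < +oo)%E ->
  bounded_excess.
Proof.
have g0 w := ln_inf_infty_ge0 cM M_gt0 M0 w.
have mg := measurable_ln_inf_infty usualF cM M_gt0 aI.
move=> fin; have i0 : (0 <= \int[P]_w lne ((inf_infty M w)%:E^-1))%E by apply: integral_ge0 => w _; exact: g0.
exists (fine (\int[P]_w lne ((inf_infty M w)%:E^-1))) => k t t0.
have fn : (\int[P]_w lne ((inf_infty M w)%:E^-1))%E \is a fin_num by rewrite (ge0_fin_numE i0).
rewrite (reducing_excess redT k t0) -lee_fin (fineK fn).
rewrite -ExE; last exact: (reducing_inf redT k t0).
apply: ge0_le_integral => //.
- by move=> w _; rewrite lee_fin oppr_ge0 ln_le0// I_le1// T_ge0.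
- exact/measurable_EFinP/Lone_meas/(reducing_inf redT k t0).
- by move=> w _; apply: (ln_inf_infty_ge cM M_gt0); exact: T_ge0.
Qed.

Let cvg_ae : ui_martingale P F M -> P.-negligible [set w | ~ cvg (M t w @[t --> +oo])].
Proof.
move=> [mgM _]; have := positive_martingale_cvg usualF mgM cM _ M0.
by move=> h; apply: h => t w t0; exact/ltW/M_gt0.
Qed.

(* [zeta] is the terminal value of [1 + X]; division by zero makes it vanish
   where [inf_infty M] does, in accordance with [0 * oo = 0]. *)
Section Terminal.
Hypothesis uiM : ui_martingale P F M.
Let N := [set w | ~ cvg (M t w @[t --> +oo])].
Let nN : P.-negligible N. Proof. exact: cvg_ae. Qed.
Let mN : measurable N. Proof. exact: (negligible_measurable usualF nN). Qed.
(** Where a path does not converge [lim_infty] is a default value; the indicator puts 0 there, which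
    makes this an everywhere pointwise limit and hence measurable. *)
Let Mlim w : R := \1_(~` N) w * lim_infty M w.
Let zeta w := Mlim w / inf_infty M w.

Let M_cvg w : \1_(~` N) w * M n%:R w @[n --> \oo] --> Mlim w.
Proof.
rewrite /Mlim indicE; case: (boolP (w \in ~` N)) => [|_].
  rewrite inE /N /= => /contrapT cv; apply: cvgMr; exact: cvg_lim_infty.
by rewrite mul0r; under eq_fun do rewrite mul0r; exact: cvg_cst.
Qed.

Let mMlim : measurable_fun setT Mlim.
Proof.
apply: (@measurable_fun_cvg _ _ _ _ (fun n w => \1_(~` N) w * M n%:R w)) => //.
by move=> n; apply: measurable_funM; [apply: measurable_indic; exact: measurableC|exact: mM].
Qed.

Let mzeta : measurable_fun setT zeta.
Proof.
apply: measurable_funM => //; apply: (measurableT_comp (@measurable_funV R)).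
exact: (measurable_inf_infty usualF cM M_gt0 aI).
Qed.

Let Mlim_ge0 w : 0 <= Mlim w.
Proof.
rewrite /Mlim indicE; case: (boolP (w \in ~` N)) => [|_]; last by rewrite mul0r.
by rewrite inE /N /= => /contrapT cv; rewrite mul1r; exact: (lim_infty_ge0 M_gt0).
Qed.

Let zeta_ge0 w : 0 <= zeta w.
Proof. by rewrite divr_ge0// (inf_infty_ge0 M_gt0). Qed.

Let terminalE w : ~ N w ->
  ((lim_infty M w)%:E / (inf_infty M w)%:E)%E = (zeta w)%:E.
Proof.
rewrite /N /= => /contrapT cv.
have e : Mlim w = lim_infty M w.
  by rewrite /Mlim indicE mem_set ?mul1r//= /N /=; exact.
rewrite /zeta e inver; case: eqP => [J0|_]; last by rewrite EFinM.
by rewrite (lim_infty_eq0 cM M_gt0 cv J0) !mul0r mul0e.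
Qed.

Let int_zeta : (\int[P]_w ((lim_infty M w)%:E / (inf_infty M w)%:E) = \int[P]_w (zeta w)%:E)%E.
Proof.
have mz : measurable_fun setT (EFin \o zeta) by exact/measurable_EFinP.
by apply/esym/(integral_ae_eq usualF nN _ mz) => w /terminalE.
Qed.

Lemma measurable_terminal : measurable_fun setT
  (fun w => (lim_infty M w)%:E / (inf_infty M w)%:E)%E.
Proof.
have mz : measurable_fun setT (EFin \o zeta) by exact/measurable_EFinP.
by apply: (measurable_fun_ae_eq usualF nN) mz => w /terminalE ->.
Qed.

(** The quotients M_n/I_n = 1 + X_n have bounded means, by Fatou along the reducing sequence, and a
    second Fatou reaches the terminal quotient. *)
Lemma bounded_excess_terminal : bounded_excess ->
  (\int[P]_w ((lim_infty M w)%:E / (inf_infty M w)%:E) < +oo)%E.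
Proof.
move=> [C hC]; rewrite int_zeta; apply: (@le_lt_trans _ _ (1 + C)%:E); last exact: ltry.
have mJ := measurable_inf_infty usualF cM M_gt0 aI.
pose J0 := [set w | inf_infty M w = 0].
have mJ0 : measurable J0.
  by rewrite -[J0]setTI; exact: (mJ measurableT [set 0] (measurable_set1 0)).
(* Where I_oo = 0 the quotients M_n/I_n need not tend to the conventional value 0, so they are
   replaced by 0 on that event. *)
pose f n w : R := \1_(~` J0) w * (\1_(~` N) w * M n%:R w / I n%:R w).
have mf n : measurable_fun setT (f n).
  apply: measurable_funM; first by apply: measurable_indic; exact: measurableC.
  apply: measurable_funM; last by apply: (measurableT_comp (@measurable_funV R)); exact: mI.
  by apply: measurable_funM; [apply: measurable_indic; exact: measurableC|exact: mM].
have ind_itv (A : set Omega) w : 0 <= (\1_A w : R) <= 1 by rewrite indicE; case: (_ \in _); rewrite /= ?lexx ?ler01.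
have f0 n w : 0 <= f n w.
  rewrite mulr_ge0// ?divr_ge0 ?mulr_ge0//; do ?by have /andP[] := ind_itv (~` J0) w.
  - exact/ltW/M_gt0.
  - exact/ltW/I_gt0.
apply: (@fatou_cvg _ _ _ P _ f) => // [w|n].
  have [J00|J00] := eqVneq (inf_infty M w) 0.
    rewrite /zeta J00 invr0 mulr0 /f indicE memNset; last by apply.
    by under eq_fun do rewrite mul0r; exact: cvg_cst.
  rewrite /f indicE mem_set; last by move/eqP; rewrite (negbTE J00).
  under eq_fun do rewrite mul1r.
  apply: cvgM; first exact: M_cvg.
  by apply: cvgV => //; exact: (cvg_inf_infty cM M_gt0).
have IXn k : Lone P (fun w => 1 + stopped X (T k) n%:R w).
  by apply: LoneD; [exact: Lone_cst|exact: (reducing_X redT)].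
apply: (@le_trans _ _ (\int[P]_w (1 + X n%:R w)%:E)%E).
  apply: ge0_le_integral => //.
  - by move=> w _; rewrite lee_fin f0.
  - exact/measurable_EFinP.
  - by apply/measurable_EFinP; apply: measurable_funD => //; exact: mX.
  move=> w _; rewrite lee_fin (_ : 1 + _ = M n%:R w / I n%:R w); last first.
    by rewrite XE// addrC subrK.
  have q0 : 0 <= M n%:R w / I n%:R w by rewrite divr_ge0 ?ltW ?M_gt0 ?I_gt0.
  have /andP[a0 a1] := ind_itv (~` J0) w; have /andP[b0 b1] := ind_itv (~` N) w.
  rewrite /f -mulrA mulrA; exact: ler_piMl.
apply: (@fatou_cvg _ _ _ P _ (fun k w => 1 + stopped X (T k) n%:R w)) => //.
- by move=> k; exact: Lone_meas (IXn k).
- by move=> k w; rewrite addr_ge0// X_ge0// T_ge0.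
- move=> w; apply: cvgD; first exact: cvg_cst.
  exact: cvg_stopped (reducing_eventually redT w (ler0n _ _)).
move=> k; rewrite ExE// lee_fin ExD ?Ex_cst ?lerD2l ?hC//; first exact: Lone_cst.
exact: (reducing_X redT).
Qed.

(** A uniformly integrable martingale is closed by its limit: the identity holds between s and every
    n >= s, and Vitali lets n tend to infinity. *)
Let Ex_Mlim s b g : 0 <= s -> rv_measurable (F s) g -> (forall w, `|g w| <= b) ->
  Lone P Mlim /\ Ex P (fun w => g w * M s w) = Ex P (fun w => g w * Mlim w).
Proof.
move=> s0 mg gb; have [mgM ui] := uiM.
have mC f : [set M t | t in `[0, +oo[] f -> measurable_fun setT f.
  by move=> [t + <-]; rewrite /= in_itv/= andbT; exact: mM.
have mg' := rv_mfun (filt_meas usualF s0) mg.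
have mf n : measurable_fun setT (fun w => \1_(~` N) w * M n%:R w : R).
  by apply: measurable_funM; [apply: measurable_indic; exact: measurableC|exact: mM].
have := @vitali _ _ _ P (fun n w => \1_(~` N) w * M n%:R w) Mlim mf M_cvg.
case=> [e e0|If IMl cv].
  have [c c0 hc] := unif_integrable_tail mC ui e0.
  exists c => // _ [n _ <-]; apply: int_tail_mono (mf n) (mM (ler0n R n)) _ (hc _ _).
    by move=> w; rewrite normrM ler_piMl// abs_indic_le1.
  by exists n%:R => //; rewrite /= in_itv/= andbT.
split=> //; have {}cv := cv b g mg' gb.
apply: (cvg_unique (@Rhausdorff R) _ cv).
apply: cvg_near_cst; exists (`|Num.ceil s|)%N => // n /= sn.
have sn' : s <= n%:R.
  exact: le_natr_ceil.
rewrite -(martingale_orth usualF mgM s0 sn' mg gb).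
apply: (Ex_ae_eq usualF nN).
  by move=> w Nw; rewrite indicE mem_set ?mul1r.
by apply: LoneM_bdd (If n) mg' gb.
Qed.

(** 1/I_s is truncated at n to become a bounded test function, against which M_s may be exchanged
    for its limit; then 1/I_s <= 1/I_oo, and where I_oo = 0 the limit of M is 0 as well. Fatou
    removes the truncation. *)
Let dominated s E : Lone P zeta -> 0 <= s -> F s E ->
  (\int[P]_w (\1_E w * (1 + X s w))%:E <= (Ex P (fun w => \1_E w * zeta w))%:E)%E.
Proof.
move=> Iz s0 FE; have sF := filt_sigma usualF s0; have mE := filt_meas usualF s0 FE.
pose g (n : nat) w : R := \1_E w * Num.min (I s w)^-1 n%:R.
have mg n : rv_measurable (F s) (g n).
  apply: (rvM sF); first exact: rv_indic.
  by apply: (rv_min sF); [apply: (rvV sF); exact: aI|exact: (rv_cst sF)].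
have m0 n w : 0 <= Num.min (I s w)^-1 n%:R by rewrite le_min invr_ge0 ler0n andbT; exact/ltW/I_gt0.
have g0 n w : 0 <= g n w by rewrite mulr_ge0.
have gb n w : `|g n w| <= n%:R.
  rewrite ger0_norm// /g -[leRHS]mul1r ler_pM ?ler0n//.
  by rewrite ge_min lexx orbT.
have Ms0 w : 0 <= M s w by exact/ltW/M_gt0.
apply: (@fatou_cvg _ _ _ P _ (fun n w => g n w * M s w)) => //.
- by move=> n; apply: measurable_funM; [exact: (rv_mfun (filt_meas usualF s0))|exact: mM].
- by move=> n w; rewrite mulr_ge0.
- move=> w; apply: cvg_near_cst; exists (`|Num.ceil (I s w)^-1|)%N => // n /= sn.
  rewrite /g min_l; first by rewrite XE// (addrC 1) subrK mulrAC mulrA.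
  exact: le_natr_ceil.
move=> n; have [IMl e] := Ex_Mlim s0 (mg n) (gb n).
have [mgM _] := uiM.
rewrite ExE; last exact: LoneM_bdd (martingale_Lone usualF mgM s0) (rv_mfun (filt_meas usualF s0) (mg n)) (gb n).
rewrite lee_fin e; apply: Ex_le.
- exact: LoneM_bdd IMl (rv_mfun (filt_meas usualF s0) (mg n)) (gb n).
- exact: LoneM_bdd Iz (measurable_indic mE) (abs_indic_le1 E).
move=> w; rewrite /g -mulrA ler_wpM2l//.
have [J0|J0] := eqVneq (inf_infty M w) 0.
  suff -> : Mlim w = 0 by rewrite mulr0.
  rewrite /Mlim indicE; case: (boolP (w \in ~` N)) => [|_]; last by rewrite mul0r.
  by rewrite inE /N /= => /contrapT cv; rewrite (lim_infty_eq0 cM M_gt0 cv J0) mulr0.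
have J1 : 0 < inf_infty M w by rewrite lt_neqAle eq_sym J0 (inf_infty_ge0 M_gt0).
rewrite /zeta mulrC ler_wpM2l// ge_min; apply/orP; left.
by rewrite lef_pV2 ?posrE ?I_gt0// (inf_infty_le cM M_gt0).
Qed.

(** Domination by [zeta] gives 1 + X a tail bound uniform over stopping times on bounded horizons. A
    finite stopping time is the limit of its caps at n, and Fatou carries the bound over. *)
Lemma terminal_class_D :
  (\int[P]_w ((lim_infty M w)%:E / (inf_infty M w)%:E) < +oo)%E -> class_D P F X.
Proof.
rewrite int_zeta => fin.
have Iz : Lone P zeta.
  apply/integrableP; split; first exact/measurable_EFinP.
  rewrite (eq_integral (fun w => (zeta w)%:E))// => w _.
  by rewrite gee0_abs// lee_fin.
pose Z t w := 1 + X t w.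
have aZ : adapted F Z.
  by move=> t t0; have sF := filt_sigma usualF t0; apply: (rvD sF); [exact: (rv_cst sF)|exact: aX].
have cZ : sure_continuous Z by move=> w; apply: cpathD; [exact: cpath_cst|exact: cX].
have Z0 t w : 0 <= t -> 0 <= Z t w by move=> t0; rewrite addr_ge0// X_ge0.
have IZ t : 0 <= t -> Lone P (Z t).
  move=> t0; apply: (@Lone_of_int _ _ _ P _ (Ex P zeta)).
  - exact: (adapted_mfun usualF aZ).
  - by move=> w; exact: Z0.
  have := dominated Iz t0 (sigmaT (filt_sigma usualF t0)).
  rewrite (eq_integral (fun w => (Z t w)%:E)); last by move=> w _; rewrite indicT mul1r.
  by move=> /le_trans; apply; rewrite lee_fin le_eqVlt; apply/orP; left; apply/eqP/eq_Ex => w; rewrite indicT mul1r.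
have domZ t E : 0 <= t -> F t E ->
    Ex P (fun w => \1_E w * `|Z t w|) <= Ex P (fun w => \1_E w * zeta w).
  move=> t0 FE; have mE := filt_meas usualF t0 FE.
  have := dominated Iz t0 FE; rewrite ExE.
    by rewrite lee_fin; apply: le_trans; rewrite le_eqVlt; apply/orP; left; apply/eqP/eq_Ex => w; rewrite ger0_norm// Z0.
  exact: LoneM_bdd (IZ t t0) (measurable_indic mE) (abs_indic_le1 E).
apply: tail_unif_integrable => [_ [S sS <-]|e e0].
  exact: (measurable_finite_stopping usualF aX cX sS).
have [c c0 hc] := stopped_dominated_ui usualF Iz zeta_ge0 e0.
exists c => // _ [S sS <-].
have mS := measurable_finite_stopping usualF aX cX sS.
have mZS := measurable_finite_stopping usualF aZ cZ sS.
apply: int_tail_mono mS mZS _ _.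
  move=> w; have S0 : 0 <= S w by rewrite -lee_fin; exact: sS.1.
  by rewrite !ger0_norm ?X_ge0 ?Z0// /Z lerDr.
apply: (@fatou_cvg _ _ _ P _ (fun n w => tail c (stopped Z (EFin \o S) n%:R w))) => //.
- by move=> n; apply: measurable_tail; exact: (adapted_mfun usualF (adapted_stopped usualF aZ cZ sS)).
- by move=> n w; exact: tail_ge0.
- move=> w; apply: (@cvg_comp _ _ _ (fun n => stopped Z (EFin \o S) n%:R w) (tail c)).
    exact: cvg_finite_stopping.
  exact: tail_continuous.
- by move=> n; apply: hc => // r E /andP[r0 _]; exact: domZ.
Qed.
End Terminal.

(** Since M >= I, -E log M is at most E log(1/I), that is E X <= C, at every stopped time; the
    second moments of U are then at most 8 C. This also makes the stopped values of U uniformly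
    integrable, whence the martingale property. *)
Lemma bounded_excess_L2 : bounded_excess -> L2_bounded_martingale P F U.
Proof.
move=> [C hC].
have C0 : 0 <= C.
  by apply: le_trans (hC 0%N 0 (lexx 0)); apply: Ex_ge0 => w; exact/X_ge0/T_ge0.
have lnC k t : 0 <= t -> - Ex P (fun w => ln (stopped M (T k) t w)) <= C.
  move=> t0; apply: le_trans (hC k t t0).
  rewrite (reducing_excess redT k t0) -[leLHS]mulN1r -ExZ; last exact: (reducing_ln redT).
  apply: Ex_le; [exact/LoneZ/(reducing_ln redT)|exact: (reducing_inf redT)|] => w.
  have c0 := T_ge0 k w t0.
  rewrite mulN1r lerN2 ler_ln ?posrE ?I_gt0 ?M_gt0//.
  exact: (inf_le M_gt0 w c0 (lexx _)).
have sqC k t : 0 <= t -> Ex P (fun w => stopped U (T k) t w ^+ 2) <= 8 * C.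
  rewrite le_eqVlt => /predU1P[<-|t0].
    rewrite (_ : (fun w => _) = fun=> 0); first by rewrite Ex_cst mulr_ge0.
    apply/funext => w; rewrite /stopped -/(capped (T k) 0 w) capped_ge ?U0 ?expr0n//.
    exact: (reducing_stopping redT k).1.
  apply: le_trans (reducing_sq_le redT k t0) _; rewrite ler_pM2l//.
  exact/lnC/ltW.
have mUT k t : 0 <= t -> measurable_fun setT (stopped U (T k) t).
  exact: (adapted_mfun usualF (adapted_stopped usualF aU cU (reducing_stopping redT k))).
split; last first.
  exists (8 * C) => t t0.
  apply: (@fatou_cvg _ _ _ P _ (fun k w => stopped U (T k) t w ^+ 2)) => //.
  - by move=> k; apply: measurable_funX; exact: mUT.
  - by move=> k w; exact: sqr_ge0.
  - move=> w; rewrite expr2; under eq_fun do rewrite expr2.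
    by apply: cvgM; exact: cvg_stopped (reducing_eventually redT w t0).
  - by move=> k; rewrite ExE ?lee_fin ?sqC//; exact: (reducing_U_sq redT).
apply: (@martingale_of_stopped _ _ _ P F usualF U T) => //.
- exact: reducing_U redT.
- by move=> t w; exact: reducing_eventually redT t w.
move=> t t0 e e0.
(* The tail at level c is at most x^2/c, so the mean tail is at most 8 C / c; the summand 1 makes c
   positive. *)
pose c := (`|8 * C| + 1) / e.
have c0 : 0 < c by rewrite divr_gt0// ltr_wpDl.
exists c; first exact: ltW.
move=> _ [k _ <-].
have I2 := reducing_U_sq redT k t0.
apply: (@le_trans _ _ (\int[P]_w (c^-1 * stopped U (T k) t w ^+ 2)%:E)%E).
  apply: ge0_le_integral => //.
  - by move=> w _; rewrite lee_fin tail_ge0.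
  - by apply/measurable_EFinP; apply: measurable_tail; exact: mUT.
  - by apply/measurable_EFinP; exact: Lone_meas (LoneZ _ I2).
  move=> w _; rewrite lee_fin /tail ge_max mulr_ge0 ?invr_ge0 ?(ltW c0) ?sqr_ge0//=.
  rewrite -real_normK ?num_real// ler_pdivlMl//.
  move: (`|_|) => x; have := sqr_ge0 (x - c / 2); rewrite !expr2; nra.
rewrite ExE; last exact: LoneZ.
rewrite lee_fin ExZ// ler_pdivrMl//.
apply: le_trans (sqC k t t0) _; rewrite /c mulfVK ?gt_eqF//.
by apply: le_trans (ler_norm _) _; rewrite lerDl.
Qed.

(** The bound on E U^2 at deterministic times has to be moved to the stopped times first, which
    takes the submartingale property of U^2. *)
Lemma L2_bounded_excess : L2_bounded_martingale P F U -> bounded_excess.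
Proof.
move=> [mgU [K hK]].
have I2 t : 0 <= t -> Lone P (fun w => U t w ^+ 2).
  move=> t0; apply: Lone_of_int (hK t t0) => [|w]; last exact: sqr_ge0.
  by apply: measurable_funX; exact: mU.
have E2 t : 0 <= t -> Ex P (fun w => U t w ^+ 2) <= K.
  by move=> t0; exact: Ex_le_int (I2 t t0) (hK t t0).
have jensen r t E : 0 <= r -> r <= t -> F r E ->
    Ex P (fun w => \1_E w * `|U r w ^+ 2|) <= Ex P (fun w => \1_E w * U t w ^+ 2).
  move=> r0 rt FE; have t0 := le_trans r0 rt; have rF := filt_sigma usualF r0.
  have mE := filt_meas usualF r0 FE.
  have IE f : Lone P f -> Lone P (fun w => \1_E w * f w).
    by move=> If; exact: LoneM_bdd If (measurable_indic mE) (abs_indic_le1 E).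
  (* U r is not bounded and cannot serve as a test function; its truncation g can, and 2 g U_t - g^2
     <= U_t^2 gives the inequality for g^2, from which Fatou removes the truncation. *)
  pose g (n : nat) w := clip n%:R (U r w).
  have mg n : measurable_fun setT (g n) by apply: measurable_clip; exact: mU.
  have gb n w : `|g n w| <= n%:R by exact: norm_clip_le.
  suff h : (\int[P]_w (\1_E w * U r w ^+ 2)%:E <= (Ex P (fun w => \1_E w * U t w ^+ 2))%:E)%E.
    move: h; rewrite ExE; last exact/IE/I2.
    rewrite lee_fin; apply: le_trans; rewrite le_eqVlt; apply/orP; left.
    by apply/eqP/eq_Ex => w; rewrite ger0_norm ?sqr_ge0.
  apply: (@fatou_cvg _ _ _ P _ (fun n w => \1_E w * g n w ^+ 2)) => //.
  - by move=> n; apply: measurable_funM; [exact: measurable_indic|exact: measurable_funX].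
  - by move=> n w; rewrite mulr_ge0// sqr_ge0.
  - move=> w; apply: cvg_near_cst; pose a := Num.norm (U r w).
    exists (`|Num.ceil a|)%N => // n /= sn.
    suff -> : g n w = U r w by [].
    apply/eqP; rewrite eq_sym -subr_eq0 -normr_eq0 norm_sub_clip// /tail.
    rewrite max_l// subr_le0; exact: le_natr_ceil.
  move=> n.
  have Ig : Lone P (fun w => \1_E w * g n w ^+ 2).
    apply: IE; apply: (@Lone_bdd _ _ _ _ (n%:R ^+ 2)); first exact: measurable_funX.
    by move=> w; rewrite normrX ler_pXn2r ?nnegrE.
  have orth : Ex P (fun w => (\1_E w * g n w) * U t w) = Ex P (fun w => (\1_E w * g n w) * U r w).
    apply: (martingale_orth usualF mgU r0 rt (c := n%:R)).
      apply: (rvM rF); first exact: rv_indic.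
      apply: (rv_comp rF (h := clip n%:R)); last exact: aU.
      by apply: continuous_measurable_fun; exact: clip_continuous.
    move=> w; rewrite normrM -[leRHS]mul1r ler_pM ?normr_ge0//; exact: abs_indic_le1.
  have Ib q : 0 <= q -> Lone P (fun w => (\1_E w * g n w) * U q w).
    move=> q0; apply: (LoneM_bdd (c := n%:R) (martingale_Lone usualF mgU q0)).
      by apply: measurable_funM => //; exact: measurable_indic.
    move=> w; rewrite normrM -[leRHS]mul1r ler_pM ?normr_ge0//; exact: abs_indic_le1.
  rewrite ExE// lee_fin.
  have h1 : Ex P (fun w => \1_E w * g n w ^+ 2) <= Ex P (fun w => (\1_E w * g n w) * U r w).
    by apply: Ex_le => [//||w]; [exact: Ib|rewrite -mulrA ler_wpM2l// clip_sq_le].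
  have h2 : 2 * Ex P (fun w => (\1_E w * g n w) * U t w) - Ex P (fun w => \1_E w * g n w ^+ 2) <=
      Ex P (fun w => \1_E w * U t w ^+ 2).
    rewrite -ExZ; last exact: Ib.
    rewrite -ExB; [|exact/LoneZ/Ib|exact: Ig].
    apply: Ex_le; [by apply: LoneB; [exact/LoneZ/Ib|exact: Ig]|exact/IE/I2|] => w.
    rewrite (_ : _ - _ = \1_E w * (2 * g n w * U t w - g n w ^+ 2)); last by ring.
    rewrite ler_wpM2l//; have := sqr_ge0 (g n w - U t w); rewrite sqrrB.
    by move: (g n w) (U t w) => x y; rewrite -mulr_natl; lra.
  by move: h1 h2; rewrite orth; lra.
have sqK k t : 0 <= t -> Ex P (fun w => stopped U (T k) t w ^+ 2) <= K.
  move=> t0; apply: le_trans (E2 t t0); rewrite -lee_fin -ExE; last exact: (reducing_U_sq redT).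
  rewrite (eq_integral (fun w => (`|stopped U (T k) t w ^+ 2|)%:E)); last first.
    by move=> w _; rewrite ger0_norm// sqr_ge0.
  apply: (stopped_dominated_le usualF (Z := fun t w => U t w ^+ 2) (I2 t t0)) => //.
  - by move=> w; exact: sqr_ge0.
  - by move=> q q0; have sF := filt_sigma usualF q0; apply: (rvX sF); exact: aU.
  - by move=> w; apply: eq_cpath (cpathM (@cU w) (@cU w)) => q q0; rewrite expr2.
  - exact: (reducing_stopping redT).
  - by move=> r E /andP[r0 rt] FE; exact: jensen.
(* E X <= 1 - 2 E log M and -E log M <= 2 E U^2 <= 2 K. Time 0 is separate because the comparison of
   log M with U^2 is stated for t > 0. *)
exists (1 + 4 * K) => k t; rewrite le_eqVlt => /predU1P[<-|t0].
  have K0 : 0 <= K by apply: le_trans (E2 0 (lexx 0)); apply: Ex_ge0 => w; exact: sqr_ge0.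
  rewrite (eq_Ex _ (g := fun=> 0)); first by rewrite Ex_cst; lra.
  move=> w; rewrite /stopped -/(capped (T k) 0 w) capped_ge; last exact: (reducing_stopping redT k).1.
  by rewrite XE// path_inf0// M0 divr1 subrr.
have t0' := ltW t0.
have h1 := reducing_ln_le redT k t0; have h2 := sqK k t t0'.
have IX := reducing_X redT k t0'; have Il := reducing_ln redT k t0'.
have h3 : Ex P (stopped X (T k) t) <= Ex P (fun w => 2^-1 * (1 + stopped X (T k) t w) - ln (stopped M (T k) t w)).
  rewrite (reducing_excess redT k t0').
  apply: Ex_le; first exact: (reducing_inf redT).
    by apply: LoneB => //; apply: LoneZ; apply: LoneD => //; exact: Lone_cst.
  move=> w; have c0 := T_ge0 k w t0'; rewrite /stopped -/(capped (T k) t w).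
  have x0 := X_ge0 w c0; have i0 := I_gt0 w c0.
  rewrite ME// lnM ?posrE ?I_gt0//; last by rewrite ltr_wpDr.
  (* The bound ln y <= y - 1 is applied to (1+X)/2; the resulting ln 2 is absorbed by the -1. The
     factor 1/2 is what allows E X to be moved to the other side. *)
  have y0 : 0 < 2^-1 * (1 + X (capped (T k) t w) w) by rewrite mulr_gt0// ltr_wpDr.
  have e := ln_le_sub1 y0.
  have l2 : ln (2 : R) <= 1 by have := @ln_le_sub1 R 2 (ltr0n _ 2); lra.
  move: e; rewrite lnM ?posrE ?invr_gt0 ?ltr_wpDr// lnV ?posrE// => e.
  by rewrite -/(I _ w); lra.
move: h3; rewrite ExB; [|by apply: LoneZ; apply: LoneD => //; exact: Lone_cst|exact: Il].
rewrite ExZ; last by apply: LoneD => //; exact: Lone_cst.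
rewrite ExD//; last exact: Lone_cst.
by rewrite Ex_cst; lra.
Qed.

(** Every condition implies [bounded_excess], and together with uniform integrability of M the
    latter implies every condition; the return to class (D) always goes through the terminal
    quotient. *)
Lemma sure_equivalence :
  [<-> class_D P F X;
       ui_martingale P F M /\
         (\int[P]_w ((lim_infty M w)%:E / (inf_infty M w)%:E) < +oo)%E;
       ui_martingale P F M /\
         (\int[P]_w lne ((inf_infty M w)%:E^-1) < +oo)%E;
       ui_martingale P F M /\ L2_bounded_martingale P F U].
Proof.
tfae.
- move=> h; have uiM := class_D_ui_martingale h; split=> //.
  exact: (bounded_excess_terminal uiM (class_D_bounded_excess h)).
- move=> [uiM h]; split=> //.
  exact/bounded_excess_log/class_D_bounded_excess/(terminal_class_D uiM h).
- by move=> [uiM h]; split=> //; exact/bounded_excess_L2/log_bounded_excess.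
- move=> [uiM h]; apply: (terminal_class_D uiM).
  exact: (bounded_excess_terminal uiM (L2_bounded_excess h)).
Qed.

End Equivalence.

(** * Passage to regular versions *)

Section Amendment.
Context {R : realType} {d} {Omega : measurableType d} (P : probability Omega R).
Variable F : R -> set (set Omega).
Hypothesis usualF : usual_filtration P F.
Variable B : set Omega.
Hypothesis nB : P.-negligible B.
Implicit Types (Z : R -> Omega -> R) (f g : Omega -> R).

(** The two preimages differ only inside [B], and all subsets of [B] belong to [F t]. *)
Lemma rv_ae_eq t f g : 0 <= t -> (forall w, ~ B w -> f w = g w) ->
  rv_measurable (F t) f -> rv_measurable (F t) g.
Proof.
move=> t0 fg mf S mS; have sF := filt_sigma usualF t0.
have FB : F t B by exact: (filt_null usualF).
rewrite (_ : g @^-1` S = (f @^-1` S `\` B) `|` (g @^-1` S `&` B)).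
  apply: (sigmaU sF); first exact: (sigmaD sF (mf _ mS)).
  by apply: (filt_null usualF t0); apply: negligibleS nB; exact: subIsetr.
apply/seteqP; split=> w.
  move=> gS; have [wB|wB] := pselect (B w); [by right|left; split=> //].
  by rewrite /preimage /= fg.
by case=> [[fS wB]|[]//]; rewrite /preimage /= -fg.
Qed.

Lemma adapted_ae_eq Z Z' : (forall t w, 0 <= t -> ~ B w -> Z t w = Z' t w) ->
  adapted F Z -> adapted F Z'.
Proof.
move=> ZZ aZ t t0; apply: (rv_ae_eq t0 (f := Z t)); last exact: aZ.
by move=> w wB; exact: ZZ.
Qed.

(** The shift c makes up for the initial value that [localized] subtracts from the stopped
    process. *)
Lemma martingale_ae_eq Z Z' (c : R) :
  (forall t w, 0 <= t -> ~ B w -> Z t w + c = Z' t w) ->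
  martingale P F Z -> martingale P F Z'.
Proof.
move=> ZZ mZ; have [aZ IZ h] := (martingaleP usualF _).1 mZ.
have aZc : adapted F (fun t w => Z t w + c).
  by move=> t t0; have sF := filt_sigma usualF t0; apply: (rvD sF); [exact: aZ|exact: (rv_cst sF)].
have IZc t : 0 <= t -> Lone P (fun w => Z t w + c).
  by move=> t0; apply: LoneD; [exact: IZ|exact: Lone_cst].
have IZ' t : 0 <= t -> Lone P (Z' t).
  by move=> t0; apply: (Lone_ae_eq usualF nB _ (IZc t t0)) => w; exact: ZZ.
apply/(martingaleP usualF); split; [exact: (adapted_ae_eq ZZ)|exact: IZ'|].
move=> s t E s0 st FE; have t0 := le_trans s0 st; have mE := filt_meas usualF s0 FE.
have IE f : Lone P f -> Lone P (fun w => \1_E w * f w).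
  by move=> If; exact: LoneM_bdd If (measurable_indic mE) (abs_indic_le1 E).
have e r : 0 <= r -> Ex P (fun w => \1_E w * Z' r w) =
    Ex P (fun w => \1_E w * Z r w) + Ex P (fun w => \1_E w * c).
  move=> r0; rewrite -ExD; [|exact/IE/IZ|exact/IE/Lone_cst].
  apply/esym/(Ex_ae_eq usualF nB).
    by move=> w wB; rewrite -ZZ// mulrDr.
  by apply: LoneD; [exact/IE/IZ|exact/IE/Lone_cst].
by rewrite (e s s0) (e t t0) (h s t E s0 st FE).
Qed.

Lemma unif_integrable_ae_eq (C C' : set (Omega -> R)) :
  (forall f, C f -> exists f', [/\ C' f', measurable_fun setT f' & forall w, ~ B w -> f' w = f w]) ->
  (forall f, C' f -> measurable_fun setT f) ->
  unif_integrable P C' -> unif_integrable P C.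
Proof.
move=> CC mC' /(unif_integrable_tail mC') h.
apply: tail_unif_integrable => [f /CC[f' [_ mf' ff]]|e /h[c c0 hc]].
  exact: (measurable_fun_ae_eq usualF nB ff mf').
exists c => // f /CC[f' [Cf' mf' ff]].
rewrite -(integral_ae_eq usualF nB (f := fun w => (tail c (f' w))%:E)).
- exact: hc.
- by move=> w /ff ->.
- exact/measurable_EFinP/measurable_tail.
Qed.

Lemma ui_martingale_ae_eq Z Z' : (forall t w, 0 <= t -> ~ B w -> Z t w = Z' t w) ->
  ui_martingale P F Z -> ui_martingale P F Z'.
Proof.
move=> ZZ [mZ ui]; split.
  by apply: (martingale_ae_eq (c := 0)) mZ => t w t0 wB; rewrite addr0 ZZ.
have aZ : adapted F Z by have [] := mZ.
apply: unif_integrable_ae_eq ui => [_ [t + <-]|_ [t + <-]]; rewrite /= in_itv/= andbT => t0.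
  exists (Z t); split; [by exists t => //; rewrite /= in_itv/= andbT| |by move=> w; exact: ZZ].
  exact: (adapted_mfun usualF).
exact: (adapted_mfun usualF).
Qed.

Lemma L2_bounded_ae_eq Z Z' : (forall t w, 0 <= t -> ~ B w -> Z t w = Z' t w) ->
  L2_bounded_martingale P F Z -> L2_bounded_martingale P F Z'.
Proof.
move=> ZZ [mZ [K hK]]; split.
  by apply: (martingale_ae_eq (c := 0)) mZ => t w t0 wB; rewrite addr0 ZZ.
have aZ : adapted F Z by have [] := mZ.
exists K => t t0; rewrite -(integral_ae_eq usualF nB (f := fun w => (Z t w ^+ 2)%:E)).
- exact: hK.
- by move=> w wB; rewrite ZZ.
- by apply/measurable_EFinP; apply: measurable_funX; exact: (adapted_mfun usualF).
Qed.

(** On the exceptional set the whole path is replaced by a constant, so that pathwise properties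
    hold everywhere. *)
Definition amend (c : R) Z : R -> Omega -> R := fun t w => if w \in B then c else Z t w.

Lemma amend_in c Z t w : B w -> amend c Z t w = c.
Proof. by move=> wB; rewrite /amend mem_set. Qed.

Lemma amend_out c Z t w : ~ B w -> amend c Z t w = Z t w.
Proof. by move=> wB; rewrite /amend memNset. Qed.

Lemma adapted_amend c Z : adapted F Z -> adapted F (amend c Z).
Proof. by apply: adapted_ae_eq => t w _ wB; rewrite amend_out. Qed.

Lemma continuous_amend c Z : (forall w, ~ B w -> {within `[0, +oo[, continuous (Z ^~ w)}) ->
  sure_continuous (amend c Z).
Proof.
move=> cZ w; have [wB|wB] := pselect (B w).
  by apply: (@eq_cpath _ (fun=> c)) => [t _|]; [rewrite amend_in|exact: cpath_cst].
by apply: (@eq_cpath _ (Z ^~ w)) => [t _|]; [rewrite amend_out|exact/within_cpath/cZ].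
Qed.

Lemma localizable_amend c Z (tau : nat -> Omega -> \bar R) : adapted F Z ->
  (forall w, ~ B w -> {within `[0, +oo[, continuous (Z ^~ w)}) ->
  (forall w, ~ B w -> Z 0 w = c) ->
  (forall n, stopping_time F (tau n)) ->
  (forall w, ~ B w -> tau n w @[n --> \oo] --> +oo%E) ->
  (forall n, martingale P F (fun t w => stopped Z (tau n) t w - Z 0 w)) ->
  localizable P F (amend c Z).
Proof.
move=> aZ cZ Z0 stau tauy mtau; exists tau; split=> //.
  move=> w t t0; have [wB|wB] := pselect (B w).
    by apply: nearW => n; rewrite /stopped !amend_in.
  have /cvgeyPge/(_ t) := tauy w wB; apply: filterS => n tn.
  by rewrite /stopped -/(capped (tau n) t w) capped_ge.
move=> n; apply: (martingale_ae_eq (c := c)) (mtau n) => t w t0 wB.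
by rewrite /stopped amend_out// Z0// subrK.
Qed.

Lemma class_D_ae_eq Z Z' : adapted F Z -> sure_continuous Z ->
  (forall t w, 0 <= t -> ~ B w -> Z t w = Z' t w) -> class_D P F Z <-> class_D P F Z'.
Proof.
move=> aZ cZ ZZ.
have mZS (S : Omega -> R) : stopping_time F (EFin \o S) -> measurable_fun setT (fun w => Z (S w) w).
  exact: (measurable_finite_stopping usualF aZ cZ).
have ZS S w : stopping_time F (EFin \o S) -> ~ B w -> Z (S w) w = Z' (S w) w.
  by move=> sS wB; apply: ZZ => //; rewrite -lee_fin; exact: sS.1.
have mZS' (S : Omega -> R) : stopping_time F (EFin \o S) -> measurable_fun setT (fun w => Z' (S w) w).
  by move=> sS; apply: (measurable_fun_ae_eq usualF nB) (mZS S sS) => w; exact: ZS.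
split; apply: unif_integrable_ae_eq => _ [S sS <-]; try exact: mZS; try exact: mZS'.
  by exists (fun w => Z (S w) w); split; [exists S|exact: mZS|move=> w; exact: ZS].
exists (fun w => Z' (S w) w); split; [by exists S|exact: mZS'|move=> w wB].
by rewrite ZS.
Qed.

End Amendment.

Theorem proposition2p14 (R : realType) (d : measure_display)
    (Omega : measurableType d) (P : probability Omega R)
    (F : R -> set (set Omega)) (usualF : usual_filtration P F)
    (X N A M U : R -> Omega -> R)
    (XNA : Sigma_decomposition P F X N A)
    (M_clm : continuous_local_martingale P F M)
    (M_gt0 : {ae P, forall w, forall t, 0 <= t -> 0 < M t w})
    (M_0 : {ae P, forall w, M 0 w = 1})
    (XMI : {ae P, forall w, forall t, 0 <= t ->
              X t w = M t w / running_inf M t w - 1})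
    (U_int : is_stochastic_integral P F (fun t w => (M t w)^-1) M U) :
  is_stochastic_integral P F (fun t w => (1 + X t w)^-1) N U /\
  [<-> class_SigmaD P F X;
       ui_martingale P F M /\
         (\int[P]_w ((lim_infty M w)%:E / (inf_infty M w)%:E) < +oo)%E;
       ui_martingale P F M /\
         (\int[P]_w lne ((inf_infty M w)%:E^-1) < +oo)%E;
       ui_martingale P F M /\ L2_bounded_martingale P F U].
Proof.
have [_ [aX _] X_NA [[aN [tauN [stauN _ tauNy mN]]] cN] N_0 [aA cA A_inc] A_0 _] := XNA.
have [[aM [tauM [stauM _ tauMy mM]]] cM] := M_clm.
have [[aMV cMV] [aU cU] U_0 hU] := U_int.
(* All almost sure hypotheses are gathered so that one negligible set serves every process and every
   localizing sequence. *)
pose good w := [/\ [/\ forall t, 0 <= t -> 0 < M t w, M 0 w = 1,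
    forall t, 0 <= t -> X t w = M t w / running_inf M t w - 1 &
    {within `[0, +oo[, continuous (M ^~ w)}],
  [/\ forall t, 0 <= t -> X t w = N t w + A t w, N 0 w = 0, A 0 w = 0,
    {within `[0, +oo[, continuous (N ^~ w)} & {within `[0, +oo[, continuous (A ^~ w)}],
  forall s t, 0 <= s -> s <= t -> A s w <= A t w,
  U 0 w = 0 /\ {within `[0, +oo[, continuous (U ^~ w)} &
  tauN n w @[n --> \oo] --> +oo%E /\ tauM n w @[n --> \oo] --> +oo%E].
have good_ae : {ae P, forall w, good w}.
  apply: negligibleS (negligibleU M_gt0 (negligibleU M_0 (negligibleU XMI (negligibleU cM
    (negligibleU X_NA (negligibleU N_0 (negligibleU A_0 (negligibleU cN (negligibleU cA
    (negligibleU A_inc (negligibleU U_0 (negligibleU cU (negligibleU tauNy tauMy))))))))))))).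
  move=> w ng; apply: contrapT.
  do 13! [move=> /not_orP[/contrapT ?]]; move=> /contrapT ?; apply: ng.
  by split.
pose B := [set w | ~ good w].
have nB : P.-negligible B := good_ae.
have gB w : ~ B w -> good w by move=> /contrapT.
(* The constants 1 for M and 0 for the others are compatible with all the relations: 1/1 - 1 = 0 = 0
   + 0, and the initial values are respected. *)
pose M' := amend B 1 M; pose X' := amend B 0 X; pose N' := amend B 0 N.
pose A' := amend B 0 A; pose U' := amend B 0 U.
have outM t w : ~ B w -> M' t w = M t w by exact: amend_out.
have outX t w : ~ B w -> X' t w = X t w by exact: amend_out.
have outN t w : ~ B w -> N' t w = N t w by exact: amend_out.
have outA t w : ~ B w -> A' t w = A t w by exact: amend_out.
have outU t w : ~ B w -> U' t w = U t w by exact: amend_out.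
have inM t w : B w -> M' t w = 1 by exact: amend_in.
have inX t w : B w -> X' t w = 0 by exact: amend_in.
have inN t w : B w -> N' t w = 0 by exact: amend_in.
have inA t w : B w -> A' t w = 0 by exact: amend_in.
have inU t w : B w -> U' t w = 0 by exact: amend_in.
have aM' : adapted F M' by exact: (adapted_amend usualF nB).
have aX' : adapted F X' by exact: (adapted_amend usualF nB).
have aN' : adapted F N' by exact: (adapted_amend usualF nB).
have aU' : adapted F U' by exact: (adapted_amend usualF nB).
have cM' : sure_continuous M' by apply: continuous_amend => w /gB[[]].
have cN' : sure_continuous N' by apply: continuous_amend => w /gB[_ []].
have cA' : sure_continuous A' by apply: continuous_amend => w /gB[_ []].
have cU' : sure_continuous U' by apply: continuous_amend => w /gB[_ _ _ []].
have M'_gt0 t w : 0 <= t -> 0 < M' t w.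
  move=> t0; have [wB|wB] := pselect (B w); first by rewrite inM.
  by rewrite outM//; have [[h _ _ _] _ _ _ _] := gB w wB; exact: h.
have M'0 w : M' 0 w = 1.
  have [wB|wB] := pselect (B w); first by rewrite inM.
  by rewrite outM//; have [[_ h _ _] _ _ _ _] := gB w wB; exact: h.
have N'0 w : N' 0 w = 0.
  have [wB|wB] := pselect (B w); first by rewrite inN.
  by rewrite outN//; have [_ [_ h _ _ _] _ _ _] := gB w wB; exact: h.
have A'0 w : A' 0 w = 0.
  have [wB|wB] := pselect (B w); first by rewrite inA.
  by rewrite outA//; have [_ [_ _ h _ _] _ _ _] := gB w wB; exact: h.
have U'0 w : U' 0 w = 0.
  have [wB|wB] := pselect (B w); first by rewrite inU.
  by rewrite outU//; have [_ _ _ [h _] _] := gB w wB; exact: h.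
have XNA' t w : 0 <= t -> X' t w = N' t w + A' t w.
  move=> t0; have [wB|wB] := pselect (B w); first by rewrite inX// inN// inA// addr0.
  by rewrite outX// outN// outA//; have [_ [h _ _ _ _] _ _ _] := gB w wB; exact: h.
have A'_inc s t w : 0 <= s -> s <= t -> A' s w <= A' t w.
  move=> s0 st; have [wB|wB] := pselect (B w); first by rewrite !inA.
  by rewrite !outA//; have [_ _ h _ _] := gB w wB; exact: h.
have pathM w : ~ B w -> M' ^~ w = M ^~ w by move=> wB; apply/funext => t; exact: outM.
have XE' t w : 0 <= t -> X' t w = M' t w / path_inf (M' ^~ w) t - 1.
  move=> t0; have [wB|wB] := pselect (B w).
    rewrite inX// inM//; have [s /andP[s0 st] ->] := path_inf_attained (cM' w) t0.
    by rewrite inM// divr1 subrr.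
  by rewrite outX// outM// pathM//; have [[_ _ h _] _ _ _ _] := gB w wB; exact: h.
have cX' : sure_continuous X'.
  move=> w; apply: (@eq_cpath _ (fun t => N' t w + A' t w)) => [t t0|]; first by rewrite XNA'.
  exact: cpathD.
have locM' : localizable P F M'.
  apply: (localizable_amend usualF nB (tau := tauM)) => // w /gB[].
  - by move=> [].
  - by move=> [].
  - by move=> _ _ _ _ [].
have locN' : localizable P F N'.
  apply: (localizable_amend usualF nB (tau := tauN)) => // w /gB[].
  - by move=> _ [].
  - by move=> _ [].
  - by move=> _ _ _ _ [].
have hU' (J : nat -> simple_integrand F) :
    ucp_cvg P (fun n => si_process (J n)) (fun t w => (M' t w)^-1) ->
    ucp_cvg P (fun n => si_integral (J n) M') U'.
  have aV : adapted F (fun t w => (M' t w)^-1).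
    by move=> t t0; apply: (rvV (filt_sigma usualF t0)); exact: aM'.
  have cV : sure_continuous (fun t w => (M' t w)^-1).
    by move=> w; apply: cpathV => [t t0|]; [rewrite gt_eqF// M'_gt0|exact: cM'].
  have e1 : ucp_cvg P (fun n => si_process (J n)) (fun t w => (M' t w)^-1) <->
      ucp_cvg P (fun n => si_process (J n)) (fun t w => (M t w)^-1).
    apply: (ucp_ae_eq usualF nB) => [n t e|w wB n s s0]; last by rewrite outM.
    exact: (measurable_sup_si_process usualF (J n) t e aV cV).
  have e2 : ucp_cvg P (fun n => si_integral (J n) M') U' <->
      ucp_cvg P (fun n => si_integral (J n) M) U.
    apply: (ucp_ae_eq usualF nB) => [n t e|w wB n s s0].
      exact: (measurable_sup_si_integral usualF (J n) t e aM' cM' aU' cU').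
    rewrite /si_integral outU//; congr (_ - _); apply: eq_bigr => k _.
    by rewrite !outM.
  by move=> /e1/hU/e2.
have [T redT] := exists_reducing usualF aM' cM' M'_gt0 M'0 locM' aX' cX' XE' aN' cN' aU' cU' U'0 hU' N'0.
have tfae' := sure_equivalence usualF aM' cM' M'_gt0 M'0 aX' cX' XE' aU' cU' U'0 redT.
split; last first.
  have aI := adapted_inf usualF aM' M'_gt0 aX' XE'.
  (* The given N and A witness class (Sigma), so only class (D) is at stake. *)
  have eX : class_SigmaD P F X = class_D P F X'.
    have [h1 h2] := class_D_ae_eq usualF nB aX' cX' (Z' := X) (fun t w _ => @outX t w).
    by apply/propext; split=> [[_ /h2]//|/h1 h]; split=> //; exists N, A.
  have eM : ui_martingale P F M = ui_martingale P F M'.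
    by apply/propext; split; apply: (ui_martingale_ae_eq usualF nB) => t w _ wB; rewrite outM.
  have eU : L2_bounded_martingale P F U = L2_bounded_martingale P F U'.
    by apply/propext; split; apply: (L2_bounded_ae_eq usualF nB) => t w _ wB; rewrite outU.
  have eI w : ~ B w -> inf_infty M' w = inf_infty M w.
    by move=> wB; rewrite /inf_infty; congr inf; apply: eq_imagel => t _; exact: outM.
  have eL w : ~ B w -> lim_infty M' w = lim_infty M w.
    by move=> wB; rewrite /lim_infty (_ : (fun t => M' t w) = fun t => M t w)//; exact: pathM.
  have el : (\int[P]_w lne ((inf_infty M w)%:E^-1) = \int[P]_w lne ((inf_infty M' w)%:E^-1))%E.
    apply/esym/(integral_ae_eq usualF nB) => [w wB|]; first by rewrite eI.
    exact: (measurable_ln_inf_infty usualF cM' M'_gt0 aI).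
  (* Measurability of the terminal quotient rests on the almost sure convergence of M, so this
     equality is stated under the martingale condition, which accompanies the integral in the
     theorem. *)
  have et : ui_martingale P F M' ->
      (\int[P]_w ((lim_infty M w)%:E / (inf_infty M w)%:E) =
       \int[P]_w ((lim_infty M' w)%:E / (inf_infty M' w)%:E))%E.
    move=> uiM; apply/esym/(integral_ae_eq usualF nB) => [w wB|]; first by rewrite eI// eL.
    exact: (measurable_terminal usualF aM' cM' M'_gt0 M'0 aX' XE' uiM).
  have e2 : (ui_martingale P F M' /\
      (\int[P]_w ((lim_infty M w)%:E / (inf_infty M w)%:E) < +oo)%E) =
    (ui_martingale P F M' /\
      (\int[P]_w ((lim_infty M' w)%:E / (inf_infty M' w)%:E) < +oo)%E).
    by apply/propext; split=> -[uiM h]; split=> //; move: h; rewrite (et uiM).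
  by rewrite eX eM eU el e2.
have aV : adapted F (fun t w => (1 + X' t w)^-1).
  move=> t t0; have sF := filt_sigma usualF t0; apply: (rvV sF).
  by apply: (rvD sF); [exact: (rv_cst sF)|exact: aX'].
have cV : sure_continuous (fun t w => (1 + X' t w)^-1).
  move=> w; apply: cpathV => [t t0|]; last by apply: cpathD; [exact: cpath_cst|exact: cX'].
  by rewrite gt_eqF// ltr_wpDr// (excess_ge0 cM' M'_gt0 XE').
split=> //.
- split.
    by apply: (adapted_ae_eq usualF nB _ aV) => t w _ wB; rewrite outX.
  apply: negligibleS nB => w /= h; apply: contrapT => wB; apply: h.
  have := cpath_within (cV w).
  by rewrite (_ : (fun t => (1 + X' t w)^-1) = fun t => (1 + X t w)^-1)//; apply/funext => t; rewrite outX.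
move=> J hJ.
have e1 : ucp_cvg P (fun n => si_process (J n)) (fun t w => (1 + X' t w)^-1) <->
    ucp_cvg P (fun n => si_process (J n)) (fun t w => (1 + X t w)^-1).
  apply: (ucp_ae_eq usualF nB) => [n t e|w wB n s s0]; last by rewrite outX.
  exact: (measurable_sup_si_process usualF (J n) t e aV cV).
(* The integral is first computed for the explicit process M/I + log I - 1; the uniqueness of the
   decomposition then identifies it with N. *)
pose L t w := log_excess M' t w - 1.
have aI := adapted_inf usualF aM' M'_gt0 aX' XE'.
have cI := continuous_inf cM' M'_gt0 cX' XE'.
have aL : adapted F L.
  move=> t t0; have sF := filt_sigma usualF t0.
  apply: (rvB sF); [exact: (adapted_log_excess usualF)|exact: (rv_cst sF)].
have cL : sure_continuous L.
  by move=> w; apply: cpathB; [exact: continuous_log_excess|exact: cpath_cst].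
have IX t w : 0 <= t -> (1 + X' t w)^-1 = path_inf (M' ^~ w) t / M' t w.
  by move=> t0; rewrite XE'// (addrC 1) subrK invf_div.
have LE t w : 0 <= t -> L t w = M' t w / path_inf (M' ^~ w) t + ln (path_inf (M' ^~ w) t) - 1 by [].
have key := ucp_integral_excess usualF aM' cM' M'_gt0 aI cI LE IX aV cV aL cL aU' cU' hU' (e1.2 hJ).
have nD := decomposition_unique usualF aM' cM' M'_gt0 M'0 locM' aX' cX' XE' aN' cN' aU' cU' U'0 N'0 locN' XNA' A'_inc A'0.
have e2 : ucp_cvg P (fun n => si_integral (J n) L) U' <->
    ucp_cvg P (fun n => si_integral (J n) N) U.
  apply: (ucp_ae_eq usualF (negligibleU nB nD)) => [n t e|w /not_orP[wB /contrapT hN] n s s0].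
    exact: (measurable_sup_si_integral usualF (J n) t e aL cL aU' cU').
  rewrite /si_integral outU//; congr (_ - _); apply: eq_bigr => k _.
  have tk0 q : 0 <= Num.min (si_time (J n) q) s by rewrite le_min (ltW s0) si_time_nneg.
  have LN r : 0 <= r -> L r w = N r w by move=> r0; rewrite -(outN _ _ wB) hN.
  by rewrite !LN.
exact/e2.
Qed.
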